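(* Let $a>0$ and for $b,c>0$ put $\Phi(x)={}_1F_2\left(a\,;b,c\,;-\frac{x^2}{4}\right)$. Let $\Lambda=\left\{\left(a+\frac12,\,2a\right),\,\left(2a,\,a+\frac12\right)\right\}$ and let $P_a$ be the Newton diagram associated to $\Lambda$, i.e. the convex hull of $\bigcup_{(\alpha,\beta)\in\Lambda}\{(x,y)\in\mathbb{R}^2: x\ge\alpha,\ y\ge\beta\}$. Let $O_a\subset(0,\infty)^2$ be the set of points $(b,c)$ defined as follows: if $a\ge\frac12$, $$O_a=\left\{(b,c): a<b<a+\tfrac12,\ c\ge 3a+\tfrac12-b\right\}\cup\left\{(b,c): 2a<b<2a+\tfrac12,\ 3a+\tfrac12-b\le c<a+\tfrac12\right\}\cup\left\{(b,c): b\ge 2a+\tfrac12,\ a<c<a+\tfrac12\right\};$$ if $0<a<\frac12$, $$O_a=\left\{(b,c): a<b<2a,\ c\ge 3a+\tfrac12-b\right\}\cup\left\{(b,c): a+\tfrac12<b<2a+\tfrac12,\ 3a+\tfrac12-b\le c<2a\right\}\cup\left\{(b,c): b\ge 2a+\tfrac12,\ a<c<2a\right\}.$$ Let $N_a$ be the complement of $P_a\cup O_a$ in $(0,\infty)^2$. Then: (i) If $(b,c)\in P_a$, then $\Phi(x)\ge0$ for all $x>0$, and $\Phi(x)>0$ for all $x>0$ unless $(b,c)\in\Lambda$. (ii) If $(b,c)\in N_a$, then $\Phi$ alternates in sign and possesses at least one zero on $(0,\infty)$.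
   Context: For $a,b,c>0$, ${}_1F_2\left(a\,;b,c\,;-\frac{x^2}{4}\right)=\sum_{k=0}^\infty \frac{(a)_k}{k!\,(b)_k(c)_k}\left(-\frac{x^2}{4}\right)^k$, where $(\alpha)_k=\Gamma(\alpha+k)/\Gamma(\alpha)$. ''Alternates in sign'' means takes both positive and negative values on $(0,\infty)$. *)

(* Defs.v *)
From Stdlib Require Import Reals Lra Arith Factorial.
From Coquelicot Require Import Coquelicot.
Open Scope R_scope.

Fixpoint poch (alpha : R) (k : nat) : R :=
  match k with
  | O => 1
  | S k' => poch alpha k' * (alpha + INR k')
  end.

Definition F12_term (a b c x : R) (k : nat) : R :=
  poch a k / (INR (Factorial.fact k) * poch b k * poch c k) * (- x ^ 2 / 4) ^ k.

Definition Phi (a b c x : R) : R := Series (F12_term a b c x).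

Definition convex2 (C : R * R -> Prop) : Prop :=
  forall p q t, 0 <= t <= 1 -> C p -> C q ->
    C (t * fst p + (1 - t) * fst q, t * snd p + (1 - t) * snd q).

Definition conv_hull (S : R * R -> Prop) (p : R * R) : Prop :=
  forall C, convex2 C -> (forall q, S q -> C q) -> C p.

Definition Lambda (a : R) (p : R * R) : Prop :=
  p = (a + 1/2, 2 * a) \/ p = (2 * a, a + 1/2).

Definition P_a (a : R) (p : R * R) : Prop :=
  conv_hull (fun q => exists al be, Lambda a (al, be) /\ al <= fst q /\ be <= snd q) p.

Definition O_a (a : R) (p : R * R) : Prop :=
  let b := fst p in let c := snd p in
  0 < b /\ 0 < c /\
  (if Rle_dec (1/2) a then
     (a < b < a + 1/2 /\ 3*a + 1/2 - b <= c)
     \/ (2*a < b < 2*a + 1/2 /\ 3*a + 1/2 - b <= c < a + 1/2)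
     \/ (2*a + 1/2 <= b /\ a < c < a + 1/2)
   else
     (a < b < 2*a /\ 3*a + 1/2 - b <= c)
     \/ (a + 1/2 < b < 2*a + 1/2 /\ 3*a + 1/2 - b <= c < 2*a)
     \/ (2*a + 1/2 <= b /\ a < c < 2*a)).

Definition N_a (a : R) (p : R * R) : Prop :=
  0 < fst p /\ 0 < snd p /\ ~ P_a a p /\ ~ O_a a p.

Definition alternates_in_sign (f : R -> R) : Prop :=
  (exists x, 0 < x /\ 0 < f x) /\ (exists y, 0 < y /\ f y < 0).

(* Main.v *)
(* With [y = x^2/4] the functions are power series in [y], and [th = y d/dy] satisfies
   [(th + p) g = y^(1-p) (y^p g)'].  Hence if [(th + p) g >= 0] and [g(0) >= 0] then [g >= 0], so
   nonnegativity survives multiplying the coefficients by [(p+d+k)/(p+k)]; a limit of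
   products of such factors is [(p)_k/(p+d)_k], so it also survives raising [b] or [c].

   Part (i): on the segment [b + c = 3a + 1/2] joining the two points of [Lambda], Gasper's
   expansion writes [Phi] as a sum of squares of Bessel functions with nonnegative coefficients;
   the rest of [P_a] is reached by raising.

   Part (ii): [N_a] is the set where [b <= a], or [c <= a], or [b + c < 3a + 1/2].  If [b <= a]
   and [Phi >= 0], raising [b] to [a] would make a Bessel function nonnegative.  In the last case,
   with [a < b], assume [Phi >= 0] and test it against [x^(n-1) e^(-x/K) cos(tau x)], [tau] being
   slightly larger than the frequency [1] of the oscillation of [Phi].  Positivity gives
   [Phi = O(x^(-2a+eps))] on average, so the integral is [O(K^(n-2a+eps))].  On the other hand [Phi]
   comes by two raisings from [cos x - x/(2c) sin x], whose test integral is explicit, and this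
   bounds the integral below by a multiple of [K^(n+1/2+a-b-c)]. *)
Require Import Defs.
From Stdlib Require Import Reals Lra Lia Psatz Classical.
From Coquelicot Require Import Coquelicot.
Open Scope R_scope.

(** * Entire power series and the operator [y d/dy] *)

(** At infinity [Phi] behaves like a multiple of [x^(-2a)] plus an oscillation of size
    [x^(a+1/2-b-c)]; the two orders agree exactly on [b + c = 3a + 1/2], and below that line the
    oscillation wins. No asymptotic expansion is proved: the test integrals compare the two orders
    by inequalities alone. Raising is classically an average of [g(t y)] against a Beta density in
    [t]; the limit of finite products replaces that integral, so neither Gamma nor Beta functions
    occur. To carry a lower bound for a test integral through raisings, the base function is dilated
    by [r] in [0,1] and the integral is read as a power series in [r^2]. It is bounded below by a
    multiple of the single monomial [r^(2K)] minus a constant, and raising acts on a monomial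
    through its multiplier at index [K], of order [K^(-d)]. The base is not [cos x], because raising
    [1/2] directly to [c] would require [c >= 1/2]; with the numerator parameter [c + 1] present,
    the first raising goes from [1/2] to [c + 1]. *)

Definition entire_seq (al : nat -> R) : Prop :=
  exists M D, 0 <= M /\ 0 <= D /\
    forall k, Rabs (al k) <= M * D ^ k / INR (Factorial.fact k).

Lemma ex_series_exp_bound (M D : R) :
  ex_series (fun k => M * D ^ k / INR (Factorial.fact k)).
Proof.
  assert (H : ex_series (fun k => scal M (/ INR (Factorial.fact k) * D ^ k))).
  { apply (ex_series_scal (V := R_NormedModule) M).
    exists (exp D). apply is_series_Reals. unfold exp.
    destruct (exist_exp D) as [l Hl]; exact Hl. }
  revert H. apply ex_series_ext. intros k.
  unfold scal; simpl; unfold mult; simpl. field. apply INR_fact_neq_0.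
Qed.

Lemma entire_seq_pow (al : nat -> R) (y : R) :
  entire_seq al ->
  exists M D, 0 <= M /\ 0 <= D /\
    forall k, Rabs (al k * y ^ k) <= M * D ^ k / INR (Factorial.fact k).
Proof.
  intros (M & D & HM & HD & H).
  exists M, (D * Rabs y). split; [easy|split].
  - apply Rmult_le_pos; auto using Rabs_pos.
  - intros k. rewrite Rabs_mult, <- RPow_abs, Rpow_mult_distr.
    replace (M * (D ^ k * Rabs y ^ k) / INR (Factorial.fact k))
      with (M * D ^ k / INR (Factorial.fact k) * Rabs y ^ k)
      by (field; apply INR_fact_neq_0).
    apply Rmult_le_compat_r; [apply pow_le, Rabs_pos | apply H].
Qed.

Lemma entire_seq_ex_abs (al : nat -> R) (y : R) :
  entire_seq al -> ex_series (fun k => Rabs (al k * y ^ k)).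
Proof.
  intros H. destruct (entire_seq_pow al y H) as (M & D & _ & _ & HB).
  apply (@ex_series_le R_AbsRing R_CompleteNormedModule) with (2 := ex_series_exp_bound M D).
  intros k. unfold norm; simpl; unfold abs; simpl. rewrite Rabs_Rabsolu. apply HB.
Qed.

Lemma entire_seq_ex (al : nat -> R) (y : R) :
  entire_seq al -> ex_series (fun k => al k * y ^ k).
Proof. intros H. apply ex_series_Rabs, entire_seq_ex_abs, H. Qed.

Lemma entire_seq_ex_pseries (al : nat -> R) (y : R) :
  entire_seq al -> ex_pseries al y.
Proof. intros H. apply ex_pseries_R, entire_seq_ex, H. Qed.

Lemma entire_seq_radius (al : nat -> R) (y : R) :
  entire_seq al -> Rbar_lt (Rabs y) (CV_radius al).
Proof.
  intros H.
  apply Rbar_lt_le_trans with (Rabs y + 1); [simpl; lra|].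
  apply (proj1 (Lub_Rbar_correct (CV_disk al))).
  apply entire_seq_ex_abs, H.
Qed.

Lemma entire_seq_ext (al be : nat -> R) :
  (forall k, al k = be k) -> entire_seq al -> entire_seq be.
Proof.
  intros E (M & D & HM & HD & H). exists M, D. repeat split; try easy.
  intros k. rewrite <- E. apply H.
Qed.

(** Factorial domination is used in place of an infinite radius of convergence because it is visibly
    stable under bounded multipliers; division by [p + k] and raising are of this kind. *)
Lemma entire_seq_mult_bounded (m al : nat -> R) (C : R) :
  (forall k, Rabs (m k) <= C) -> entire_seq al ->
  entire_seq (fun k => al k * m k).
Proof.
  intros Hm (M & D & HM & HD & H).
  assert (0 <= C) by (eapply Rle_trans; [apply Rabs_pos | apply (Hm O)]).
  exists (M * C), D. repeat split; auto.
  - now apply Rmult_le_pos.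
  - intros k. rewrite Rabs_mult.
    replace (M * C * D ^ k / INR (Factorial.fact k))
      with (M * D ^ k / INR (Factorial.fact k) * C)
      by (field; apply INR_fact_neq_0).
    apply Rmult_le_compat; auto using Rabs_pos.
Qed.

Lemma INR_le_pow2 (k : nat) : INR k <= 2 ^ k.
Proof.
  induction k as [|k IH]; [simpl; lra|].
  rewrite S_INR. simpl. assert (1 <= 2 ^ k) by (apply pow_R1_Rle; lra). lra.
Qed.

Lemma entire_seq_plus (al be : nat -> R) :
  entire_seq al -> entire_seq be -> entire_seq (fun k => al k + be k).
Proof.
  intros (M & D & HM & HD & H) (M' & D' & HM' & HD' & H').
  exists (M + M'), (Rmax D D').
  assert (HDD : 0 <= Rmax D D') by (eapply Rle_trans; [apply HD | apply Rmax_l]).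
  repeat split; try lra.
  intros k. eapply Rle_trans; [apply Rabs_triang|].
  unfold Rdiv. rewrite !Rmult_plus_distr_r.
  assert (Hf : 0 < / INR (Factorial.fact k)) by apply Rinv_0_lt_compat, INR_fact_lt_0.
  apply Rplus_le_compat; (eapply Rle_trans; [first [apply H | apply H']|]);
    apply Rmult_le_compat_r; try lra; apply Rmult_le_compat_l; auto;
    apply pow_incr; split; auto using Rmax_l, Rmax_r.
Qed.

Lemma entire_seq_mult_INR (al : nat -> R) :
  entire_seq al -> entire_seq (fun k => INR k * al k).
Proof.
  intros (M & D & HM & HD & H). exists M, (2 * D). repeat split; try lra.
  intros k. rewrite Rabs_mult, (Rabs_pos_eq (INR k)) by apply pos_INR.
  rewrite Rpow_mult_distr.
  replace (M * (2 ^ k * D ^ k) / INR (Factorial.fact k))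
    with (2 ^ k * (M * D ^ k / INR (Factorial.fact k)))
    by (field; apply INR_fact_neq_0).
  apply Rmult_le_compat; auto using pos_INR, Rabs_pos, INR_le_pow2.
Qed.

Lemma entire_seq_scal (C : R) (al : nat -> R) :
  entire_seq al -> entire_seq (fun k => C * al k).
Proof.
  intros H. apply entire_seq_ext with (fun k => al k * C); [intros; ring|].
  now apply (entire_seq_mult_bounded (fun _ => C) al (Rabs C)); [intros; lra|].
Qed.

Lemma entire_seq_div (p : R) (al : nat -> R) :
  0 < p -> entire_seq al -> entire_seq (fun k => al k / (p + INR k)).
Proof.
  intros Hp H.
  apply (entire_seq_mult_bounded (fun k => / (p + INR k)) al (/ p)); auto.
  intros k. assert (Hk := pos_INR k).
  rewrite Rabs_pos_eq by (left; apply Rinv_0_lt_compat; lra).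
  apply Rinv_le_contravar; lra.
Qed.

Lemma entire_seq_single (K : nat) (C : R) :
  entire_seq (fun k => if Nat.eqb k K then C else 0).
Proof.
  exists (Rabs C * INR (Factorial.fact K)), 1.
  assert (Hf := INR_fact_lt_0 K). assert (Hc := Rabs_pos C).
  repeat split; try lra; [nra|].
  intros k. rewrite pow1, Rmult_1_r.
  destruct (Nat.eqb_spec k K) as [->|].
  - right. field. lra.
  - rewrite Rabs_R0. apply Rmult_le_pos; [nra|].
    left. apply Rinv_0_lt_compat, INR_fact_lt_0.
Qed.

Lemma PSeries_entire_linear (al be : nat -> R) (A B y : R) :
  entire_seq al -> entire_seq be ->
  PSeries (fun k => A * al k + B * be k) y = A * PSeries al y + B * PSeries be y.
Proof.
  intros Ha Hb. unfold PSeries.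
  rewrite <- (Series_scal_l A), <- (Series_scal_l B), <- Series_plus.
  - apply Series_ext; intros; ring.
  - apply (ex_series_ext (fun k => (A * al k) * y ^ k)); [intros; simpl; ring|].
    apply entire_seq_ex, entire_seq_scal, Ha.
  - apply (ex_series_ext (fun k => (B * be k) * y ^ k)); [intros; simpl; ring|].
    apply entire_seq_ex, entire_seq_scal, Hb.
Qed.

Lemma PSeries_single (K : nat) (C y : R) :
  PSeries (fun k => if Nat.eqb k K then C else 0) y = C * y ^ K.
Proof.
  unfold PSeries.
  apply is_series_unique, is_series_Reals. intros eps Heps. exists K. intros n Hn.
  assert (E : sum_f_R0 (fun k => (if Nat.eqb k K then C else 0) * y ^ k) n = C * y ^ K).
  { induction n as [|n IH].
    - replace K with O by lia. simpl. ring.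
    - rewrite tech5. destruct (Nat.eqb_spec (S n) K) as [<-|Hne].
      + rewrite (sum_eq _ (fun _ => 0)).
        * rewrite sum_eq_R0; [ring|auto].
        * intros i Hi. destruct (Nat.eqb_spec i (S n)); [lia|ring].
      + rewrite IH by lia. ring. }
  rewrite E. unfold Rdist. rewrite Rminus_diag, Rabs_R0. exact Heps.
Qed.

Lemma PSeries_entire_theta (be : nat -> R) (y : R) :
  entire_seq be ->
  is_derive (PSeries be) y (PSeries (PS_derive be) y) /\
  y * PSeries (PS_derive be) y = PSeries (fun k => INR k * be k) y.
Proof.
  intros H. split.
  - apply is_derive_PSeries, entire_seq_radius, H.
  - rewrite <- PSeries_incr_1. apply PSeries_ext.
    intros [|k]; unfold PS_incr_1, PS_derive; [simpl; rewrite Rmult_0_l|]; reflexivity.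
Qed.

Lemma PSeries_entire_continuous (be : nat -> R) (y : R) :
  entire_seq be -> continuity_pt (PSeries be) y.
Proof. intros H. apply PSeries_continuity, entire_seq_radius, H. Qed.

Lemma nondecreasing_of_derive (f df : R -> R) (s t : R) :
  s <= t ->
  (forall x, s <= x <= t -> is_derive f x (df x)) ->
  (forall x, s <= x <= t -> 0 <= df x) -> f s <= f t.
Proof.
  intros Hst Hd Hp.
  destruct (MVT_gen f s t df) as (c & Hc & E).
  - intros x Hx. rewrite Rmin_left, Rmax_right in Hx by lra. apply Hd; lra.
  - intros x Hx. rewrite Rmin_left, Rmax_right in Hx by lra.
    apply derivable_continuous_pt. exists (df x).
    apply is_derive_Reals, Hd; lra.
  - rewrite Rmin_left, Rmax_right in Hc by lra.
    specialize (Hp c Hc). nra.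
Qed.

Lemma is_derive_Rpower (p y : R) :
  0 < y -> is_derive (fun s => Rpower s p) y (p * Rpower y p / y).
Proof.
  intros Hy. apply is_derive_Reals.
  replace (p * Rpower y p / y) with (p * Rpower y (p - 1)).
  - apply derivable_pt_lim_power, Hy.
  - unfold Rminus. rewrite Rpower_plus, Rpower_Ropp, Rpower_1 by auto. field. lra.
Qed.

Lemma Rpower_pos (x p : R) : 0 < Rpower x p.
Proof. apply exp_pos. Qed.

Lemma pos_near_0 (f : R -> R) (Y : R) :
  0 < Y -> continuity_pt f 0 -> 0 < f 0 ->
  exists d, 0 < d <= Y /\ forall s, 0 <= s <= d -> 0 < f s.
Proof.
  intros HY Hc H0.
  destruct (Hc (f 0) H0) as (d & Hd & H).
  exists (Rmin (d / 2) Y).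
  assert (Rmin (d / 2) Y <= d / 2) by apply Rmin_l.
  repeat split; [apply Rmin_pos; lra | apply Rmin_r |].
  intros s Hs.
  destruct (Req_dec s 0) as [->|Hs0]; [exact H0|].
  assert (Hb := H s). simpl in Hb. unfold R_dist in Hb.
  assert (Rabs (f s - f 0) < f 0).
  { apply Hb. split; [split; [exact I | auto] | rewrite Rabs_pos_eq; lra]. }
  apply Rabs_def2 in H2. lra.
Qed.

(* [(y d/dy + p) f = y^(1-p) (y^p f)'] *)
Lemma Rpower_mult_nondecreasing (f df : R -> R) (p s t : R) :
  0 < s <= t ->
  (forall x, s <= x <= t -> is_derive f x (df x)) ->
  (forall x, s <= x <= t -> 0 <= x * df x + p * f x) ->
  Rpower s p * f s <= Rpower t p * f t.
Proof.
  intros Hst Hd Hp.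
  apply (nondecreasing_of_derive (fun x => Rpower x p * f x)
           (fun x => Rpower x p / x * (x * df x + p * f x))); [lra| |].
  - intros x Hx.
    replace (Rpower x p / x * (x * df x + p * f x))
      with (p * Rpower x p / x * f x + Rpower x p * df x) by (field; lra).
    apply (is_derive_mult (fun s => Rpower s p) f).
    + apply is_derive_Rpower; lra.
    + apply Hd, Hx.
    + intros; apply Rmult_comm.
  - intros x Hx. apply Rmult_le_pos; [|apply Hp, Hx].
    left. apply Rdiv_lt_0_compat; [apply Rpower_pos | lra].
Qed.

(** Near 0 positivity comes from continuity; from some [d > 0] on it persists because [y^p f] is
    nondecreasing. The comparison starts at [d] since [Rpower] is controlled on positive bases
    only. *)
Lemma pos_of_theta (f df : R -> R) (p Y : R) :
  0 < Y -> (forall x, is_derive f x (df x)) -> 0 < f 0 ->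
  (forall x, 0 < x <= Y -> 0 <= x * df x + p * f x) ->
  forall x, 0 < x <= Y -> 0 < f x.
Proof.
  intros HY Hd H0 Hp x Hx.
  destruct (pos_near_0 f x) as (d & Hd0 & Hpos); [lra| |exact H0|].
  - apply derivable_continuous_pt. exists (df 0). apply is_derive_Reals, Hd.
  - assert (H : Rpower d p * f d <= Rpower x p * f x).
    { apply (Rpower_mult_nondecreasing f df); [lra | intros; apply Hd |].
      intros z Hz. apply Hp; lra. }
    assert (H1 := Rmult_lt_0_compat _ _ (Rpower_pos d p) (Hpos d ltac:(lra))).
    assert (H2 := Rpower_pos x p). nra.
Qed.

(** If [f 0 = 0] there is no positive start, so [f] is shifted: were [f x < 0], then [f - f x] would
    be positive at 0 and, as [p > 0], satisfy the same inequality, hence be positive at [x], where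
    it vanishes. *)
Lemma nonneg_of_theta (f df : R -> R) (p Y : R) :
  0 < Y -> 0 < p -> (forall x, is_derive f x (df x)) -> 0 <= f 0 ->
  (forall x, 0 < x <= Y -> 0 <= x * df x + p * f x) ->
  forall x, 0 < x <= Y -> 0 <= f x.
Proof.
  intros HY Hp Hd H0 Hth x Hx.
  apply Rnot_lt_le. intros Hneg.
  assert (H : 0 < f x + - f x).
  { apply (pos_of_theta (fun z => f z + - f x) df p Y); auto; [|lra|].
    - intros z. replace (df z) with (df z + 0) by ring.
      apply (is_derive_plus f (fun _ => - f x)); [apply Hd|].
      apply (@is_derive_const R_AbsRing R_NormedModule).
    - intros z Hz. specialize (Hth z Hz). nra. }
  lra.
Qed.

(** Dividing the coefficients by [p + k] inverts the operator [th + p], so the two sign lemmas above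
    apply to the quotient series. *)
Lemma PSeries_div_nonneg (al : nat -> R) (p Y : R) :
  0 < p -> 0 < Y -> entire_seq al ->
  (forall y, 0 < y <= Y -> 0 <= PSeries al y) ->
  (0 <= al O -> forall y, 0 < y <= Y -> 0 <= PSeries (fun k => al k / (p + INR k)) y) /\
  (0 < al O -> forall y, 0 < y <= Y -> 0 < PSeries (fun k => al k / (p + INR k)) y).
Proof.
  intros Hp HY He Hal.
  set (be := fun k => al k / (p + INR k)).
  assert (Hbe : entire_seq be) by (apply entire_seq_div; auto).
  assert (Hd : forall x, is_derive (PSeries be) x (PSeries (PS_derive be) x))
    by (intros; now apply PSeries_entire_theta).
  assert (H0 : PSeries be 0 = al O / p)
    by (rewrite PSeries_0; unfold be; simpl; now rewrite Rplus_0_r).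
  assert (Hth : forall x, 0 < x <= Y -> 0 <= x * PSeries (PS_derive be) x + p * PSeries be x).
  { intros x Hx. rewrite (proj2 (PSeries_entire_theta be x Hbe)).
    rewrite <- (Rmult_1_l (PSeries (fun k => INR k * be k) x)).
    rewrite <- PSeries_entire_linear; [|now apply entire_seq_mult_INR|auto].
    rewrite (PSeries_ext _ al); [now apply Hal|].
    intros k. unfold be. assert (Hk := pos_INR k). simpl. field. lra. }
  split; intros Hal0 y Hy.
  - apply (nonneg_of_theta (PSeries be) (PSeries (PS_derive be)) p Y); auto.
    rewrite H0. apply Rmult_le_pos; [lra|]. left; now apply Rinv_0_lt_compat.
  - apply (pos_of_theta (PSeries be) (PSeries (PS_derive be)) p Y); auto.
    rewrite H0. now apply Rdiv_lt_0_compat.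
Qed.

(** * Raising parameters *)

Lemma poch_pos (x : R) (k : nat) : 0 < x -> 0 < poch x k.
Proof.
  intros Hx. induction k as [|k IH]; simpl; [lra|].
  assert (Hk := pos_INR k). apply Rmult_lt_0_compat; lra.
Qed.

Lemma poch_shift (x : R) (k : nat) : x * poch (x + 1) k = poch x k * (x + INR k).
Proof.
  induction k as [|k IH]; [simpl; ring|].
  simpl poch. rewrite S_INR, <- Rmult_assoc, IH. ring.
Qed.

Lemma poch_S_l (x : R) (k : nat) : poch x (S k) = x * poch (x + 1) k.
Proof. simpl. now rewrite poch_shift. Qed.

Lemma poch_add (x : R) (m k : nat) : poch x (m + k) = poch x m * poch (x + INR m) k.
Proof.
  induction k as [|k IH]; [rewrite Nat.add_0_r; simpl; ring|].
  rewrite Nat.add_succ_r. simpl. rewrite IH, plus_INR. ring.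
Qed.

Lemma poch_double (x : R) (k : nat) :
  poch (2 * x) (2 * k) = 4 ^ k * poch x k * poch (x + 1 / 2) k.
Proof.
  induction k as [|k IH]; [simpl; ring|].
  replace (2 * S k)%nat with (S (S (2 * k))) by lia.
  change (poch (2 * x) (2 * k) * (2 * x + INR (2 * k)) * (2 * x + INR (S (2 * k)))
    = 4 * 4 ^ k * (poch x k * (x + INR k)) * (poch (x + 1 / 2) k * (x + 1 / 2 + INR k))).
  rewrite IH, S_INR, mult_INR. simpl. field.
Qed.

Lemma poch_le (x y : R) (k : nat) : 0 <= x <= y -> 0 <= poch x k <= poch y k.
Proof.
  intros H. induction k as [|k IH]; simpl; [lra|].
  assert (Hk := pos_INR k). split.
  - apply Rmult_le_pos; lra.
  - apply Rmult_le_compat; lra.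
Qed.

Lemma poch_abs_le (x y : R) (k : nat) : Rabs x <= y -> Rabs (poch x k) <= poch y k.
Proof.
  intros H. induction k as [|k IH]; simpl; [rewrite Rabs_R1; lra|].
  assert (Hk := pos_INR k). rewrite Rabs_mult.
  apply Rmult_le_compat; auto using Rabs_pos.
  eapply Rle_trans; [apply Rabs_triang|]. rewrite (Rabs_pos_eq (INR k)); lra.
Qed.

Lemma poch_ge_min (x : R) (k : nat) : 0 < x -> Rmin 1 x <= poch x k.
Proof.
  intros Hx. destruct k as [|k]; [apply Rmin_l|].
  rewrite poch_S_l.
  assert (H : 1 <= poch (x + 1) k).
  { induction k as [|k IH]; simpl; [lra|]. assert (Hk := pos_INR k). nra. }
  assert (H2 := Rmin_r 1 x). nra.
Qed.

Lemma poch_ratio_bound (x y : R) :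
  0 < x -> 0 < y ->
  exists D, 0 <= D /\ forall k, poch x k / poch y k <= D ^ k.
Proof.
  intros Hx Hy. exists (1 + x / y).
  assert (H0 : 0 < x / y) by now apply Rdiv_lt_0_compat.
  split; [lra|]. induction k as [|k IH]; simpl; [lra|].
  assert (Hk := pos_INR k). assert (Hpx := poch_pos x k Hx). assert (Hpy := poch_pos y k Hy).
  replace (poch x k * (x + INR k) / (poch y k * (y + INR k)))
    with ((x + INR k) / (y + INR k) * (poch x k / poch y k)) by (field; lra).
  apply Rmult_le_compat; auto.
  - left; apply Rdiv_lt_0_compat; lra.
  - left; apply Rdiv_lt_0_compat; lra.
  - apply Rmult_le_reg_r with (y + INR k); [lra|].
    replace ((x + INR k) / (y + INR k) * (y + INR k)) with (x + INR k) by (field; lra).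
    replace ((1 + x / y) * (y + INR k)) with (y + INR k + x + x / y * INR k) by (field; lra).
    nra.
Qed.

(** For [d > 0] this is the [k]-th moment of the Beta density with parameters [p] and [d]. *)
Definition raise_mult (p d : R) (k : nat) : R := poch p k / poch (p + d) k.

Lemma raise_mult_bounds (p d : R) (k : nat) :
  0 < p -> 0 <= d -> 0 <= raise_mult p d k <= 1.
Proof.
  intros Hp Hd. unfold raise_mult.
  assert (H := poch_le p (p + d) k ltac:(lra)).
  assert (H1 := poch_pos p k Hp). assert (H2 := poch_pos (p + d) k ltac:(lra)).
  split; [left; now apply Rdiv_lt_0_compat|].
  apply Rmult_le_reg_r with (poch (p + d) k); auto.
  unfold Rdiv. rewrite Rmult_assoc, Rinv_l; lra.
Qed.

Lemma raise_mult_0 (p d : R) : raise_mult p d 0 = 1.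
Proof. unfold raise_mult. simpl. lra. Qed.

Lemma entire_seq_raise (p d : R) (al : nat -> R) :
  0 < p -> 0 <= d -> entire_seq al -> entire_seq (fun k => al k * raise_mult p d k).
Proof.
  intros Hp Hd H. apply (entire_seq_mult_bounded _ _ 1); auto.
  intros k. destruct (raise_mult_bounds p d k Hp Hd). rewrite Rabs_pos_eq; auto.
Qed.

(* [(p + d + k)/(p + k) = 1 + d/(p + k)] *)
Lemma PSeries_raise_step (al : nat -> R) (p d Y : R) :
  0 < p -> 0 <= d -> 0 < Y -> entire_seq al ->
  (forall y, 0 < y <= Y -> 0 <= PSeries al y) ->
  let ga := fun k => al k * (p * (p + d + INR k) / ((p + d) * (p + INR k))) in
  (0 <= al O -> forall y, 0 < y <= Y -> 0 <= PSeries ga y) /\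
  (0 < al O -> 0 < d -> forall y, 0 < y <= Y -> 0 < PSeries ga y).
Proof.
  intros Hp Hd HY He Hal ga.
  assert (E : forall y, PSeries ga y =
     p / (p + d) * PSeries al y
     + p * d / (p + d) * PSeries (fun k => al k / (p + INR k)) y).
  { intros y. rewrite <- PSeries_entire_linear; auto using entire_seq_div.
    apply PSeries_ext. intros k. unfold ga. assert (Hk := pos_INR k). field. lra. }
  destruct (PSeries_div_nonneg al p Y Hp HY He Hal) as [H1 H2].
  assert (Hpd : 0 < p / (p + d)) by (apply Rdiv_lt_0_compat; lra).
  split.
  - intros H0 y Hy. rewrite E. apply Rplus_le_le_0_compat.
    + apply Rmult_le_pos; [lra | auto].
    + apply Rmult_le_pos; [|now apply H1].
      apply Rmult_le_pos; [nra|]. left; apply Rinv_0_lt_compat; lra.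
  - intros H0 Hd0 y Hy. rewrite E. apply Rplus_le_lt_0_compat.
    + apply Rmult_le_pos; [lra | auto].
    + apply Rmult_lt_0_compat; [|now apply H2].
      apply Rdiv_lt_0_compat; nra.
Qed.

(** The product of the one-step multipliers based at [p], [p + 1], ..., [p + n - 1], already
    telescoped: only Pochhammer symbols based at the two ends survive. *)
Definition raise_approx (p d : R) (n k : nat) : R :=
  raise_mult p d k * (poch (p + d + INR n) k / poch (p + INR n) k).

Lemma raise_approx_S (p d : R) (n k : nat) :
  0 < p -> 0 <= d ->
  raise_approx p d (S n) k =
  raise_approx p d n k *
    ((p + INR n) * (p + INR n + d + INR k) / ((p + INR n + d) * (p + INR n + INR k))).
Proof.
  intros Hp Hd. unfold raise_approx. rewrite S_INR.
  assert (Hn := pos_INR n). assert (Hk := pos_INR k).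
  assert (E1 := poch_shift (p + d + INR n) k).
  assert (E2 := poch_shift (p + INR n) k).
  replace (p + d + (INR n + 1)) with (p + d + INR n + 1) by ring.
  replace (p + (INR n + 1)) with (p + INR n + 1) by ring.
  assert (H1 := poch_pos (p + INR n) k ltac:(lra)).
  assert (H2 := poch_pos (p + INR n + 1) k ltac:(lra)).
  replace (poch (p + d + INR n + 1) k)
    with (poch (p + d + INR n) k * (p + d + INR n + INR k) / (p + d + INR n))
    by (rewrite <- E1; field; lra).
  replace (poch (p + INR n + 1) k)
    with (poch (p + INR n) k * (p + INR n + INR k) / (p + INR n))
    by (rewrite <- E2; field; lra).
  field. repeat split; lra.
Qed.

(** The bound is uniform in [n] and [k], as dominated convergence requires. Passing from [k] to
    [k + 1] multiplies by a ratio at most 1, since [(u+d)(u+n) - u(u+d+n) = d n >= 0] for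
    [u = p + k]. *)
Lemma raise_approx_bounds (p d : R) (n k : nat) :
  0 < p -> 0 <= d -> Rabs (raise_approx p d n k) <= 1.
Proof.
  intros Hp Hd. unfold raise_approx, raise_mult.
  assert (Hn := pos_INR n).
  induction k as [|k IH]; simpl.
  - rewrite Rabs_pos_eq; lra.
  - assert (Hk := pos_INR k).
    assert (H1 := poch_pos p k ltac:(lra)). assert (H2 := poch_pos (p + d) k ltac:(lra)).
    assert (H3 := poch_pos (p + INR n) k ltac:(lra)).
    assert (H4 := poch_pos (p + d + INR n) k ltac:(lra)).
    set (q := (p + INR k) * (p + d + INR n + INR k) / ((p + d + INR k) * (p + INR n + INR k))).
    replace (poch p k * (p + INR k) / (poch (p + d) k * (p + d + INR k)) *
       (poch (p + d + INR n) k * (p + d + INR n + INR k) /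
       (poch (p + INR n) k * (p + INR n + INR k))))
      with ((poch p k / poch (p + d) k * (poch (p + d + INR n) k / poch (p + INR n) k)) * q)
      by (unfold q; field; repeat split; lra).
    rewrite Rabs_mult. rewrite <- (Rmult_1_r 1).
    apply Rmult_le_compat; auto using Rabs_pos.
    assert (Hden : 0 < (p + d + INR k) * (p + INR n + INR k)) by (apply Rmult_lt_0_compat; lra).
    rewrite Rabs_pos_eq.
    + unfold q. apply Rmult_le_reg_r with ((p + d + INR k) * (p + INR n + INR k)); auto.
      unfold Rdiv. rewrite Rmult_assoc, Rinv_l by lra. nra.
    + left. apply Rdiv_lt_0_compat; auto. apply Rmult_lt_0_compat; lra.
Qed.

Lemma raise_approx_lim (p d : R) (k : nat) :
  0 < p -> 0 <= d -> is_lim_seq (fun n => raise_approx p d n k) (raise_mult p d k).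
Proof.
  intros Hp Hd. unfold raise_approx.
  replace (Finite (raise_mult p d k)) with (Rbar_mult (raise_mult p d k) 1)
    by (simpl; f_equal; ring).
  apply is_lim_seq_scal_l.
  induction k as [|k IH].
  - apply is_lim_seq_ext with (fun _ => 1); [intros; simpl; field|].
    apply is_lim_seq_const.
  - apply is_lim_seq_ext with
      (fun n => poch (p + d + INR n) k / poch (p + INR n) k * (1 + d * / (INR n + (p + INR k)))).
    + intros n. simpl. assert (Hn := pos_INR n). assert (Hk := pos_INR k).
      assert (H3 := poch_pos (p + INR n) k ltac:(lra)). field. lra.
    + replace (Finite 1) with (Finite (1 * (1 + d * 0))) by (f_equal; ring).
      apply is_lim_seq_mult'; auto.
      apply is_lim_seq_plus'; [apply is_lim_seq_const|].
      apply is_lim_seq_mult'; [apply is_lim_seq_const|].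
      replace (Finite 0) with (Rbar_inv p_infty) by reflexivity.
      apply is_lim_seq_inv; [|discriminate].
      eapply is_lim_seq_plus; [apply is_lim_seq_INR | apply is_lim_seq_const | reflexivity].
Qed.

Lemma Series_tail_lim (u : nat -> R) :
  ex_series u -> is_lim_seq (fun N => Series (fun k => u (S N + k)%nat)) 0.
Proof.
  intros H.
  apply is_lim_seq_ext with (fun N => Series u - sum_n u N).
  - intros N. rewrite (Series_incr_n u (S N)) by (auto; lia). simpl pred.
    rewrite sum_n_Reals. ring.
  - replace (Finite 0) with (Finite (Series u - Series u)) by (f_equal; ring).
    apply is_lim_seq_minus'; [apply is_lim_seq_const|].
    apply (Series_correct u H).
Qed.

Lemma Series_sum_bound (u v : nat -> R) (N : nat) :
  (forall k, Rabs (u k) <= v k) -> ex_series v ->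
  Rabs (Series u - sum_f_R0 u N) <= Series (fun k => v (S N + k)%nat).
Proof.
  intros Huv Hv.
  assert (Hu : ex_series u).
  { apply (@ex_series_le R_AbsRing R_CompleteNormedModule) with v; auto. }
  rewrite (Series_incr_n u (S N)) by (auto; lia). simpl pred.
  replace (sum_f_R0 u N + Series (fun k => u (S N + k)%nat) - sum_f_R0 u N)
    with (Series (fun k => u (S N + k)%nat)) by ring.
  assert (Hvt : ex_series (fun k => v (S N + k)%nat)) by now apply ex_series_incr_n.
  eapply Rle_trans; [apply Series_Rabs|].
  - apply (@ex_series_le R_AbsRing R_CompleteNormedModule) with (2 := Hvt).
    intros k. unfold norm; simpl; unfold abs; simpl. rewrite Rabs_Rabsolu. apply Huv.
  - apply Series_le; auto. intros k; split; [apply Rabs_pos | apply Huv].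
Qed.

Lemma is_lim_seq_sum_f_R0 (u : nat -> nat -> R) (l : nat -> R) (N : nat) :
  (forall k, is_lim_seq (fun n => u n k) (l k)) ->
  is_lim_seq (fun n => sum_f_R0 (u n) N) (sum_f_R0 l N).
Proof.
  intros H. induction N as [|N IH]; simpl; [apply H|].
  apply is_lim_seq_plus'; auto.
Qed.

(** Dominated convergence in one-sided form: the partial sums of each [u n] are at least minus the
    tail of [v]; this survives the limit in [n], and then the tail tends to 0. *)
Lemma Series_nonneg_of_dominated_lim (u : nat -> nat -> R) (l v : nat -> R) :
  ex_series v -> (forall n k, Rabs (u n k) <= v k) ->
  (forall k, is_lim_seq (fun n => u n k) (l k)) ->
  (forall n, 0 <= Series (u n)) -> 0 <= Series l.
Proof.
  intros Hv Huv Hl Hpos.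
  assert (Hlv : forall k, Rabs (l k) <= v k).
  { intros k. apply (is_lim_seq_le (fun n => Rabs (u n k)) (fun _ => v k) (Rabs (l k)) (v k)).
    - intros; apply Huv.
    - apply (is_lim_seq_abs _ (l k)), Hl.
    - apply is_lim_seq_const. }
  assert (Hpart : forall N, - Series (fun k => v (S N + k)%nat) <= sum_f_R0 l N).
  { intros N.
    apply (is_lim_seq_le (fun n => - Series (fun k => v (S N + k)%nat))
             (fun n => sum_f_R0 (u n) N)
             (- Series (fun k => v (S N + k)%nat)) (sum_f_R0 l N)).
    - intros n. assert (H := Series_sum_bound (u n) v N (Huv n) Hv).
      apply Rabs_le_between in H. specialize (Hpos n). lra.
    - apply is_lim_seq_const.
    - apply is_lim_seq_sum_f_R0, Hl. }
  apply (is_lim_seq_le (fun N => - Series (fun k => v (S N + k)%nat)) (sum_f_R0 l) 0 (Series l)).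
  - exact Hpart.
  - replace (Finite 0) with (Rbar_opp 0) by (simpl; f_equal; ring).
    apply -> is_lim_seq_opp. now apply Series_tail_lim.
  - apply is_lim_seq_ext with (sum_n l); [intros; apply sum_n_Reals|].
    apply (Series_correct l).
    apply (@ex_series_le R_AbsRing R_CompleteNormedModule) with v; auto.
Qed.

(* [(p)_k/(p+d)_k] is the limit of products of the multipliers of [PSeries_raise_step]. *)
Lemma PSeries_raise_nonneg (al : nat -> R) (p d Y : R) :
  0 < p -> 0 <= d -> 0 < Y -> entire_seq al -> 0 <= al O ->
  (forall y, 0 < y <= Y -> 0 <= PSeries al y) ->
  forall y, 0 < y <= Y -> 0 <= PSeries (fun k => al k * raise_mult p d k) y.
Proof.
  intros Hp Hd HY He H0 Hal.
  assert (Hn : forall n y, 0 < y <= Y -> 0 <= PSeries (fun k => al k * raise_approx p d n k) y).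
  { induction n as [|n IH]; intros y Hy.
    - rewrite (PSeries_ext _ al); [now apply Hal|].
      intros k. unfold raise_approx, raise_mult. simpl. rewrite !Rplus_0_r.
      assert (H1 := poch_pos p k ltac:(lra)). assert (H2 := poch_pos (p + d) k ltac:(lra)).
      field. lra.
    - assert (Hpn := pos_INR n).
      rewrite (PSeries_ext _ (fun k => al k * raise_approx p d n k *
        ((p + INR n) * (p + INR n + d + INR k) / ((p + INR n + d) * (p + INR n + INR k))))).
      + apply (PSeries_raise_step _ (p + INR n) d Y); auto; try lra.
        * apply (entire_seq_mult_bounded _ _ 1); auto.
          intros k; now apply raise_approx_bounds.
        * unfold raise_approx. rewrite raise_mult_0. simpl. lra.
      + intros k. rewrite raise_approx_S by auto. ring. }
  intros y Hy.
  apply (Series_nonneg_of_dominated_lim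
    (fun n k => al k * raise_approx p d n k * y ^ k) _ (fun k => Rabs (al k * y ^ k))).
  - now apply entire_seq_ex_abs.
  - intros n k. rewrite !Rabs_mult.
    assert (H := raise_approx_bounds p d n k Hp Hd).
    assert (H1 := Rabs_pos (al k)). assert (H2 := Rabs_pos (y ^ k)).
    apply Rmult_le_compat_r; auto. nra.
  - intros k. apply is_lim_seq_mult'; [|apply is_lim_seq_const].
    apply is_lim_seq_mult'; [apply is_lim_seq_const|]. now apply raise_approx_lim.
  - intros n. now apply Hn.
Qed.

(** A limit of positive values is only nonnegative, so strictness has to come from one finite step:
    [(p)_k/(p+d)_k] is the multiplier based at [p + 1], which keeps nonnegativity, times the first
    one-step multiplier, which is strict when [d > 0]. *)
Lemma PSeries_raise_pos (al : nat -> R) (p d Y : R) :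
  0 < p -> 0 < d -> 0 < Y -> entire_seq al -> 0 < al O ->
  (forall y, 0 < y <= Y -> 0 <= PSeries al y) ->
  forall y, 0 < y <= Y -> 0 < PSeries (fun k => al k * raise_mult p d k) y.
Proof.
  intros Hp Hd HY He H0 Hal y Hy.
  rewrite (PSeries_ext _ (fun k => al k * raise_mult (p + 1) d k *
     (p * (p + d + INR k) / ((p + d) * (p + INR k))))).
  - apply (PSeries_raise_step _ p d Y); auto; try lra.
    + apply entire_seq_raise; auto; lra.
    + apply PSeries_raise_nonneg; auto; lra.
    + rewrite raise_mult_0. lra.
  - intros k. unfold raise_mult. assert (Hk := pos_INR k).
    assert (E1 := poch_shift p k). assert (E2 := poch_shift (p + d) k).
    replace (p + 1 + d) with (p + d + 1) by ring.
    assert (H1 := poch_pos (p + d) k ltac:(lra)).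
    replace (poch (p + 1) k) with (poch p k * (p + INR k) / p) by (rewrite <- E1; field; lra).
    replace (poch (p + d + 1) k) with (poch (p + d) k * (p + d + INR k) / (p + d))
      by (rewrite <- E2; field; lra).
    field. lra.
Qed.

Definition hyp (a b c : R) (k : nat) : R :=
  (-1) ^ k * poch a k / (INR (Factorial.fact k) * poch b k * poch c k).

Lemma Phi_PSeries (a b c x : R) : Phi a b c x = PSeries (hyp a b c) (x ^ 2 / 4).
Proof.
  unfold Phi, PSeries. apply Series_ext. intros k. unfold F12_term, hyp.
  replace (- x ^ 2 / 4) with ((-1) * (x ^ 2 / 4)) by field.
  rewrite (Rpow_mult_distr (-1)). generalize ((x ^ 2 / 4) ^ k). intros z. unfold Rdiv. ring.
Qed.

Lemma hyp_sym (a b c : R) (k : nat) : hyp a b c k = hyp a c b k.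
Proof. unfold hyp. f_equal. ring. Qed.

Lemma hyp_0 (a b c : R) : hyp a b c 0 = 1.
Proof. unfold hyp. simpl. field. Qed.

Lemma entire_seq_hyp (a b c : R) : 0 < a -> 0 < b -> 0 < c -> entire_seq (hyp a b c).
Proof.
  intros Ha Hb Hc.
  destruct (poch_ratio_bound a b Ha Hb) as (D & HD & H).
  exists (/ Rmin 1 c), D.
  assert (Hm : 0 < Rmin 1 c) by (apply Rmin_pos; lra).
  repeat split; auto; [left; now apply Rinv_0_lt_compat|].
  intros k. unfold hyp.
  assert (Hpa := poch_pos a k Ha). assert (Hpb := poch_pos b k Hb).
  assert (Hpc := poch_pos c k Hc). assert (Hf := INR_fact_lt_0 k).
  replace ((-1) ^ k * poch a k / (INR (Factorial.fact k) * poch b k * poch c k))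
    with ((-1) ^ k * (/ poch c k * (poch a k / poch b k) / INR (Factorial.fact k)))
    by (field; lra).
  rewrite Rabs_mult, pow_1_abs, Rmult_1_l, Rabs_pos_eq.
  - apply Rmult_le_compat_r; [left; now apply Rinv_0_lt_compat|].
    apply Rmult_le_compat; auto.
    + left; now apply Rinv_0_lt_compat.
    + left; now apply Rdiv_lt_0_compat.
    + apply Rinv_le_contravar; auto. now apply poch_ge_min.
  - left. apply Rdiv_lt_0_compat; auto. apply Rmult_lt_0_compat; [now apply Rinv_0_lt_compat|].
    now apply Rdiv_lt_0_compat.
Qed.

Definition nonneg_hyp (a b c : R) : Prop := forall y, 0 < y -> 0 <= PSeries (hyp a b c) y.
Definition pos_hyp (a b c : R) : Prop := forall y, 0 < y -> 0 < PSeries (hyp a b c) y.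

Lemma PSeries_hyp_sym (a b c y : R) : PSeries (hyp a b c) y = PSeries (hyp a c b) y.
Proof. apply PSeries_ext, hyp_sym. Qed.

Lemma nonneg_hyp_sym (a b c : R) : nonneg_hyp a b c -> nonneg_hyp a c b.
Proof. intros H y Hy. rewrite PSeries_hyp_sym. now apply H. Qed.

Lemma pos_hyp_sym (a b c : R) : pos_hyp a b c -> pos_hyp a c b.
Proof. intros H y Hy. rewrite PSeries_hyp_sym. now apply H. Qed.

Lemma pos_hyp_nonneg (a b c : R) : pos_hyp a b c -> nonneg_hyp a b c.
Proof. intros H y Hy. left. now apply H. Qed.

Lemma hyp_raise (a b c d : R) (k : nat) :
  0 < b -> 0 < c -> 0 <= d -> hyp a (b + d) c k = hyp a b c k * raise_mult b d k.
Proof.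
  intros Hb Hc Hd. unfold hyp, raise_mult.
  assert (Hpb := poch_pos b k Hb). assert (Hpc := poch_pos c k Hc).
  assert (H2 := poch_pos (b + d) k ltac:(lra)). assert (Hf := INR_fact_lt_0 k).
  field. lra.
Qed.

Lemma pos_hyp_raise_l (a b b' c : R) :
  0 < a -> 0 < b -> 0 < c -> b < b' -> nonneg_hyp a b c -> pos_hyp a b' c.
Proof.
  intros Ha Hb Hc Hd H y Hy. replace b' with (b + (b' - b)) by ring.
  rewrite (PSeries_ext _ (fun k => hyp a b c k * raise_mult b (b' - b) k)).
  - apply (PSeries_raise_pos _ b (b' - b) y); auto; try lra.
    + now apply entire_seq_hyp.
    + rewrite hyp_0; lra.
    + intros z Hz; apply H; lra.
  - intros k; apply hyp_raise; auto; lra.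
Qed.

Lemma nonneg_hyp_raise (a b c b' c' : R) :
  0 < a -> 0 < b -> 0 < c -> b <= b' -> c <= c' -> nonneg_hyp a b c -> nonneg_hyp a b' c'.
Proof.
  intros Ha Hb Hc Hb' Hc' H.
  assert (H1 : nonneg_hyp a b' c).
  { destruct Hb' as [Hb'|<-]; auto. apply pos_hyp_nonneg, pos_hyp_raise_l with b; auto. }
  destruct Hc' as [Hc'|<-]; auto.
  apply nonneg_hyp_sym, pos_hyp_nonneg, pos_hyp_raise_l with c; auto; [lra|].
  now apply nonneg_hyp_sym.
Qed.

Lemma pos_hyp_raise (a b c b' c' : R) :
  0 < a -> 0 < b -> 0 < c -> b <= b' -> c <= c' -> b < b' \/ c < c' ->
  nonneg_hyp a b c -> pos_hyp a b' c'.
Proof.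
  intros Ha Hb Hc Hb' Hc' [Hlt|Hlt] H.
  - apply pos_hyp_raise_l with b; auto; [lra|]. now apply nonneg_hyp_raise with b c; auto; lra.
  - apply pos_hyp_sym, pos_hyp_raise_l with c; auto; [lra|].
    apply nonneg_hyp_sym. now apply nonneg_hyp_raise with b c; auto; lra.
Qed.

(** * Two hypergeometric sums *)

(* Extending [1/(k-n)!] by [0] to [n > k] makes the two recurrences below hold for all [k], [n]. *)
Definition inv_fact_sub (k n : nat) : R :=
  if Nat.leb n k then / INR (Factorial.fact (k - n)) else 0.

Lemma inv_fact_sub_SS (k n : nat) : inv_fact_sub (S k) (S n) = inv_fact_sub k n.
Proof. reflexivity. Qed.

Lemma inv_fact_sub_S_l (k n : nat) :
  inv_fact_sub k n = (INR k + 1 - INR n) * inv_fact_sub (S k) n.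
Proof.
  unfold inv_fact_sub.
  destruct (Nat.leb_spec n k) as [H|H]; destruct (Nat.leb_spec n (S k)) as [H'|H']; try lia.
  - replace (S k - n)%nat with (S (k - n)) by lia.
    change (Factorial.fact (S (k - n))) with (S (k - n) * Factorial.fact (k - n))%nat.
    rewrite mult_INR, S_INR, minus_INR by lia.
    assert (Hf := INR_fact_lt_0 (k - n)). apply le_INR in H. field. lra.
  - replace n with (S k) by lia. rewrite S_INR. ring.
  - ring.
Qed.

Lemma inv_fact_sub_S_r (k n : nat) :
  inv_fact_sub k (S n) = (INR k - INR n) * inv_fact_sub k n.
Proof. rewrite inv_fact_sub_S_l, inv_fact_sub_SS, S_INR. f_equal. ring. Qed.

Lemma INR_fact_S (n : nat) :
  INR (Factorial.fact (S n)) = (INR n + 1) * INR (Factorial.fact n).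
Proof.
  change (Factorial.fact (S n)) with (S n * Factorial.fact n)%nat.
  now rewrite mult_INR, S_INR.
Qed.

(** The very-well-poised factor [(2n+2a-1)/(2a-1) (2a-1)_n / n!] with [2a - 1] cancelled, since it
    vanishes at [a = 1/2]. This is why index 0 is set apart and the other terms use [(2a)_(n-1)]. *)
Definition gasper_coef (a b c : R) (n : nat) : R :=
  match n with
  | O => 1
  | S m => (2 * INR m + 2 * a + 1) * poch (2 * a) m / INR (Factorial.fact (S m))
           * (poch (2 * a - b) (S m) * poch (b - a - 1 / 2) (S m))
           / (poch b (S m) * poch c (S m))
  end.

Definition gasper_term (a b c : R) (k n : nat) : R :=
  (-1) ^ n * gasper_coef a b c n * inv_fact_sub k n / poch (2 * a) (k + n).

(* Zeilberger's recurrence for the very-well-poised sum [5F4(2a-1, a+1/2, 2a-b, b-a-1/2, -k; 1)];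
   the right-hand side is the WZ certificate
   [- n (b+n-1) (c+n-1) (2a+k+n) / (2n+2a-1) * gasper_term a b c (k+1) n] at [n = m + 1]. *)
Lemma gasper_telescoping (a b c : R) (k m : nat) :
  0 < a -> 0 < b -> 0 < c -> b + c = 3 * a + 1 / 2 ->
  sum_f_R0 (fun n => (INR k + 1) * (b + INR k) * (c + INR k) * gasper_term a b c (S k) n
                     - (a + 1 / 2 + INR k) * gasper_term a b c k n) m =
  (-1) ^ m * poch (2 * a) m / INR (Factorial.fact m)
  * (poch (2 * a - b) (S m) * poch (b - a - 1 / 2) (S m)) / (poch b m * poch c m)
  * inv_fact_sub k m / poch (2 * a) (k + 1 + m).
Proof.
  intros Ha Hb Hc E. assert (Hk := pos_INR k).
  assert (Ec : c = 3 * a + 1 / 2 - b) by lra.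
  induction m as [|m IH].
  - unfold gasper_term. simpl. replace (k + 1 + 0)%nat with (S k) by lia.
    rewrite Nat.add_0_r. simpl.
    rewrite (inv_fact_sub_S_l k 0). simpl.
    assert (H1 := poch_pos (2 * a) k ltac:(lra)).
    rewrite Ec. field. lra.
  - rewrite tech5, IH. clear IH. unfold gasper_term.
    cbn [gasper_coef pow].
    rewrite inv_fact_sub_SS, inv_fact_sub_S_r.
    replace (S k + S m)%nat with (S (k + 1 + m)) by lia.
    replace (k + S m)%nat with (k + 1 + m)%nat by lia.
    replace (k + 1 + S m)%nat with (S (k + 1 + m)) by lia.
    rewrite (INR_fact_S m).
    assert (Hm := pos_INR m). assert (Hf := INR_fact_lt_0 m).
    assert (H1 := poch_pos (2 * a) (k + 1 + m) ltac:(lra)).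
    assert (H2 := poch_pos b m Hb). assert (H3 := poch_pos c m Hc).
    cbn [poch]. rewrite !S_INR, !plus_INR. change (INR 1) with 1.
    generalize dependent (poch (2 * a) (k + 1 + m)). generalize dependent (poch b m).
    generalize dependent (poch c m). generalize dependent (INR (Factorial.fact m)).
    intros. rewrite Ec in *. field. lra.
Qed.

Lemma sum_f_R0_scal_minus (A B : R) (f g : nat -> R) (N : nat) :
  sum_f_R0 (fun n => A * f n - B * g n) N = A * sum_f_R0 f N - B * sum_f_R0 g N.
Proof. induction N as [|N IH]; simpl; [|rewrite IH]; ring. Qed.

Lemma gasper_sum (a b c : R) (k : nat) :
  0 < a -> 0 < b -> 0 < c -> b + c = 3 * a + 1 / 2 ->
  sum_f_R0 (gasper_term a b c k) k =
  poch (a + 1 / 2) k / (INR (Factorial.fact k) * poch b k * poch c k).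
Proof.
  intros Ha Hb Hc E. induction k as [|k IH].
  - unfold gasper_term, inv_fact_sub. simpl. field.
  (* At [m = S k] the certificate contains [inv_fact_sub k (S k) = 0], so the telescoped identity
     becomes a first-order recurrence in [k] for the sum. *)
  - assert (H := gasper_telescoping a b c k (S k) Ha Hb Hc E).
    rewrite sum_f_R0_scal_minus in H.
    rewrite (inv_fact_sub_S_r k k), Rminus_diag, Rmult_0_l, Rmult_0_r, Rdiv_0_l in H.
    assert (E2 : sum_f_R0 (gasper_term a b c k) (S k) = sum_f_R0 (gasper_term a b c k) k).
    { rewrite tech5. unfold gasper_term at 2. rewrite inv_fact_sub_S_r. field.
      assert (H1 := poch_pos (2 * a) (k + S k) ltac:(lra)). lra. }
    rewrite E2, IH in H. assert (Hk := pos_INR k).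
    assert (H2 := poch_pos b k Hb). assert (H3 := poch_pos c k Hc).
    assert (Hf := INR_fact_lt_0 k).
    apply Rmult_eq_reg_l with ((INR k + 1) * (b + INR k) * (c + INR k)).
    2: apply Rgt_not_eq; apply Rmult_lt_0_compat; [apply Rmult_lt_0_compat|]; lra.
    apply Rminus_diag_uniq_sym in H. rewrite <- H. rewrite INR_fact_S. cbn [poch].
    field. lra.
Qed.

(** Terms of the Cauchy square of the series with coefficients [1/(i! (mu)_i)], again cut off to 0
    for [i > k] so that the recurrences hold for all indices. *)
Definition square_term (mu : R) (k i : nat) : R :=
  (if Nat.leb i k then / (INR (Factorial.fact (k - i)) * poch mu (k - i)) else 0)
  / (INR (Factorial.fact i) * poch mu i).

Lemma square_term_S_l (mu : R) (k i : nat) :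
  0 < mu ->
  square_term mu k i =
  (INR k + 1 - INR i) * (mu + INR k - INR i) * square_term mu (S k) i.
Proof.
  intros Hmu. unfold square_term.
  assert (Hf := INR_fact_lt_0 i). assert (Hp := poch_pos mu i Hmu).
  destruct (Nat.leb_spec i k) as [H|H]; destruct (Nat.leb_spec i (S k)) as [H'|H']; try lia.
  - replace (S k - i)%nat with (S (k - i)) by lia.
    rewrite INR_fact_S. cbn [poch]. rewrite minus_INR by lia.
    assert (Hf' := INR_fact_lt_0 (k - i)). assert (Hp' := poch_pos mu (k - i) Hmu).
    apply le_INR in H. field. lra.
  - replace (INR k + 1 - INR i) with 0 by (replace i with (S k) by lia; rewrite S_INR; ring).
    unfold Rdiv. ring.
  - unfold Rdiv. ring.
Qed.

Lemma square_term_S_S (mu : R) (k i : nat) :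
  0 < mu ->
  (INR i + 1) * (mu + INR i) * square_term mu (S k) (S i) = square_term mu k i.
Proof.
  intros Hmu. unfold square_term. simpl Nat.leb. simpl Nat.sub.
  assert (Hf := INR_fact_lt_0 i). assert (Hp := poch_pos mu i Hmu). assert (Hi := pos_INR i).
  rewrite INR_fact_S. cbn [poch].
  generalize (if Nat.leb i k then / (INR (Factorial.fact (k - i)) * poch mu (k - i)) else 0).
  intros r. field. lra.
Qed.

(* Zeilberger's recurrence; the WZ certificate is
   [i (mu+i-1) (2i-3k-2mu-1) * square_term mu (k+1) i] at [i = m + 1]. *)
Lemma square_telescoping (mu : R) (k m : nat) :
  0 < mu ->
  sum_f_R0 (fun i => (INR k + 1) * (mu + INR k) * (2 * mu - 1 + INR k) * square_term mu (S k) i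
                     - (4 * INR k + 4 * mu - 2) * square_term mu k i) m =
  (2 * INR m - 3 * INR k - 2 * mu + 1) * square_term mu k m.
Proof.
  intros Hmu. induction m as [|m IH].
  - simpl. rewrite (square_term_S_l mu k 0) by auto. simpl. ring.
  - rewrite tech5, IH. clear IH. rewrite <- (square_term_S_S mu k m) by auto.
    rewrite (square_term_S_l mu k (S m)) by auto. rewrite !S_INR. ring.
Qed.

Lemma square_sum (mu : R) (k : nat) :
  1 / 2 < mu ->
  sum_f_R0 (square_term mu k) k =
  4 ^ k * poch (mu - 1 / 2) k / (INR (Factorial.fact k) * poch mu k * poch (2 * mu - 1) k).
Proof.
  intros Hmu. induction k as [|k IH].
  - unfold square_term. simpl. field.
  - assert (H := square_telescoping mu k (S k) ltac:(lra)).
    rewrite sum_f_R0_scal_minus in H.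
    assert (E1 : square_term mu k (S k) = 0).
    { rewrite square_term_S_l, S_INR by lra. ring. }
    rewrite tech5 with (An := square_term mu k), E1, IH in H. assert (Hk := pos_INR k).
    assert (H2 := poch_pos mu k ltac:(lra)). assert (H3 := poch_pos (2 * mu - 1) k ltac:(lra)).
    assert (Hf := INR_fact_lt_0 k).
    apply Rmult_eq_reg_l with ((INR k + 1) * (mu + INR k) * (2 * mu - 1 + INR k)).
    2: apply Rgt_not_eq; apply Rmult_lt_0_compat; [apply Rmult_lt_0_compat|]; lra.
    rewrite Rmult_0_r, Rplus_0_r in H.
    apply Rminus_diag_uniq in H. rewrite H, INR_fact_S. cbn [poch pow].
    field. lra.
Qed.

(* [bessel_quarter mu] are the coefficients of [0F1(; mu; -y/4)]. *)
Definition bessel_quarter (mu : R) (k : nat) : R := hyp mu mu mu k * (/ 4) ^ k.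

Lemma entire_seq_bessel_quarter (mu : R) : 0 < mu -> entire_seq (bessel_quarter mu).
Proof.
  intros Hmu. apply (entire_seq_mult_bounded (fun k => (/ 4) ^ k) _ 1).
  - intros k. rewrite Rabs_pos_eq by (apply pow_le; lra).
    rewrite <- (pow1 k). apply pow_incr; lra.
  - now apply entire_seq_hyp.
Qed.

Lemma bessel_quarter_eq (mu : R) (k : nat) :
  0 < mu -> bessel_quarter mu k = (-1) ^ k / (4 ^ k * INR (Factorial.fact k) * poch mu k).
Proof.
  intros Hmu. unfold bessel_quarter, hyp. rewrite pow_inv.
  assert (H2 := poch_pos mu k Hmu). assert (Hf := INR_fact_lt_0 k).
  assert (H4 : 0 < 4 ^ k) by (apply pow_lt; lra).
  field. lra.
Qed.

(** The classical formula for the square of a Bessel function; the quarter in the argument absorbs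
    the [4^k] of [square_sum]. *)
Lemma PSeries_hyp_square (mu y : R) :
  1 / 2 < mu ->
  PSeries (hyp (mu - 1 / 2) mu (2 * mu - 1)) y =
  PSeries (bessel_quarter mu) y * PSeries (bessel_quarter mu) y.
Proof.
  intros Hmu. rewrite <- PSeries_mult.
  2, 3: apply entire_seq_radius, entire_seq_bessel_quarter; lra.
  apply PSeries_ext. intros k. unfold PS_mult.
  assert (H4 : 0 < 4 ^ k) by (apply pow_lt; lra).
  rewrite (sum_eq _ (fun i => square_term mu k i * ((-1) ^ k / 4 ^ k))).
  - rewrite <- scal_sum, square_sum by auto. unfold hyp.
    assert (H2 := poch_pos mu k ltac:(lra)). assert (H3 := poch_pos (2 * mu - 1) k ltac:(lra)).
    assert (Hf := INR_fact_lt_0 k). field. lra.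
  - intros i Hi. rewrite !bessel_quarter_eq by lra. unfold square_term.
    rewrite (proj2 (Nat.leb_le i k)) by auto.
    assert (H2 := poch_pos mu i ltac:(lra)). assert (H3 := poch_pos mu (k - i) ltac:(lra)).
    assert (Hf := INR_fact_lt_0 i). assert (Hf' := INR_fact_lt_0 (k - i)).
    assert (Ep : forall x, x ^ k = x ^ i * x ^ (k - i))
      by (intros; rewrite <- pow_add; f_equal; lia).
    rewrite !Ep.
    assert (0 < 4 ^ i) by (apply pow_lt; lra).
    assert (0 < 4 ^ (k - i)) by (apply pow_lt; lra).
    field. lra.
Qed.

(** The terms after the constant term 1 add up to at most [y e^y / mu]. This stands in for any
    knowledge of Bessel zeros: for a given [y], some square in the expansion, of high enough index,
    does not vanish. *)
Lemma bessel_quarter_pos_large (y : R) :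
  0 < y -> exists m, forall mu, INR m <= mu -> 0 < PSeries (bessel_quarter mu) y.
Proof.
  intros Hy.
  set (E := Series (fun k => 1 * y ^ k / INR (Factorial.fact k))).
  assert (HE : 0 <= E).
  { unfold E. rewrite <- (Series_ext (fun k => Rabs (1 * y ^ k / INR (Factorial.fact k)))).
    - eapply Rle_trans; [apply Rabs_pos | apply Series_Rabs].
      apply (ex_series_ext (fun k => 1 * y ^ k / INR (Factorial.fact k))).
      + intros k. rewrite Rabs_pos_eq; [reflexivity|]. rewrite Rmult_1_l.
        left; apply Rdiv_lt_0_compat; [now apply pow_lt | apply INR_fact_lt_0].
      + apply ex_series_exp_bound.
    - intros k. rewrite Rabs_pos_eq; [reflexivity|]. rewrite Rmult_1_l.
      left; apply Rdiv_lt_0_compat; [now apply pow_lt | apply INR_fact_lt_0]. }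
  destruct (INR_unbounded (1 + y * E)) as [m Hm].
  exists m. intros mu Hmu.
  assert (HyE : 0 <= y * E) by (apply Rmult_le_pos; lra).
  assert (Hmu1 : 1 < mu) by lra.
  assert (He := entire_seq_bessel_quarter mu ltac:(lra)).
  rewrite PSeries_decr_1 by now apply entire_seq_ex_pseries.
  assert (Hb : Rabs (PSeries (PS_decr_1 (bessel_quarter mu)) y) <= / mu * E).
  { unfold PSeries, E. rewrite <- Series_scal_l.
    assert (Hbd : forall k, Rabs (PS_decr_1 (bessel_quarter mu) k * y ^ k)
                    <= / mu * (1 * y ^ k / INR (Factorial.fact k))).
    { intros k. unfold PS_decr_1. rewrite bessel_quarter_eq by lra.
      rewrite Rabs_mult, (Rabs_pos_eq (y ^ k)) by (apply pow_le; lra).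
      unfold Rdiv. rewrite Rabs_mult, pow_1_abs.
      assert (Hf := INR_fact_lt_0 k). assert (Hk := pos_INR k).
      assert (H4 : 1 <= 4 ^ S k) by (apply pow_R1_Rle; lra).
      assert (Hp : mu <= poch mu (S k)).
      { rewrite poch_S_l. assert (H := poch_ge_min (mu + 1) k ltac:(lra)).
        rewrite Rmin_left in H by lra. nra. }
      assert (Hden : mu * INR (Factorial.fact k)
                     <= 4 ^ S k * INR (Factorial.fact (S k)) * poch mu (S k)).
      { rewrite Rmult_comm. apply Rmult_le_compat; try lra.
        rewrite INR_fact_S.
        rewrite <- (Rmult_1_l (INR (Factorial.fact k))) at 1.
        apply Rmult_le_compat; nra. }
      assert (0 < mu * INR (Factorial.fact k)) by (apply Rmult_lt_0_compat; lra).
      rewrite Rabs_pos_eq by (left; apply Rinv_0_lt_compat; lra).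
      replace (/ mu * (1 * y ^ k * / INR (Factorial.fact k)))
        with (1 * / (mu * INR (Factorial.fact k)) * y ^ k) by (field; lra).
      apply Rmult_le_compat_r; [apply pow_le; lra|].
      rewrite !Rmult_1_l. now apply Rinv_le_contravar. }
    assert (Hex : ex_series (fun k => / mu * (1 * y ^ k / INR (Factorial.fact k)))).
    { apply (@ex_series_scal R_AbsRing R_NormedModule), ex_series_exp_bound. }
    eapply Rle_trans; [apply Series_Rabs|].
    - apply (@ex_series_le R_AbsRing R_CompleteNormedModule) with (2 := Hex).
      intros k. unfold norm; simpl; unfold abs; simpl. rewrite Rabs_Rabsolu. apply Hbd.
    - apply Series_le; auto. intros k; split; [apply Rabs_pos | apply Hbd]. }
  replace (bessel_quarter mu 0) with 1
    by (unfold bessel_quarter; rewrite hyp_0; simpl; ring).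
  apply Rabs_le_between in Hb.
  assert (y * (/ mu * E) < 1).
  { apply Rmult_lt_reg_r with mu; [lra|].
    replace (y * (/ mu * E) * mu) with (y * E) by (field; lra). lra. }
  nra.
Qed.

(** * Gasper's sum of squares *)

Lemma sum_f_R0_nonneg (u : nat -> R) (N : nat) :
  (forall n, 0 <= u n) -> 0 <= sum_f_R0 u N.
Proof. intros H. now apply cond_pos_sum. Qed.

Lemma sum_f_R0_ge_term (u : nat -> R) (m N : nat) :
  (forall n, 0 <= u n) -> (m <= N)%nat -> u m <= sum_f_R0 u N.
Proof.
  intros Hu Hm. induction N as [|N IH].
  - replace m with O by lia. simpl. lra.
  - rewrite tech5. destruct (Nat.eq_dec m (S N)) as [->|Hne].
    + assert (H := sum_f_R0_nonneg u N Hu). lra.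
    + specialize (IH ltac:(lia)). specialize (Hu (S N)). lra.
Qed.

Lemma sum_f_R0_extend (u : nat -> R) (k N : nat) :
  (forall n, (k < n)%nat -> u n = 0) -> (k <= N)%nat -> sum_f_R0 u N = sum_f_R0 u k.
Proof.
  intros Hu Hk. induction N as [|N IH].
  - now replace k with O by lia.
  - destruct (Nat.eq_dec k (S N)) as [->|Hne]; [reflexivity|].
    rewrite tech5, IH, Hu by lia. ring.
Qed.

Lemma sum_f_R0_le_support (u : nat -> R) (k N : nat) :
  (forall n, 0 <= u n) -> (forall n, (k < n)%nat -> u n = 0) ->
  sum_f_R0 u N <= sum_f_R0 u k.
Proof.
  intros H0 Hu.
  rewrite <- (sum_f_R0_extend u k (k + N)) by (auto; lia).
  induction k as [|k IH]; [right; reflexivity|].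
  clear IH. replace (S k + N)%nat with (N + S k)%nat by lia.
  generalize (S k). intros j. induction j as [|j IH]; [rewrite Nat.add_0_r; lra|].
  rewrite Nat.add_succ_r, tech5. specialize (H0 (S (N + j))). lra.
Qed.

(** The contribution of [e n * y ^ n * PSeries (s n) y] to the coefficient of [y ^ k]. *)
Definition diag_term (e : nat -> R) (s : nat -> nat -> R) (k n : nat) : R :=
  if Nat.leb n k then e n * s n (k - n)%nat else 0.

Lemma Series_diag_column (e : nat -> R) (s : nat -> nat -> R) (n : nat) (y : R) :
  Series (fun k => y ^ k * diag_term e s k n) = e n * y ^ n * PSeries (s n) y.
Proof.
  rewrite (Series_incr_n_aux _ n).
  - unfold PSeries. rewrite <- Series_scal_l. apply Series_ext. intros k.
    unfold diag_term. rewrite (proj2 (Nat.leb_le n (n + k))) by lia.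
    replace (n + k - n)%nat with k by lia. rewrite pow_add. ring.
  - intros k Hk. unfold diag_term. rewrite (proj2 (Nat.leb_gt n k)) by lia. ring.
Qed.

Lemma ex_series_diag_column (e : nat -> R) (s : nat -> nat -> R) (n : nat) (y : R) :
  entire_seq (s n) -> ex_series (fun k => y ^ k * diag_term e s k n).
Proof.
  intros Hs. apply (ex_series_incr_n _ n).
  apply (ex_series_ext (fun k => (e n * y ^ n) * (s n k * y ^ k))).
  - intros k. unfold diag_term. rewrite (proj2 (Nat.leb_le n (n + k))) by lia.
    replace (n + k - n)%nat with k by lia. rewrite pow_add. simpl. ring.
  - apply (@ex_series_scal R_AbsRing R_NormedModule), entire_seq_ex, Hs.
Qed.

Lemma Series_sum_f_R0 (u : nat -> nat -> R) (N : nat) :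
  (forall n, ex_series (u n)) ->
  ex_series (fun k => sum_f_R0 (fun n => u n k) N) /\
  Series (fun k => sum_f_R0 (fun n => u n k) N) = sum_f_R0 (fun n => Series (u n)) N.
Proof.
  intros Hu. induction N as [|N [IH1 IH2]]; simpl.
  - split; [apply (ex_series_ext (u O)); auto | now apply Series_ext].
  - split.
    + now apply (@ex_series_plus R_AbsRing R_NormedModule).
    + rewrite <- IH2. now apply Series_plus.
Qed.

(** The binomial theorem at [1 + 1]: entries of size [1/(n! j!)] sum along [n + j = k] to [2^k/k!],
    so the dominating series of the double sum is again exponential. *)
Lemma sum_inv_fact_mult (M : R) (k : nat) :
  sum_f_R0 (diag_term (fun n => / INR (Factorial.fact n))
                      (fun _ j => M / INR (Factorial.fact j)) k) k =
  M * 2 ^ k / INR (Factorial.fact k).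
Proof.
  replace 2 with (1 + 1) by ring. rewrite binomial.
  unfold Rdiv. rewrite (Rmult_comm M), Rmult_assoc, Rmult_comm, scal_sum.
  apply sum_eq. intros n Hn. unfold diag_term. rewrite (proj2 (Nat.leb_le n k)) by auto.
  rewrite !pow1. unfold Binomial.C.
  assert (H1 := INR_fact_lt_0 n). assert (H2 := INR_fact_lt_0 k).
  assert (H3 := INR_fact_lt_0 (k - n)). field. lra.
Qed.

(* The partial sums of the double series minus the term [m] are nonnegative and dominated. *)
Lemma PSeries_diag_ge (al e : nat -> R) (s : nat -> nat -> R) (M y : R) :
  0 < y -> (forall n, 0 <= e n) -> (forall n, entire_seq (s n)) ->
  (forall n j, Rabs (e n * s n j) <= / INR (Factorial.fact n) * (M / INR (Factorial.fact j))) ->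
  (forall k, al k = sum_f_R0 (diag_term e s k) k) ->
  (forall n, 0 <= PSeries (s n) y) ->
  entire_seq al ->
  forall m, e m * y ^ m * PSeries (s m) y <= PSeries al y.
Proof.
  intros Hy He Hs HM Hal Hpos Hent m.
  set (B := diag_term (fun n => / INR (Factorial.fact n))
                      (fun _ j => M / INR (Factorial.fact j))).
  assert (HB : forall k n, Rabs (diag_term e s k n) <= B k n).
  { intros k n. unfold B, diag_term. destruct (Nat.leb n k); [apply HM|].
    rewrite Rabs_R0; lra. }
  assert (HB0 : forall k n, 0 <= B k n)
    by (intros; eapply Rle_trans; [apply Rabs_pos | apply HB]).
  assert (HBs : forall k N, sum_f_R0 (B k) N <= M * 2 ^ k / INR (Factorial.fact k)).
  { intros k N. rewrite <- sum_inv_fact_mult. apply sum_f_R0_le_support; [apply HB0|].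
    intros n Hn. unfold diag_term. now rewrite (proj2 (Nat.leb_gt n k)). }
  assert (Hx : forall n, 0 <= e n * y ^ n * PSeries (s n) y).
  { intros n. apply Rmult_le_pos; auto. apply Rmult_le_pos; auto. apply pow_le; lra. }
  set (u := fun N k => y ^ k * (sum_f_R0 (diag_term e s k) (N + m) - diag_term e s k m)).
  enough (H : 0 <= Series (fun k => al k * y ^ k - y ^ k * diag_term e s k m)).
  { rewrite Series_minus, Series_diag_column in H;
      [unfold PSeries at 2; lra | now apply entire_seq_ex | now apply ex_series_diag_column]. }
  apply (Series_nonneg_of_dominated_lim u _
    (fun k => 2 * M * (2 * y) ^ k / INR (Factorial.fact k))).
  - apply ex_series_exp_bound.
  - intros N k. unfold u. rewrite Rabs_mult, Rabs_pos_eq by (apply pow_le; lra).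
    assert (H1 : Rabs (sum_f_R0 (diag_term e s k) (N + m)) <= M * 2 ^ k / INR (Factorial.fact k)).
    { eapply Rle_trans; [apply Rsum_abs|]. eapply Rle_trans; [|apply (HBs k (N + m)%nat)].
      apply sum_Rle. intros; apply HB. }
    assert (H2 : Rabs (diag_term e s k m) <= M * 2 ^ k / INR (Factorial.fact k)).
    { eapply Rle_trans; [apply HB|]. eapply Rle_trans; [|apply (HBs k m)].
      apply sum_f_R0_ge_term; auto. }
    rewrite Rpow_mult_distr.
    replace (2 * M * (2 ^ k * y ^ k) / INR (Factorial.fact k))
      with (y ^ k * (M * 2 ^ k / INR (Factorial.fact k) + M * 2 ^ k / INR (Factorial.fact k)))
      by (field; apply INR_fact_neq_0).
    apply Rmult_le_compat_l; [apply pow_le; lra|].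
    unfold Rminus. eapply Rle_trans; [apply Rabs_triang|]. rewrite Rabs_Ropp. lra.
  - intros k. apply (is_lim_seq_ext_loc (fun _ => al k * y ^ k - y ^ k * diag_term e s k m)).
    + exists k. intros N HN. unfold u.
      rewrite (sum_f_R0_extend _ k) by
        (try lia; intros n Hn; unfold diag_term; now rewrite (proj2 (Nat.leb_gt n k))).
      rewrite <- Hal. ring.
    + apply is_lim_seq_const.
  - intros N. unfold u.
    rewrite (Series_ext _ (fun k => sum_f_R0 (fun n => y ^ k * diag_term e s k n) (N + m)
                                    - y ^ k * diag_term e s k m)).
    + destruct (Series_sum_f_R0 (fun n k => y ^ k * diag_term e s k n) (N + m)) as [Hex Hse].
      { intros n. now apply ex_series_diag_column. }
      rewrite Series_minus, Hse; auto; [|now apply ex_series_diag_column].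
      rewrite Series_diag_column.
      rewrite (sum_eq _ (fun n => e n * y ^ n * PSeries (s n) y))
        by (intros; apply Series_diag_column).
      assert (H := sum_f_R0_ge_term (fun n => e n * y ^ n * PSeries (s n) y) m (N + m) Hx
                     ltac:(lia)).
      simpl in H. lra.
    + intros k. rewrite Rmult_minus_distr_l, scal_sum. f_equal.
      apply sum_eq. intros; ring.
Qed.

(** What is left of a term once [(a)_k], [(a+1/2)_k] and [(2a)_(k+n)] are split at [n]; the
    duplication formula for [(2a)_(2n)] brings in [4^n] and the second factor [(a+1/2)_n]. *)
Definition gasper_weight (a b c : R) (n : nat) : R :=
  gasper_coef a b c n / (4 ^ n * (poch (a + 1 / 2) n * poch (a + 1 / 2) n)).

(** With [mu = a + n + 1/2] these are the parameters of [PSeries_hyp_square], so each block is a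
    square. *)
Definition gasper_block (a : R) (n : nat) : nat -> R :=
  hyp (a + INR n) (a + INR n + 1 / 2) (2 * a + 2 * INR n).

Lemma gasper_expansion (a b c : R) (k : nat) :
  0 < a -> 0 < b -> 0 < c -> b + c = 3 * a + 1 / 2 ->
  hyp a b c k = sum_f_R0 (diag_term (gasper_weight a b c) (gasper_block a) k) k.
Proof.
  intros Ha Hb Hc E.
  rewrite (sum_eq _ (fun n => gasper_term a b c k n
                               * ((-1) ^ k * poch a k / poch (a + 1 / 2) k))).
  - rewrite <- scal_sum, gasper_sum by auto. unfold hyp.
    assert (H1 := poch_pos b k Hb). assert (H2 := poch_pos c k Hc).
    assert (H3 := poch_pos (a + 1 / 2) k ltac:(lra)). assert (Hf := INR_fact_lt_0 k).
    field. lra.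
  - intros n Hn. unfold diag_term, gasper_term, inv_fact_sub, gasper_weight, gasper_block, hyp.
    rewrite (proj2 (Nat.leb_le n k)) by auto.
    set (j := (k - n)%nat). replace k with (n + j)%nat by (unfold j; lia).
    replace (n + j + n)%nat with (2 * n + j)%nat by lia.
    rewrite !poch_add, poch_double, pow_add, mult_INR. simpl (INR 2).
    replace (a + 1 / 2 + INR n) with (a + INR n + 1 / 2) by ring.
    assert (Hnn := pos_INR n). assert (Hf := INR_fact_lt_0 j).
    assert (H1 := poch_pos a n ltac:(lra)). assert (H2 := poch_pos (a + 1 / 2) n ltac:(lra)).
    assert (H3 := poch_pos (a + INR n) j ltac:(lra)).
    assert (H4 := poch_pos (a + INR n + 1 / 2) j ltac:(lra)).
    assert (H5 := poch_pos (2 * a + 2 * INR n) j ltac:(lra)).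
    assert (H6 : 0 < 4 ^ n) by (apply pow_lt; lra).
    assert (H7 : (-1) ^ n * (-1) ^ n = 1).
    { rewrite <- Rpow_mult_distr. replace (-1 * -1) with 1 by ring. apply pow1. }
    replace (1 + 1) with 2 by ring.
    (* The sign [(-1)^(n+j)] of [hyp] and the sign [(-1)^n] of [gasper_term] combine to the [(-1)^j]
       that the block carries; the weights are left without alternation. *)
    transitivity (((-1) ^ n * (-1) ^ n) * ((-1) ^ j * gasper_coef a b c n * poch (a + INR n) j
      / (4 ^ n * poch (a + 1 / 2) n * poch (a + 1 / 2) n * INR (Factorial.fact j)
         * poch (a + INR n + 1 / 2) j * poch (2 * a + 2 * INR n) j))).
    + rewrite H7. field. lra.
    + field. lra.
Qed.

(** The numbers [2a - b] and [b - a - 1/2] do not have opposite signs and exceed -1, so beyond their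
    first factors both Pochhammer symbols are positive. For the upper bound the two symbols are
    dominated by [(b)_n] and [(c)_n], and the remaining numerator by [2^n (a+1/2)_n]. *)
Lemma gasper_weight_bounds (a b c : R) (n : nat) :
  0 < a -> 0 < b -> 0 < c -> b + c = 3 * a + 1 / 2 ->
  0 <= (2 * a - b) * (b - a - 1 / 2) -> - 1 < 2 * a - b -> - 1 < b - a - 1 / 2 ->
  0 <= gasper_weight a b c n <= / Rmin 1 (a + 1 / 2) / INR (Factorial.fact n).
Proof.
  intros Ha Hb Hc E Hs Hl1 Hl2. unfold gasper_weight.
  destruct n as [|m].
  { simpl. assert (H1 : 0 < Rmin 1 (a + 1 / 2)) by (apply Rmin_pos; lra).
    assert (H2 := Rmin_l 1 (a + 1 / 2)).
    assert (H3 := Rinv_le_contravar _ _ H1 H2). rewrite Rinv_1 in H3.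
    unfold Rdiv. rewrite !Rmult_1_r, !Rinv_1. lra. }
  set (n := S m).
  assert (Hn : 0 < INR n) by (apply lt_0_INR; unfold n; lia).
  assert (Hm := pos_INR m).
  assert (H1 := poch_pos (2 * a) m ltac:(lra)). assert (H2 := poch_pos b n Hb).
  assert (H3 := poch_pos c n Hc). assert (H4 := poch_pos (a + 1 / 2) n ltac:(lra)).
  assert (Hf := INR_fact_lt_0 n). assert (H6 : 0 < 4 ^ n) by (apply pow_lt; lra).
  set (q := poch (2 * a - b) n * poch (b - a - 1 / 2) n / (poch b n * poch c n)).
  assert (Hq0 : 0 <= q).
  { unfold q, n. apply Rmult_le_pos.
    - rewrite !poch_S_l.
      replace ((2 * a - b) * poch (2 * a - b + 1) m * ((b - a - 1 / 2) * poch (b - a - 1 / 2 + 1) m))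
        with ((2 * a - b) * (b - a - 1 / 2)
              * (poch (2 * a - b + 1) m * poch (b - a - 1 / 2 + 1) m)) by ring.
      apply Rmult_le_pos; auto.
      left. apply Rmult_lt_0_compat; apply poch_pos; lra.
    - left. apply Rinv_0_lt_compat, Rmult_lt_0_compat; auto. }
  assert (Hq1 : q <= 1).
  (* The sign condition forces [a <= b <= 2a + 1/2]: outside this range the two factors have
     opposite signs. *)
  { assert (Hx : Rabs (2 * a - b) <= b).
    { apply Rabs_le. split; [lra|]. destruct (Rle_or_lt a b); [lra|nra]. }
    assert (Hy : Rabs (b - a - 1 / 2) <= c).
    { apply Rabs_le. split; [lra|]. destruct (Rle_or_lt b (2 * a + 1 / 2)); nra. }
    assert (Hxa := poch_abs_le _ _ n Hx). assert (Hya := poch_abs_le _ _ n Hy).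
    unfold q. apply Rmult_le_reg_r with (poch b n * poch c n); [now apply Rmult_lt_0_compat|].
    unfold Rdiv. rewrite Rmult_assoc, Rinv_l, Rmult_1_r, (Rmult_1_l (poch b n * poch c n))
      by (apply Rgt_not_eq; now apply Rmult_lt_0_compat).
    eapply Rle_trans; [apply Rle_abs|]. rewrite Rabs_mult.
    apply Rmult_le_compat; auto using Rabs_pos. }
  assert (Hc2 : (2 * INR m + 2 * a + 1) * poch (2 * a) m <= 2 ^ n * poch (a + 1 / 2) n).
  { unfold n. cbn [pow poch].
    assert (H : poch (2 * a) m <= 2 ^ m * poch (a + 1 / 2) m).
    { clear - Ha. induction m as [|m IH]; simpl; [lra|].
      assert (Hm := pos_INR m). assert (H1 := poch_pos (2 * a) m ltac:(lra)).
      replace (2 * 2 ^ m * (poch (a + 1 / 2) m * (a + 1 / 2 + INR m)))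
        with ((2 ^ m * poch (a + 1 / 2) m) * (2 * (a + 1 / 2 + INR m))) by ring.
      apply Rmult_le_compat; lra. }
    replace (2 * 2 ^ m * (poch (a + 1 / 2) m * (a + 1 / 2 + INR m)))
      with ((2 * INR m + 2 * a + 1) * (2 ^ m * poch (a + 1 / 2) m)) by field.
    apply Rmult_le_compat_l; lra. }
  assert (Hw : gasper_coef a b c n / (4 ^ n * (poch (a + 1 / 2) n * poch (a + 1 / 2) n)) =
    (2 * INR m + 2 * a + 1) * poch (2 * a) m * q
    / (4 ^ n * poch (a + 1 / 2) n * poch (a + 1 / 2) n * INR (Factorial.fact n))).
  { unfold q. change (gasper_coef a b c n) with
      ((2 * INR m + 2 * a + 1) * poch (2 * a) m / INR (Factorial.fact n)
       * (poch (2 * a - b) n * poch (b - a - 1 / 2) n) / (poch b n * poch c n)).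
    field. lra. }
  rewrite Hw. clear Hw. clearbody q n. split.
  - apply Rmult_le_pos.
    + apply Rmult_le_pos; auto. apply Rmult_le_pos; lra.
    + left. apply Rinv_0_lt_compat. repeat apply Rmult_lt_0_compat; auto.
  - apply Rle_trans with (2 ^ n * poch (a + 1 / 2) n * 1
      / (4 ^ n * poch (a + 1 / 2) n * poch (a + 1 / 2) n * INR (Factorial.fact n))).
    + apply Rmult_le_compat_r.
      * left. apply Rinv_0_lt_compat. repeat apply Rmult_lt_0_compat; auto.
      * apply Rmult_le_compat; auto; try lra. apply Rmult_le_pos; lra.
    + replace (4 ^ n) with (2 ^ n * 2 ^ n) by (rewrite <- Rpow_mult_distr; f_equal; ring).
      assert (H2n : 1 <= 2 ^ n) by (apply pow_R1_Rle; lra).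
      replace (2 ^ n * poch (a + 1 / 2) n * 1
        / (2 ^ n * 2 ^ n * poch (a + 1 / 2) n * poch (a + 1 / 2) n * INR (Factorial.fact n)))
        with (/ (2 ^ n * poch (a + 1 / 2) n) * / INR (Factorial.fact n)) by (field; lra).
      apply Rmult_le_compat_r; [left; now apply Rinv_0_lt_compat|].
      assert (Hmin := poch_ge_min (a + 1 / 2) n ltac:(lra)).
      assert (Hmp : 0 < Rmin 1 (a + 1 / 2)) by (apply Rmin_pos; lra).
      apply Rinv_le_contravar; auto. nra.
Qed.

Lemma gasper_weight_pos (a b c : R) (n : nat) :
  0 < a -> 0 < b -> 0 < c ->
  0 < (2 * a - b) * (b - a - 1 / 2) -> - 1 < 2 * a - b -> - 1 < b - a - 1 / 2 ->
  0 < gasper_weight a b c n.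
Proof.
  intros Ha Hb Hc Hs Hl1 Hl2. unfold gasper_weight.
  assert (H4 := poch_pos (a + 1 / 2) n ltac:(lra)).
  assert (H6 : 0 < 4 ^ n) by (apply pow_lt; lra).
  apply Rdiv_lt_0_compat; [|repeat apply Rmult_lt_0_compat; auto].
  destruct n as [|m]; [simpl; lra|]. unfold gasper_coef.
  assert (Hm := pos_INR m).
  apply Rdiv_lt_0_compat; [|apply Rmult_lt_0_compat; now apply poch_pos].
  apply Rmult_lt_0_compat.
  - apply Rdiv_lt_0_compat; [|apply INR_fact_lt_0].
    apply Rmult_lt_0_compat; [lra|]. apply poch_pos; lra.
  - rewrite !poch_S_l.
    replace ((2 * a - b) * poch (2 * a - b + 1) m * ((b - a - 1 / 2) * poch (b - a - 1 / 2 + 1) m))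
      with ((2 * a - b) * (b - a - 1 / 2)
            * (poch (2 * a - b + 1) m * poch (b - a - 1 / 2 + 1) m)) by ring.
    apply Rmult_lt_0_compat; auto.
    apply Rmult_lt_0_compat; apply poch_pos; lra.
Qed.

Lemma gasper_block_square (a y : R) (n : nat) :
  0 < a ->
  PSeries (gasper_block a n) y =
  PSeries (bessel_quarter (a + INR n + 1 / 2)) y * PSeries (bessel_quarter (a + INR n + 1 / 2)) y.
Proof.
  intros Ha. assert (Hn := pos_INR n).
  rewrite <- PSeries_hyp_square by lra. unfold gasper_block.
  apply PSeries_ext. intros k. f_equal; field.
Qed.

(** All squares but one are dropped. The index 0 suffices for nonnegativity; strict positivity uses
    an index depending on [y]. *)
Lemma hyp_segment_ge (a b c y : R) (m : nat) :
  0 < a -> 0 < b -> 0 < c -> b + c = 3 * a + 1 / 2 -> 0 < y ->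
  0 <= (2 * a - b) * (b - a - 1 / 2) -> - 1 < 2 * a - b -> - 1 < b - a - 1 / 2 ->
  gasper_weight a b c m * y ^ m * PSeries (gasper_block a m) y <= PSeries (hyp a b c) y.
Proof.
  intros Ha Hb Hc E Hy Hs Hl1 Hl2.
  apply (PSeries_diag_ge (hyp a b c) (gasper_weight a b c) (gasper_block a)
           (/ Rmin 1 (a + 1 / 2) * / Rmin 1 (2 * a))); auto.
  - intros n. now apply gasper_weight_bounds.
  - intros n. assert (Hn := pos_INR n). apply entire_seq_hyp; lra.
  - intros n j. destruct (gasper_weight_bounds a b c n) as [Hw0 Hw1]; auto.
    rewrite Rabs_mult, (Rabs_pos_eq _ Hw0).
    assert (Hn := pos_INR n).
    replace (/ INR (Factorial.fact n) *
      (/ Rmin 1 (a + 1 / 2) * / Rmin 1 (2 * a) / INR (Factorial.fact j)))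
      with ((/ Rmin 1 (a + 1 / 2) / INR (Factorial.fact n))
            * (/ Rmin 1 (2 * a) / INR (Factorial.fact j))) by (unfold Rdiv; ring).
    apply Rmult_le_compat; auto using Rabs_pos.
    unfold gasper_block, hyp.
    assert (H3 := poch_pos (a + INR n) j ltac:(lra)).
    assert (H4 := poch_pos (a + INR n + 1 / 2) j ltac:(lra)).
    assert (H5 := poch_pos (2 * a + 2 * INR n) j ltac:(lra)).
    assert (Hf := INR_fact_lt_0 j).
    assert (H6 := poch_le (a + INR n) (a + INR n + 1 / 2) j ltac:(lra)).
    assert (H7 := poch_le (2 * a) (2 * a + 2 * INR n) j ltac:(lra)).
    assert (H8 := poch_ge_min (2 * a) j ltac:(lra)).
    assert (H9 : 0 < Rmin 1 (2 * a)) by (apply Rmin_pos; lra).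
    replace ((-1) ^ j * poch (a + INR n) j
      / (INR (Factorial.fact j) * poch (a + INR n + 1 / 2) j * poch (2 * a + 2 * INR n) j))
      with ((-1) ^ j * (/ poch (2 * a + 2 * INR n) j
        * (poch (a + INR n) j / poch (a + INR n + 1 / 2) j) / INR (Factorial.fact j)))
      by (field; lra).
    assert (Hr : 0 < poch (a + INR n) j / poch (a + INR n + 1 / 2) j <= 1).
    { split; [now apply Rdiv_lt_0_compat|].
      apply Rmult_le_reg_r with (poch (a + INR n + 1 / 2) j); auto.
      unfold Rdiv. rewrite Rmult_assoc, Rinv_l; lra. }
    assert (Hi : 0 < / poch (2 * a + 2 * INR n) j) by now apply Rinv_0_lt_compat.
    rewrite Rabs_mult, pow_1_abs, Rmult_1_l, Rabs_pos_eq.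
    + apply Rmult_le_compat_r; [left; now apply Rinv_0_lt_compat|].
      rewrite <- (Rmult_1_r (/ Rmin 1 (2 * a))).
      apply Rmult_le_compat; try lra. apply Rinv_le_contravar; lra.
    + left. apply Rdiv_lt_0_compat; auto. apply Rmult_lt_0_compat; lra.
  - intros k. now apply gasper_expansion.
  - intros n. rewrite gasper_block_square by auto. apply Rle_0_sqr.
  - now apply entire_seq_hyp.
Qed.

Lemma nonneg_hyp_segment (a b c : R) :
  0 < a -> 0 < b -> 0 < c -> b + c = 3 * a + 1 / 2 ->
  0 <= (2 * a - b) * (b - a - 1 / 2) -> nonneg_hyp a b c.
Proof.
  intros Ha Hb Hc E Hs y Hy.
  eapply Rle_trans; [|apply (hyp_segment_ge a b c y 0); auto; nra].
  unfold gasper_weight. simpl. rewrite gasper_block_square by auto.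
  rewrite !Rmult_1_l. unfold Rdiv. rewrite Rinv_1, !Rmult_1_l. apply Rle_0_sqr.
Qed.

Lemma pos_hyp_segment (a b c : R) :
  0 < a -> 0 < b -> 0 < c -> b + c = 3 * a + 1 / 2 ->
  0 < (2 * a - b) * (b - a - 1 / 2) -> pos_hyp a b c.
Proof.
  intros Ha Hb Hc E Hs y Hy.
  destruct (bessel_quarter_pos_large y Hy) as [m Hm].
  eapply Rlt_le_trans; [|apply (hyp_segment_ge a b c y m); auto; nra].
  rewrite gasper_block_square by auto.
  assert (H := Hm (a + INR m + 1 / 2) ltac:(lra)).
  apply Rmult_lt_0_compat; [|now apply Rmult_lt_0_compat].
  apply Rmult_lt_0_compat; [|now apply pow_lt].
  apply gasper_weight_pos; auto; nra.
Qed.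

Lemma nonneg_hyp_region (a b c : R) :
  0 < a -> Rmin (a + 1 / 2) (2 * a) <= b -> Rmin (a + 1 / 2) (2 * a) <= c ->
  3 * a + 1 / 2 <= b + c ->
  nonneg_hyp a b c /\ (~ Lambda a (b, c) -> pos_hyp a b c).
Proof.
  intros Ha.
  assert (Hm : exists m M, Rmin (a + 1 / 2) (2 * a) = m /\ m <= M /\ m + M = 3 * a + 1 / 2 /\
            (forall z, (2 * a - z) * (z - a - 1 / 2) = (z - m) * (M - z)) /\
            (forall p, p = (m, M) \/ p = (M, m) -> Lambda a p)).
  { unfold Rmin. destruct (Rle_dec (a + 1 / 2) (2 * a)) as [H|H].
    - exists (a + 1 / 2), (2 * a). repeat split; try lra; try (intros; ring).
      intros p [E|E]; rewrite E; [now left | now right].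
    - exists (2 * a), (a + 1 / 2). repeat split; try lra; try (intros; ring).
      intros p [E|E]; rewrite E; [now right | now left]. }
  destruct Hm as (m & M & Em & HmM & HmM2 & Hq & HL). rewrite Em. intros Hb Hc Hbc.
  assert (Hm0 : 0 < m).
  { destruct (Rlt_or_le 0 m); auto. specialize (Hq 0). nra. }
  assert (Hseg : forall z, m <= z <= M -> nonneg_hyp a z (3 * a + 1 / 2 - z)).
  { intros z Hz. apply nonneg_hyp_segment; try lra. rewrite Hq. apply Rmult_le_pos; lra. }
  (* The point [(b0, 3a+1/2-b0)] lies on the critical segment, below and to the left of [(b, c)]. *)
  set (b0 := Rmin b M).
  assert (Hb0 : m <= b0 <= M /\ b0 <= b /\ 3 * a + 1 / 2 - b0 <= c).
  { unfold b0, Rmin. destruct (Rle_dec b M); repeat split; lra. }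
  split.
  - apply nonneg_hyp_raise with b0 (3 * a + 1 / 2 - b0); try lra. apply Hseg; lra.
  - intros HnL.
    destruct (Rlt_or_le b0 b) as [Hlt|Hle].
    { apply pos_hyp_raise with b0 (3 * a + 1 / 2 - b0); try lra. apply Hseg; lra. }
    destruct (Rlt_or_le (3 * a + 1 / 2 - b0) c) as [Hlt|Hle'].
    { apply pos_hyp_raise with b0 (3 * a + 1 / 2 - b0); try lra. apply Hseg; lra. }
    (* Nothing is left to raise: the point is on the segment itself and, being off [Lambda], in its
       interior, where all weights are strictly positive. *)
    assert (Eb : b0 = b) by lra. rewrite Eb in *.
    apply pos_hyp_segment; try lra. rewrite Hq.
    assert (b <> m) by (intros ->; apply HnL, HL; left; f_equal; lra).
    assert (b <> M) by (intros ->; apply HnL, HL; right; f_equal; lra).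
    apply Rmult_lt_0_compat; lra.
Qed.

(** * Decay and the geometry of the regions *)

Definition dhyp (a b c y : R) : R :=
  - (a / (b * c)) * PSeries (hyp (a + 1) (b + 1) (c + 1)) y.

Lemma is_derive_hyp (a b c y : R) :
  0 < a -> 0 < b -> 0 < c -> is_derive (PSeries (hyp a b c)) y (dhyp a b c y).
Proof.
  intros Ha Hb Hc.
  replace (dhyp a b c y) with (PSeries (PS_derive (hyp a b c)) y).
  - now apply PSeries_entire_theta, entire_seq_hyp.
  - unfold dhyp, PSeries. rewrite <- Series_scal_l. apply Series_ext. intros k.
    unfold PS_derive, hyp. rewrite !poch_S_l, INR_fact_S, S_INR. cbn [pow].
    assert (Hk := pos_INR k). assert (Hf := INR_fact_lt_0 k).
    assert (H1 := poch_pos (b + 1) k ltac:(lra)). assert (H2 := poch_pos (c + 1) k ltac:(lra)).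
    field. lra.
Qed.

Lemma hyp_theta_linear (a b c p y : R) :
  0 < a -> 0 < b -> 0 < c ->
  y * dhyp a b c y + p * PSeries (hyp a b c) y
  = PSeries (fun k => (p + INR k) * hyp a b c k) y.
Proof.
  intros Ha Hb Hc. assert (He := entire_seq_hyp a b c Ha Hb Hc).
  destruct (PSeries_entire_theta _ y He) as [H1 H2].
  replace (dhyp a b c y) with (PSeries (PS_derive (hyp a b c)) y).
  - rewrite H2. rewrite <- (Rmult_1_l (PSeries (fun k => INR k * hyp a b c k) y)).
    rewrite <- PSeries_entire_linear; auto using entire_seq_mult_INR.
    apply PSeries_ext. intros; ring.
  - rewrite <- (is_derive_unique _ _ _ H1). now apply is_derive_unique, is_derive_hyp.
Qed.

Lemma hyp_theta_b (a b c y : R) :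
  0 < a -> 0 < b -> 0 < c ->
  y * dhyp a (b + 1) c y + b * PSeries (hyp a (b + 1) c) y = b * PSeries (hyp a b c) y.
Proof.
  intros Ha Hb Hc. rewrite hyp_theta_linear by lra.
  unfold PSeries. rewrite <- Series_scal_l. apply Series_ext. intros k.
  unfold hyp. assert (E := poch_shift b k).
  assert (Hk := pos_INR k). assert (Hf := INR_fact_lt_0 k).
  assert (H1 := poch_pos b k ltac:(lra)). assert (H2 := poch_pos c k ltac:(lra)).
  replace (poch (b + 1) k) with (poch b k * (b + INR k) / b) by (rewrite <- E; field; lra).
  field. lra.
Qed.

Lemma hyp_theta_a (a b c y : R) :
  0 < a -> 0 < b -> 0 < c ->
  y * dhyp a b c y + a * PSeries (hyp a b c) y = a * PSeries (hyp (a + 1) b c) y.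
Proof.
  intros Ha Hb Hc. rewrite hyp_theta_linear by lra.
  unfold PSeries. rewrite <- Series_scal_l. apply Series_ext. intros k.
  unfold hyp. assert (E := poch_shift a k).
  assert (Hf := INR_fact_lt_0 k).
  assert (H1 := poch_pos b k ltac:(lra)). assert (H2 := poch_pos c k ltac:(lra)).
  replace (poch (a + 1) k) with (poch a k * (a + INR k) / a) by (rewrite <- E; field; lra).
  field. lra.
Qed.

Lemma ln_le_minus_1 (x : R) : 0 < x -> ln x <= x - 1.
Proof. intros Hx. assert (H := exp_ineq1_le (ln x)). rewrite exp_ln in H; lra. Qed.

(** From [ln u <= u - 1] at [u = d t / s], which gives the constant [(s/d)^s]. *)
Lemma Rpower_le_exp (s d : R) :
  0 < s -> 0 < d ->
  exists C, 0 < C /\ forall t, 0 < t -> Rpower t s <= C * exp (d * t).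
Proof.
  intros Hs Hd. exists (exp (- s * ln (d / s))). split; [apply exp_pos|].
  intros t Ht. unfold Rpower. rewrite <- exp_plus.
  assert (Hds : 0 < d / s) by now apply Rdiv_lt_0_compat.
  assert (H := ln_le_minus_1 (d / s * t) ltac:(now apply Rmult_lt_0_compat)).
  rewrite ln_mult in H by auto.
  assert (H2 : s * ln t <= - s * ln (d / s) + d * t).
  { replace (d * t) with (s * (d / s * t)) by (field; lra). nra. }
  destruct H2 as [H2|H2]; [left; now apply exp_increasing | right; now f_equal].
Qed.

Lemma PSeries_hyp_cancel (a c y : R) (b : R) :
  0 < a -> 0 < b -> 0 < c -> PSeries (hyp a a c) y = PSeries (hyp b b c) y.
Proof.
  intros Ha Hb Hc. apply PSeries_ext. intros k. unfold hyp.
  assert (Hf := INR_fact_lt_0 k). assert (H1 := poch_pos a k Ha).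
  assert (H2 := poch_pos b k Hb). assert (H3 := poch_pos c k Hc). field. lra.
Qed.

(* If [f_c = 0F1(; c; -y)] is nonnegative, then [f_(c+1)] decays exponentially,
   but [(y^c f_(c+1))' = c y^(c-1) f_c >= 0]. *)
Lemma bessel_not_nonneg (a c : R) : 0 < a -> 0 < c -> ~ nonneg_hyp a a c.
Proof.
  intros Ha Hc H.
  assert (Hraise : forall c', c < c' -> pos_hyp a a c').
  { intros c' Hc'. apply pos_hyp_raise with a c; auto; lra. }
  set (f := PSeries (hyp a a (c + 1))).
  assert (Hf1 : 0 < f 1) by (apply Hraise; lra).
  assert (Hd : forall d y, 0 < d -> dhyp a a d y = - / d * PSeries (hyp a a (d + 1)) y).
  { intros d y Hd. unfold dhyp. rewrite (PSeries_hyp_cancel (a + 1) (d + 1) y a) by lra.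
    field. lra. }
  (* With [f_d = 0F1(; d; -y)]: in [(th + c + 1) f_(c+2) = (c+1) f_(c+1)] the term [th f_(c+2)] is a
     negative multiple of [y f_(c+3)], hence [f_(c+1) <= f_(c+2)]. As [f_(c+1)' = - q f_(c+2)], this
     yields [f_(c+1)' <= - q f_(c+1)]. *)
  assert (Hinc : forall y, 0 < y -> f y <= PSeries (hyp a a (c + 2)) y).
  { intros y Hy. assert (E := hyp_theta_b a (c + 1) a y Ha ltac:(lra) Ha).
    rewrite !(PSeries_hyp_sym a _ a) in E.
    replace (dhyp a (c + 1 + 1) a y) with (dhyp a a (c + 2) y) in E.
    2:{ unfold dhyp. rewrite PSeries_hyp_sym.
        replace (c + 1 + 1) with (c + 2) by ring. f_equal. field. lra. }
    rewrite Hd in E by lra. replace (c + 1 + 1) with (c + 2) in E by ring.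
    assert (H3 := Hraise (c + 2 + 1) ltac:(lra) y Hy).
    assert (H4 : 0 < / (c + 2)) by (apply Rinv_0_lt_compat; lra).
    fold (f y) in E.
    assert (H5 : 0 <= y * (/ (c + 2) * PSeries (hyp a a (c + 2 + 1)) y)).
    { apply Rmult_le_pos; [lra|]. apply Rmult_le_pos; lra. }
    apply Rmult_le_reg_l with (c + 1); [lra|]. lra. }
  set (q := / (c + 1)).
  assert (Hq : 0 < q) by (apply Rinv_0_lt_compat; lra).
  assert (Hexp : forall y, 1 <= y -> exp (q * y) * f y <= exp (q * 1) * f 1).
  { intros y Hy. apply Ropp_le_cancel.
    apply (nondecreasing_of_derive (fun t => - (exp (q * t) * f t))
       (fun t => - (q * exp (q * t) * f t + exp (q * t) * dhyp a a (c + 1) t))); auto.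
    - intros x Hx. apply (@is_derive_opp R_AbsRing R_NormedModule (fun t => exp (q * t) * f t)).
      apply (is_derive_mult (fun t => exp (q * t)) f).
      + auto_derive; auto. ring.
      + apply is_derive_hyp; lra.
      + intros; apply Rmult_comm.
    - intros x Hx. rewrite Hd by lra. fold q. replace (c + 1 + 1) with (c + 2) by ring.
      assert (H1 := Hinc x ltac:(lra)). assert (H2 := exp_pos (q * x)).
      assert (0 <= exp (q * x) * q * (PSeries (hyp a a (c + 2)) x - f x)).
      { apply Rmult_le_pos; [apply Rmult_le_pos|]; lra. }
      lra. }
  assert (Hpow : forall y, 1 <= y -> f 1 <= Rpower y c * f y).
  { intros y Hy.
    replace (f 1) with (Rpower 1 c * f 1)
      by (unfold Rpower; rewrite ln_1, Rmult_0_r, exp_0; ring).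
    apply (Rpower_mult_nondecreasing f (dhyp a a (c + 1))); [lra| |].
    - intros x _. apply is_derive_hyp; lra.
    - intros x Hx. assert (E := hyp_theta_b a c a x Ha Hc Ha).
      rewrite !(PSeries_hyp_sym a _ a) in E.
      replace (dhyp a (c + 1) a x) with (dhyp a a (c + 1) x) in E.
      2:{ unfold dhyp. rewrite PSeries_hyp_sym. f_equal. field. lra. }
      fold (f x) in E. rewrite E. apply Rmult_le_pos; [lra | apply H; lra]. }
  destruct (Rpower_le_exp c (q / 2) Hc ltac:(lra)) as (C & HC & HCb).
  (* Chosen so that [e^(q y / 2) > C e^q], the point where exponential decay contradicts
     [f 1 <= y^c f y]. *)
  set (y := 1 + C * exp q * 2 / q).
  assert (Hy : 1 <= y).
  { unfold y. assert (0 < C * exp q * 2 / q); [|lra].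
    apply Rdiv_lt_0_compat; [|auto]. assert (H1 := exp_pos q). nra. }
  specialize (Hexp y Hy). specialize (Hpow y Hy). specialize (HCb y ltac:(lra)).
  rewrite Rmult_1_r in Hexp.
  assert (He : exp (q * y) = exp (q / 2 * y) * exp (q / 2 * y))
    by (rewrite <- exp_plus; f_equal; field).
  set (w := exp (q / 2 * y)) in *. assert (Hw : 0 < w) by apply exp_pos.
  assert (Hfy : 0 < f y) by (apply Hraise; lra).
  assert (Hw2 : C * exp q < w).
  { unfold w. eapply Rlt_le_trans; [|apply exp_ineq1_le]. unfold y.
    replace (1 + q / 2 * (1 + C * exp q * 2 / q)) with (1 + q / 2 + C * exp q) by (field; lra).
    lra. }
  assert (H1 : w * f 1 <= C * (exp (q * y) * f y)).
  { rewrite He. apply Rle_trans with (w * (C * w * f y)); [|right; ring].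
    apply Rmult_le_compat_l; [lra|]. nra. }
  assert (H2 : w * f 1 <= C * (exp q * f 1)).
  { eapply Rle_trans; [apply H1|]. apply Rmult_le_compat_l; lra. }
  nra.
Qed.

(** Up to positive constants and alternating signs the [D i] are the successive derivatives of
    [D 0], so nonnegativity of all makes each decreasing. The mean value theorem on [[y/2, y]] then
    bounds [y D (j+1) y] by a multiple of [D j (y/2)]: one power of [1/y] per derivative. *)
Lemma hyp_decay_iterated (a b c : R) (j : nat) :
  0 < a -> 0 < b -> 0 < c ->
  (forall i, (i <= S j)%nat -> nonneg_hyp (a + INR i) (b + INR i) (c + INR i)) ->
  exists K, forall y, 0 < y ->
    y ^ j * PSeries (hyp (a + INR j) (b + INR j) (c + INR j)) y <= K.
Proof.
  intros Ha Hb Hc.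
  set (D := fun i => PSeries (hyp (a + INR i) (b + INR i) (c + INR i))).
  set (r := fun i => (a + INR i) / ((b + INR i) * (c + INR i))).
  assert (Hr : forall i, 0 < r i).
  { intros i. assert (Hi := pos_INR i). unfold r.
    apply Rdiv_lt_0_compat; [lra|]. apply Rmult_lt_0_compat; lra. }
  assert (HD : forall i y, is_derive (D i) y (- r i * D (S i) y)).
  { intros i y. assert (Hi := pos_INR i).
    replace (- r i * D (S i) y) with (dhyp (a + INR i) (b + INR i) (c + INR i) y).
    - apply is_derive_hyp; lra.
    - unfold dhyp, D, r. rewrite S_INR, <- !Rplus_assoc. reflexivity. }
  assert (Hdec : forall i, nonneg_hyp (a + INR (S i)) (b + INR (S i)) (c + INR (S i)) ->
            forall s t, 0 <= s <= t -> D i t <= D i s).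
  { intros i Hn s t Hst. apply Ropp_le_cancel.
    apply (nondecreasing_of_derive (fun x => - D i x) (fun x => - (- r i * D (S i) x))); [lra| |].
    - intros x _. apply (@is_derive_opp R_AbsRing R_NormedModule (D i)), HD.
    - intros x Hx. assert (H := Hr i).
      assert (0 <= D (S i) x).
      { destruct (Req_dec x 0) as [->|Hx0]; [|apply Hn; lra].
        unfold D. rewrite PSeries_0, hyp_0. lra. }
      nra. }
  induction j as [|j IH]; intros Hn.
  - exists 1. intros y Hy. rewrite pow_O, Rmult_1_l. change (D O y <= 1).
    replace 1 with (D O 0) by (unfold D; rewrite PSeries_0; apply hyp_0).
    apply Hdec; [apply Hn; lia | lra].
  - destruct IH as [K HK]; [intros i Hi; apply Hn; lia|].
    exists (2 ^ S j * K / r j). intros y Hy.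
    change (y ^ S j * D (S j) y <= 2 ^ S j * K / r j).
    destruct (MVT_gen (D j) (y / 2) y (fun x => - r j * D (S j) x)) as (x & Hx & E).
    + intros; apply HD.
    + intros x _. apply derivable_continuous_pt. exists (- r j * D (S j) x).
      apply is_derive_Reals, HD.
    + rewrite Rmin_left, Rmax_right in Hx by lra.
      assert (H1 : D (S j) y <= D (S j) x) by (apply Hdec; [apply Hn; lia | lra]).
      assert (H2 : 0 <= D j y) by (apply Hn; [lia | lra]).
      assert (H3 : (y / 2) ^ j * D j (y / 2) <= K) by (apply HK; lra).
      assert (Hrj := Hr j).
      apply Rmult_le_reg_r with (r j); auto.
      replace (2 ^ S j * K / r j * r j) with (2 ^ S j * K) by (field; lra).
      assert (H4 : r j * D (S j) y * (y / 2) <= D j (y / 2)).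
      { assert (r j * (y / 2) * D (S j) y <= r j * (y / 2) * D (S j) x)
          by (apply Rmult_le_compat_l; [apply Rmult_le_pos|]; lra).
        lra. }
      assert (H5 : 0 < (y / 2) ^ j) by (apply pow_lt; lra).
      replace (y ^ S j * D (S j) y * r j)
        with (2 ^ S j * ((y / 2) ^ j * (r j * D (S j) y * (y / 2)))).
      * apply Rmult_le_compat_l; [apply pow_le; lra|]. nra.
      * unfold Rdiv. rewrite Rpow_mult_distr, pow_inv. cbn [pow]. field.
        apply pow_nonzero; lra.
Qed.

Definition power_decay (a' : R) (f : R -> R) : Prop :=
  exists K, forall y, 1 <= y -> Rpower y a' * f y <= K.

Lemma Rpower_1_base (s : R) : Rpower 1 s = 1.
Proof. unfold Rpower. now rewrite ln_1, Rmult_0_r, exp_0. Qed.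

(** For large [b] and [c] every shifted triple lies in the region of part (i), so the derivative
    argument applies, but with an integer exponent [j] and numerator [a + 1]. The exponent [a']
    results from integrating [(y^a Phi_a)' = a y^(a-1) Phi_(a+1)]. *)
Lemma hyp_power_decay_large (a a' : R) :
  0 < a' < a -> exists B0, 0 < B0 /\ forall b c, B0 <= b -> B0 <= c ->
    power_decay a' (PSeries (hyp a b c)).
Proof.
  intros Ha.
  (* The chain of derivatives starts at numerator [a + 1 - j], which must be positive, while
     [y^(-j)] must decay at least like [y^(-a')]. *)
  assert (Hj : exists j, a' <= INR j < a + 1).
  { destruct (nfloor_ex a') as [n Hn]; [lra|]. exists (S n). rewrite S_INR. lra. }
  destruct Hj as [j Hj].
  exists (2 * a + 5 + INR j). split; [assert (Hjp := pos_INR j); lra|].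
  intros b c Hb Hc. assert (Hjp := pos_INR j).
  destruct (hyp_decay_iterated (a + 1 - INR j) (b - INR j) (c - INR j) j) as [K HK]; try lra.
  { intros i Hi. apply le_INR in Hi. rewrite S_INR in Hi. assert (Hip := pos_INR i).
    apply nonneg_hyp_region; try lra; (eapply Rle_trans; [apply Rmin_r|]); lra. }
  replace (a + 1 - INR j + INR j) with (a + 1) in HK by ring.
  replace (b - INR j + INR j) with b in HK by ring.
  replace (c - INR j + INR j) with c in HK by ring.
  set (f := PSeries (hyp a b c)). set (g := PSeries (hyp (a + 1) b c)) in *.
  assert (HK0 : 0 <= K).
  { eapply Rle_trans; [|apply (HK 1); lra]. rewrite pow1, Rmult_1_l.
    apply nonneg_hyp_region; try lra; (eapply Rle_trans; [apply Rmin_r|]); lra. }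
  (* [M y^(a-a')] is a primitive of [a K y^(a-a'-1)], which bounds [(y^a f)'] on [[1, oo)]. *)
  set (M := a * K / (a - a')).
  assert (HM : 0 <= M).
  { unfold M. apply Rmult_le_pos; [nra|]. left; apply Rinv_0_lt_compat; lra. }
  assert (Hmon : forall y, 1 <= y ->
            Rpower y a * f y - M * Rpower y (a - a') <= Rpower 1 a * f 1 - M * Rpower 1 (a - a')).
  { intros y Hy. apply Ropp_le_cancel.
    apply (nondecreasing_of_derive (fun x => - (Rpower x a * f x - M * Rpower x (a - a')))
      (fun x => - ((a * Rpower x a / x * f x + Rpower x a * dhyp a b c x)
                   - M * ((a - a') * Rpower x (a - a') / x)))); auto.
    - intros x Hx.
      apply (@is_derive_opp R_AbsRing R_NormedModule
               (fun x => Rpower x a * f x - M * Rpower x (a - a'))).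
      apply (@is_derive_minus R_AbsRing R_NormedModule (fun x => Rpower x a * f x)).
      + apply (is_derive_mult (fun x => Rpower x a) f).
        * apply is_derive_Rpower; lra.
        * apply is_derive_hyp; lra.
        * intros; apply Rmult_comm.
      + apply (is_derive_scal (fun x => Rpower x (a - a'))). apply is_derive_Rpower; lra.
    - intros x Hx.
      assert (E := hyp_theta_a a b c x ltac:(lra) ltac:(lra) ltac:(lra)).
      fold (f x) in E. fold (g x) in E.
      assert (Hp := Rpower_pos x a). assert (Hp' := Rpower_pos x (a - a')).
      replace (- (a * Rpower x a / x * f x + Rpower x a * dhyp a b c x
                  - M * ((a - a') * Rpower x (a - a') / x)))
        with (a / x * (K * Rpower x (a - a') - Rpower x a * g x)).
      2:{ transitivity (K * a * Rpower x (a - a') / x - Rpower x a / x * (a * g x));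
            [field; lra|]. rewrite <- E. unfold M. field. lra. }
      apply Rmult_le_pos; [left; apply Rdiv_lt_0_compat; lra|].
      assert (Hxj : Rpower x a <= Rpower x (a - a') * x ^ j).
      { rewrite <- Rpower_pow, <- Rpower_plus by lra. apply Rle_Rpower; lra. }
      assert (Hgx : 0 <= g x).
      { apply nonneg_hyp_region; try lra; (eapply Rle_trans; [apply Rmin_r|]); lra. }
      assert (HKx := HK x ltac:(lra)).
      assert (Rpower x a * g x <= Rpower x (a - a') * x ^ j * g x)
        by (apply Rmult_le_compat_r; auto).
      assert (Rpower x (a - a') * (x ^ j * g x) <= Rpower x (a - a') * K)
        by (apply Rmult_le_compat_l; lra).
      lra. }
  exists (M + Rabs (f 1)). intros y Hy. specialize (Hmon y Hy).
  rewrite !Rpower_1_base in Hmon.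
  assert (Hp' := Rpower_pos y (a - a')).
  assert (E : Rpower y a = Rpower y a' * Rpower y (a - a'))
    by (rewrite <- Rpower_plus; f_equal; ring).
  assert (H1 : 1 <= Rpower y (a - a')).
  { rewrite <- (Rpower_1_base (a - a')). apply Rle_Rpower_l; lra. }
  apply Rmult_le_reg_l with (Rpower y (a - a')); auto.
  replace (Rpower y (a - a') * (Rpower y a' * f y)) with (Rpower y a * f y) by (rewrite E; ring).
  assert (Hf := Rle_abs (f 1)). assert (Hf0 := Rabs_pos (f 1)). nra.
Qed.

(** Decay has to go from raised parameters back to lower ones, against the direction of averaging.
    As [x^p G] is nondecreasing, [G] stays above [l = G Y / 2^p] on [[Y, 2Y]]; its average [G'] (the
    raised function, not a derivative) cannot then be small at [2Y], because [x^q (G' - l)] is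
    nondecreasing there. *)
Lemma doubling_bound (G G' dG dG' : R -> R) (p q Y : R) :
  0 < p -> 0 < q -> 0 < Y ->
  (forall x, is_derive G x (dG x)) -> (forall x, is_derive G' x (dG' x)) ->
  (forall x, 0 < x -> 0 <= x * dG x + p * G x) ->
  (forall x, 0 < x -> x * dG' x + q * G' x = q * G x) ->
  (forall x, 0 < x -> 0 <= G x) -> (forall x, 0 < x -> 0 <= G' x) ->
  G Y * (Rpower 2 q - 1) <= Rpower 2 p * Rpower 2 q * G' (2 * Y).
Proof.
  intros Hp Hq HY HdG HdG' Hth HthG' HG HG'.
  set (l := G Y / Rpower 2 p).
  assert (H2p := Rpower_pos 2 p). assert (H2q := Rpower_pos 2 q).
  assert (Hl : 0 <= l).
  { unfold l. apply Rmult_le_pos; [auto|]. left; now apply Rinv_0_lt_compat. }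
  assert (Hlow : forall x, Y <= x <= 2 * Y -> l <= G x).
  { intros x Hx.
    assert (H : Rpower Y p * G Y <= Rpower x p * G x).
    { apply (Rpower_mult_nondecreasing G dG); [lra | auto |].
      intros z Hz; apply Hth; lra. }
    assert (H1 : Rpower x p <= Rpower Y p * Rpower 2 p).
    { rewrite Rpower_mult_distr by lra. apply Rle_Rpower_l; lra. }
    assert (HYp := Rpower_pos Y p). assert (HGx := HG x ltac:(lra)).
    assert (H2 : Rpower Y p * G Y <= Rpower Y p * (Rpower 2 p * G x)) by nra.
    apply Rmult_le_reg_l in H2; auto.
    unfold l. apply Rmult_le_reg_r with (Rpower 2 p); auto.
    unfold Rdiv. rewrite Rmult_assoc, Rinv_l; lra. }
  assert (H : Rpower Y q * (G' Y - l) <= Rpower (2 * Y) q * (G' (2 * Y) - l)).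
  { apply (Rpower_mult_nondecreasing (fun x => G' x - l) dG'); [lra| |].
    - intros x _. replace (dG' x) with (dG' x - 0) by ring.
      apply (@is_derive_minus R_AbsRing R_NormedModule G' (fun _ => l)); auto.
      apply (@is_derive_const R_AbsRing R_NormedModule).
    - intros x Hx. assert (E := HthG' x ltac:(lra)). assert (H1 := Hlow x Hx). nra. }
  rewrite <- Rpower_mult_distr in H by lra.
  assert (HYq := Rpower_pos Y q).
  replace (Rpower 2 q * Rpower Y q * (G' (2 * Y) - l))
    with (Rpower Y q * (Rpower 2 q * (G' (2 * Y) - l))) in H by ring.
  apply Rmult_le_reg_l in H; auto.
  assert (HG'Y := HG' Y HY).
  assert (E : G Y = l * Rpower 2 p) by (unfold l; field; lra).
  rewrite E.
  replace (l * Rpower 2 p * (Rpower 2 q - 1)) with (Rpower 2 p * (l * (Rpower 2 q - 1))) by ring.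
  rewrite Rmult_assoc. apply Rmult_le_compat_l; lra.
Qed.

Lemma power_decay_of_doubling (a' L M : R) (G G' : R -> R) :
  0 < a' -> 0 < L -> 0 <= M ->
  (forall y, 1 <= y -> 0 <= G' y) -> (forall y, 1 <= y -> G y * L <= M * G' (2 * y)) ->
  power_decay a' G' -> power_decay a' G.
Proof.
  intros Ha' HL HM HG' H [K HK]. exists (M * K / L). intros y Hy.
  apply Rmult_le_reg_r with L; auto.
  replace (M * K / L * L) with (M * K) by (field; lra).
  specialize (HK (2 * y) ltac:(lra)). specialize (H y Hy). specialize (HG' (2 * y) ltac:(lra)).
  assert (H1 := Rpower_pos y a').
  assert (HR : Rpower y a' <= Rpower (2 * y) a') by (apply Rle_Rpower_l; lra).
  assert (HMG : 0 <= M * G' (2 * y)) by now apply Rmult_le_pos.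
  apply Rle_trans with (Rpower y a' * (M * G' (2 * y))).
  - rewrite Rmult_assoc. apply Rmult_le_compat_l; lra.
  - apply Rle_trans with (M * (Rpower (2 * y) a' * G' (2 * y))).
    + replace (M * (Rpower (2 * y) a' * G' (2 * y)))
        with (Rpower (2 * y) a' * (M * G' (2 * y))) by ring.
      now apply Rmult_le_compat_r.
    + now apply Rmult_le_compat_l.
Qed.

Lemma dhyp_sym (a b c y : R) : dhyp a b c y = dhyp a c b y.
Proof. unfold dhyp. rewrite PSeries_hyp_sym, (Rmult_comm b). reflexivity. Qed.

Lemma hyp_theta_c (a b c y : R) :
  0 < a -> 0 < b -> 0 < c ->
  y * dhyp a b (c + 1) y + c * PSeries (hyp a b (c + 1)) y = c * PSeries (hyp a b c) y.
Proof.
  intros Ha Hb Hc. rewrite dhyp_sym, !(PSeries_hyp_sym a b). now apply hyp_theta_b.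
Qed.

Lemma Rpower_2_gt_1 (q : R) : 0 < q -> 1 < Rpower 2 q.
Proof. intros Hq. rewrite <- (Rpower_O 2) by lra. apply Rpower_lt; lra. Qed.

(** Nonnegativity at [b] gives [(th + b) Phi_(b+1) = b Phi_b >= 0], the monotonicity that doubling
    needs; hence the decay is obtained at [b + 1] and not at [b]. *)
Lemma power_decay_lower_b (a a' b c : R) :
  0 < a' -> 0 < a -> 0 < b -> 0 < c -> nonneg_hyp a b c ->
  power_decay a' (PSeries (hyp a (b + 1 + 1) c)) -> power_decay a' (PSeries (hyp a (b + 1) c)).
Proof.
  intros Ha' Ha Hb Hc Hn.
  assert (H2 := Rpower_2_gt_1 (b + 1) ltac:(lra)).
  assert (Hn1 : nonneg_hyp a (b + 1) c) by (apply nonneg_hyp_raise with b c; auto; lra).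
  assert (Hn2 : nonneg_hyp a (b + 1 + 1) c) by (apply nonneg_hyp_raise with b c; auto; lra).
  apply power_decay_of_doubling with (Rpower 2 (b + 1) - 1) (Rpower 2 b * Rpower 2 (b + 1));
    auto; try lra.
  - apply Rmult_le_pos; left; apply Rpower_pos.
  - intros y Hy; apply Hn2; lra.
  - intros y Hy.
    apply (doubling_bound _ _ (dhyp a (b + 1) c) (dhyp a (b + 1 + 1) c)); auto; try lra.
    + intros x. apply is_derive_hyp; lra.
    + intros x. apply is_derive_hyp; lra.
    + intros x Hx. rewrite hyp_theta_b by lra. apply Rmult_le_pos; [lra | auto].
    + intros x Hx. apply hyp_theta_b; lra.
Qed.

Lemma power_decay_lower_c (a a' b c : R) :
  0 < a' -> 0 < a -> 0 < b -> 0 < c -> nonneg_hyp a b c ->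
  power_decay a' (PSeries (hyp a (b + 1) (c + 1))) -> power_decay a' (PSeries (hyp a (b + 1) c)).
Proof.
  intros Ha' Ha Hb Hc Hn.
  assert (H2 := Rpower_2_gt_1 c ltac:(lra)).
  assert (Hn1 : nonneg_hyp a (b + 1) c) by (apply nonneg_hyp_raise with b c; auto; lra).
  assert (Hn2 : nonneg_hyp a (b + 1) (c + 1)) by (apply nonneg_hyp_raise with b c; auto; lra).
  apply power_decay_of_doubling with (Rpower 2 c - 1) (Rpower 2 b * Rpower 2 c);
    auto; try lra.
  - apply Rmult_le_pos; left; apply Rpower_pos.
  - intros y Hy; apply Hn2; lra.
  - intros y Hy.
    apply (doubling_bound _ _ (dhyp a (b + 1) c) (dhyp a (b + 1) (c + 1))); auto; try lra.
    + intros x. apply is_derive_hyp; lra.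
    + intros x. apply is_derive_hyp; lra.
    + intros x Hx. rewrite hyp_theta_b by lra. apply Rmult_le_pos; [lra | auto].
    + intros x Hx. apply hyp_theta_c; lra.
Qed.

(** Both parameters are first pushed beyond [B0], where decay is known, and brought back by unit
    steps, in [b] and then in [c]. For [y < 1] the absolute series at 1 is bound enough. *)
Lemma hyp_power_decay (a a' b c : R) :
  0 < a' < a -> 0 < b -> 0 < c -> nonneg_hyp a b c ->
  exists K, forall y, 0 < y -> Rpower y a' * PSeries (hyp a (b + 1) c) y <= K.
Proof.
  intros Ha Hb Hc Hn.
  assert (Hdec : power_decay a' (PSeries (hyp a (b + 1) c))).
  { destruct (hyp_power_decay_large a a' Ha) as (B0 & HB0 & HB).
    destruct (INR_unbounded B0) as [N HN].
    assert (Hcc : forall m c', 0 < c' -> nonneg_hyp a b c' ->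
      power_decay a' (PSeries (hyp a (b + 1) (c' + INR m))) ->
      power_decay a' (PSeries (hyp a (b + 1) c'))).
    { induction m as [|m IH]; intros c' Hc' Hn' H; [now rewrite Rplus_0_r in H|].
      apply power_decay_lower_c; auto; try lra. apply IH; [lra| |].
      - apply nonneg_hyp_raise with b c'; auto; lra.
      - rewrite S_INR in H. now replace (c' + 1 + INR m) with (c' + (INR m + 1)) by ring. }
    assert (Hbb : forall m b', 0 < b' -> nonneg_hyp a b' (c + INR N) ->
      power_decay a' (PSeries (hyp a (b' + 1 + INR m) (c + INR N))) ->
      power_decay a' (PSeries (hyp a (b' + 1) (c + INR N)))).
    { induction m as [|m IH]; intros b' Hb' Hn' H; [now rewrite Rplus_0_r in H|].
      apply power_decay_lower_b; auto; try lra. apply IH; [lra| |].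
      - apply nonneg_hyp_raise with b' (c + INR N); auto; lra.
      - rewrite S_INR in H.
        now replace (b' + 1 + 1 + INR m) with (b' + 1 + (INR m + 1)) by ring. }
    apply (Hcc N); auto. apply (Hbb N); auto.
    - apply nonneg_hyp_raise with b c; auto; lra.
    - apply HB; lra. }
  destruct Hdec as [K HK].
  assert (He := entire_seq_hyp a (b + 1) c ltac:(lra) ltac:(lra) Hc).
  set (S1 := Series (fun k => Rabs (hyp a (b + 1) c k * 1 ^ k))).
  exists (Rmax K S1). intros y Hy.
  destruct (Rle_or_lt 1 y) as [H1|H1].
  - eapply Rle_trans; [now apply HK | apply Rmax_l].
  - eapply Rle_trans; [|apply Rmax_r].
    assert (Hp : 0 < Rpower y a' <= 1).
    { split; [apply Rpower_pos|]. rewrite <- (Rpower_1_base a'). apply Rle_Rpower_l; lra. }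
    assert (HF : 0 <= PSeries (hyp a (b + 1) c) y)
      by (apply nonneg_hyp_raise with b c; auto; lra).
    apply Rle_trans with (PSeries (hyp a (b + 1) c) y); [nra|].
    unfold S1, PSeries. eapply Rle_trans; [apply Rle_abs|].
    eapply Rle_trans; [apply Series_Rabs, entire_seq_ex_abs, He|].
    apply Series_le; [|apply entire_seq_ex_abs, He].
    intros k. split; [apply Rabs_pos|]. rewrite !Rabs_mult.
    apply Rmult_le_compat_l; [apply Rabs_pos|].
    rewrite <- !RPow_abs. apply pow_incr. split; [apply Rabs_pos|].
    rewrite !Rabs_pos_eq; lra.
Qed.

Lemma P_a_bounds (a b c : R) :
  P_a a (b, c) ->
  Rmin (a + 1 / 2) (2 * a) <= b /\ Rmin (a + 1 / 2) (2 * a) <= c /\ 3 * a + 1 / 2 <= b + c.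
Proof.
  intros H.
  apply (H (fun p => Rmin (a + 1 / 2) (2 * a) <= fst p /\ Rmin (a + 1 / 2) (2 * a) <= snd p /\
                     3 * a + 1 / 2 <= fst p + snd p)).
  - intros p q t Ht Hp Hq. simpl. repeat split; nra.
  - assert (H1 := Rmin_l (a + 1 / 2) (2 * a)). assert (H2 := Rmin_r (a + 1 / 2) (2 * a)).
    intros q (al & be & [HL|HL] & Hq1 & Hq2); injection HL as -> ->; repeat split; lra.
Qed.

Lemma convex_comb_segment (m M x : R) :
  m <= x <= M -> exists t, 0 <= t <= 1 /\ x = t * m + (1 - t) * M.
Proof.
  intros Hx. destruct (Req_dec m M) as [->|Hne].
  - exists 0. split; lra.
  - exists ((M - x) / (M - m)). split.
    + split; [apply Rmult_le_pos; [lra|left; apply Rinv_0_lt_compat; lra]|].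
      apply Rmult_le_reg_r with (M - m); [lra|]. unfold Rdiv. rewrite Rmult_assoc, Rinv_l; lra.
    + field. lra.
Qed.

(** The point exceeds the segment point of abscissa [Rmin b M] by a vector [(db, dc)] with
    nonnegative entries. Translating both vertices by it stays in their quadrants, and [(b, c)] is a
    convex combination of the translates. *)
Lemma P_a_of_bounds (a b c : R) :
  Rmin (a + 1 / 2) (2 * a) <= b -> Rmin (a + 1 / 2) (2 * a) <= c -> 3 * a + 1 / 2 <= b + c ->
  P_a a (b, c).
Proof.
  intros Hb Hc Hbc C Hconv HC.
  set (m := Rmin (a + 1 / 2) (2 * a)) in *. set (M := 3 * a + 1 / 2 - m).
  assert (HmM : m <= M /\ Lambda a (m, M) /\ Lambda a (M, m)).
  { unfold M, m, Rmin. destruct (Rle_dec (a + 1 / 2) (2 * a)); (split; [lra|]).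
    - split; [left | right]; f_equal; lra.
    - split; [right | left]; f_equal; lra. }
  destruct HmM as (HmM & HL1 & HL2).
  destruct (convex_comb_segment m M (Rmin b M)) as (t & Ht & E).
  { split; [apply Rmin_glb; lra | apply Rmin_r]. }
  set (db := b - Rmin b M). set (dc := c - (m + M - Rmin b M)).
  assert (Hd : 0 <= db /\ 0 <= dc).
  { unfold db, dc, Rmin, M in *. destruct (Rle_dec b (3 * a + 1 / 2 - m)); lra. }
  replace (b, c) with (t * fst (m + db, M + dc) + (1 - t) * fst (M + db, m + dc),
                       t * snd (m + db, M + dc) + (1 - t) * snd (M + db, m + dc)).
  - apply Hconv; auto; apply HC; [exists m, M | exists M, m]; simpl; repeat split; auto; lra.
  - simpl. f_equal.
    + unfold db. lra.
    + unfold dc. lra.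
Qed.

(** If both coordinates exceed [a] and the point is on or above the line, it is either in [P_a] or
    has a coordinate under [Rmin (a + 1/2) (2a)], and then one of the pieces of [O_a] contains
    it. *)
Lemma N_a_cases (a b c : R) :
  0 < a -> N_a a (b, c) -> b <= a \/ c <= a \/ b + c < 3 * a + 1 / 2.
Proof.
  intros Ha (Hb & Hc & HP & HO). simpl in Hb, Hc.
  destruct (Rle_or_lt b a) as [|Hba]; [now left|].
  destruct (Rle_or_lt c a) as [|Hca]; [now right; left|].
  destruct (Rlt_or_le (b + c) (3 * a + 1 / 2)) as [|Hbc]; [now right; right|].
  exfalso. unfold O_a in HO. simpl in HO.
  destruct (Rlt_or_le b (Rmin (a + 1 / 2) (2 * a))) as [Hbm|Hbm].
  - apply HO. split; [auto|split; [auto|]].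
    destruct (Rle_dec (1 / 2) a); [rewrite Rmin_left in Hbm by lra | rewrite Rmin_right in Hbm by lra];
      left; lra.
  - destruct (Rlt_or_le c (Rmin (a + 1 / 2) (2 * a))) as [Hcm|Hcm].
    + apply HO. split; [auto|split; [auto|]].
      destruct (Rle_dec (1 / 2) a);
        [rewrite Rmin_left in Hcm by lra | rewrite Rmin_right in Hcm by lra]; right;
        destruct (Rlt_or_le b (2 * a + 1 / 2)); [left|right|left|right]; lra.
    + apply HP. now apply P_a_of_bounds.
Qed.

(** * Moments and damped trigonometric integrals *)

Lemma continuous_PSeries_comp (al : nat -> R) (g : R -> R) (x : R) :
  entire_seq al -> continuous g x -> continuous (fun t => PSeries al (g t)) x.
Proof.
  intros He Hg. apply (continuous_comp g (PSeries al)); auto.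
  apply continuity_pt_filterlim, PSeries_entire_continuous, He.
Qed.

Lemma ex_RInt_of_continuous (f : R -> R) (s t : R) :
  (forall x, continuous f x) -> ex_RInt f s t.
Proof. intros H. apply (@ex_RInt_continuous R_CompleteNormedModule). auto. Qed.

Lemma RInt_abs_le_const (f : R -> R) (X W : R) :
  0 <= X -> (forall x, continuous f x) -> (forall x, 0 <= x <= X -> Rabs (f x) <= W) ->
  Rabs (RInt f 0 X) <= X * W.
Proof.
  intros HX Hc Hb.
  assert (H := @norm_RInt_le_const R_NormedModule f 0 X (RInt f 0 X) W HX Hb).
  rewrite Rminus_0_r in H. apply H.
  apply (@RInt_correct R_CompleteNormedModule). now apply ex_RInt_of_continuous.
Qed.

Definition moment (w : R -> R) (X : R) (k : nat) : R := RInt (fun x => (x ^ 2 / 4) ^ k * w x) 0 X.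

Lemma continuous_quarter_sq (y x : R) : continuous (fun t => t ^ 2 / 4 * y) x.
Proof.
  apply (@ex_derive_continuous R_AbsRing R_NormedModule). auto_derive. exact I.
Qed.

Lemma continuous_moment (w : R -> R) (k : nat) (x : R) :
  (forall x, continuous w x) -> continuous (fun x => (x ^ 2 / 4) ^ k * w x) x.
Proof.
  intros Hw. apply (@continuous_mult R_UniformSpace R_AbsRing); auto.
  apply (@ex_derive_continuous R_AbsRing R_NormedModule). auto_derive. exact I.
Qed.

Lemma moment_bound (w : R -> R) (X W : R) (k : nat) :
  0 <= X -> 0 <= W -> (forall x, continuous w x) -> (forall x, 0 <= x <= X -> Rabs (w x) <= W) ->
  Rabs (moment w X k) <= X * W * (X ^ 2 / 4) ^ k.
Proof.
  intros HX HW Hc Hb. rewrite Rmult_assoc. apply RInt_abs_le_const; auto.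
  - intros; now apply continuous_moment.
  - intros x Hx. rewrite Rabs_mult, (Rmult_comm W), Rabs_pos_eq by (apply pow_le; nra).
    apply Rmult_le_compat; auto using Rabs_pos; [apply pow_le; nra|].
    apply pow_incr. nra.
Qed.

Lemma entire_seq_moment (al : nat -> R) (w : R -> R) (X W : R) :
  0 <= X -> 0 <= W -> (forall x, continuous w x) -> (forall x, 0 <= x <= X -> Rabs (w x) <= W) ->
  entire_seq al -> entire_seq (fun k => al k * moment w X k).
Proof.
  intros HX HW Hc Hb (M & D & HM & HD & H).
  exists (M * (X * W)), (D * (X ^ 2 / 4)).
  split; [|split]; [repeat apply Rmult_le_pos; auto | apply Rmult_le_pos; nra |].
  intros k. rewrite Rabs_mult, Rpow_mult_distr.
  replace (M * (X * W) * (D ^ k * (X ^ 2 / 4) ^ k) / INR (Factorial.fact k))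
    with (M * D ^ k / INR (Factorial.fact k) * (X * W * (X ^ 2 / 4) ^ k))
    by (field; apply INR_fact_neq_0).
  apply Rmult_le_compat; auto using Rabs_pos. now apply moment_bound.
Qed.

Lemma RInt_sum_f_R0 (u : nat -> R -> R) (X : R) (N : nat) :
  (forall k x, continuous (u k) x) ->
  (forall x, continuous (fun x => sum_f_R0 (fun k => u k x) N) x) /\
  RInt (fun x => sum_f_R0 (fun k => u k x) N) 0 X = sum_f_R0 (fun k => RInt (u k) 0 X) N.
Proof.
  intros Hu. induction N as [|N [IH1 IH2]]; simpl; [split; auto|].
  split.
  - intros x. now apply (@continuous_plus R_UniformSpace R_AbsRing R_NormedModule).
  - rewrite <- IH2. apply (@RInt_plus R_CompleteNormedModule);
      now apply ex_RInt_of_continuous.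
Qed.

(** As a function of the dilation [y], a test integral is a power series whose coefficients contain
    [al k] as a factor. A raising multiplier on [al] therefore acts on this function of [y], to
    which the positivity lemmas apply. *)
Lemma RInt_PSeries_mult (al : nat -> R) (w : R -> R) (X y : R) :
  0 <= X -> 0 <= y -> (forall x, continuous w x) -> entire_seq al ->
  RInt (fun x => PSeries al (x ^ 2 / 4 * y) * w x) 0 X =
  PSeries (fun k => al k * moment w X k) y.
Proof.
  intros HX Hy Hc He.
  assert (HW : exists W, 0 <= W /\ forall x, 0 <= x <= X -> Rabs (w x) <= W).
  { destruct (continuity_ab_maj (fun x => Rabs (w x)) 0 X HX) as (m & Hm & _).
    - intros x _. apply continuity_pt_filterlim.
      apply (continuous_comp w Rabs); auto. apply continuous_Rabs.
    - exists (Rabs (w m)). split; [apply Rabs_pos | auto]. }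
  destruct HW as (W & HW & Hb).
  set (F := fun x => PSeries al (x ^ 2 / 4 * y) * w x).
  set (u := fun k x => al k * (x ^ 2 / 4 * y) ^ k * w x).
  assert (Hu : forall k x, continuous (u k) x).
  { intros k x. apply (@continuous_mult R_UniformSpace R_AbsRing); auto.
    apply (@ex_derive_continuous R_AbsRing R_NormedModule). auto_derive. exact I. }
  assert (HF : forall x, continuous F x).
  { intros x. apply (@continuous_mult R_UniformSpace R_AbsRing); auto.
    apply continuous_PSeries_comp; auto. apply continuous_quarter_sq. }
  symmetry. apply is_series_unique.
  set (v := fun k => Rabs (al k * (X ^ 2 / 4 * y) ^ k)).
  assert (Hv : ex_series v) by now apply entire_seq_ex_abs.
  assert (Hmu : forall k, RInt (u k) 0 X = al k * moment w X k * y ^ k).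
  { intros k. unfold moment.
    replace (al k * RInt (fun x => (x ^ 2 / 4) ^ k * w x) 0 X * y ^ k)
      with ((al k * y ^ k) * RInt (fun x => (x ^ 2 / 4) ^ k * w x) 0 X) by ring.
    rewrite <- (@RInt_scal R_CompleteNormedModule).
    - apply RInt_ext. intros x _. unfold u, scal; simpl; unfold mult; simpl.
      rewrite Rpow_mult_distr. ring.
    - apply ex_RInt_of_continuous. intros; now apply continuous_moment. }
  change (is_lim_seq (sum_n (fun k => al k * moment w X k * y ^ k)) (RInt F 0 X)).
  apply (is_lim_seq_ext (fun N => RInt F 0 X - RInt (fun x => F x - sum_f_R0 (fun k => u k x) N) 0 X)).
  { intros N. destruct (RInt_sum_f_R0 u X N Hu) as [H1 H2].
    rewrite (@RInt_minus R_CompleteNormedModule F (fun x => sum_f_R0 (fun k => u k x) N));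
      try now apply ex_RInt_of_continuous.
    unfold minus, plus, opp; simpl. rewrite H2, sum_n_Reals.
    rewrite (sum_eq (fun k => RInt (u k) 0 X) (fun k => al k * moment w X k * y ^ k))
      by (intros; apply Hmu). ring. }
  replace (Finite (RInt F 0 X)) with (Finite (RInt F 0 X - 0)) by (f_equal; ring).
  apply is_lim_seq_minus'; [apply is_lim_seq_const|].
  apply is_lim_seq_abs_0.
  apply (is_lim_seq_le_le (fun _ => 0) _ (fun N => X * W * Series (fun k => v (S N + k)%nat))).
  - intros N. split; [apply Rabs_pos|].
    rewrite Rmult_assoc. apply RInt_abs_le_const; auto.
    + intros x. apply (@continuous_minus R_UniformSpace R_AbsRing R_NormedModule); auto.
      now apply RInt_sum_f_R0.
    + intros x Hx. unfold F, u.
      replace (PSeries al (x ^ 2 / 4 * y) * w x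
               - sum_f_R0 (fun k => al k * (x ^ 2 / 4 * y) ^ k * w x) N)
        with (w x * (Series (fun k => al k * (x ^ 2 / 4 * y) ^ k)
                     - sum_f_R0 (fun k => al k * (x ^ 2 / 4 * y) ^ k) N)).
      * rewrite Rabs_mult. apply Rmult_le_compat; auto using Rabs_pos.
        apply Series_sum_bound; auto. intros k. unfold v. rewrite !Rabs_mult.
        apply Rmult_le_compat_l; [apply Rabs_pos|].
        rewrite <- !RPow_abs. apply pow_incr. split; [apply Rabs_pos|].
        rewrite !Rabs_pos_eq by (apply Rmult_le_pos; nra).
        apply Rmult_le_compat_r; auto. nra.
      * rewrite Rmult_minus_distr_l, scal_sum. unfold PSeries. rewrite Rmult_comm. f_equal.
  - apply is_lim_seq_const.
  - replace (Finite 0) with (Rbar_mult (X * W) 0) by (simpl; f_equal; ring).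
    now apply is_lim_seq_scal_l, Series_tail_lim.
Qed.

Lemma poch_1 (k : nat) : poch 1 k = INR (Factorial.fact k).
Proof.
  induction k as [|k IH]; [reflexivity|].
  rewrite INR_fact_S. cbn [poch]. rewrite IH. ring.
Qed.

Lemma PSeries_hyp_cos (x : R) : PSeries (hyp 1 1 (1 / 2)) (x ^ 2 / 4) = cos x.
Proof.
  unfold cos. destruct (exist_cos (Rsqr x)) as [l Hl].
  apply is_series_unique, is_series_Reals.
  unfold cos_in in Hl. intros eps Heps. destruct (Hl eps Heps) as [N HN]. exists N.
  intros n Hn. rewrite (sum_eq _ (fun i => cos_n i * Rsqr x ^ i)); [now apply HN|].
  intros i _. unfold cos_n, hyp.
  assert (E := poch_double (1 / 2) i).
  replace (2 * (1 / 2)) with 1 in E by field. replace (1 / 2 + 1 / 2) with 1 in E by field.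
  rewrite poch_1 in E. rewrite E, !poch_1.
  assert (H1 := poch_pos (1 / 2) i ltac:(lra)). assert (H2 := INR_fact_lt_0 i).
  assert (H4 : 0 < 4 ^ i) by (apply pow_lt; lra).
  replace ((x ^ 2 / 4) ^ i) with ((x ^ 2) ^ i / 4 ^ i)
    by (unfold Rdiv; now rewrite Rpow_mult_distr, pow_inv).
  replace (Rsqr x) with (x ^ 2) by (unfold Rsqr; ring).
  field. lra.
Qed.

Definition base_fun (c x : R) : R := cos x - x / (2 * c) * sin x.

(** Since [(c+1)_k/(c)_k = (c+k)/c], the series is [(th + c)/c] applied to [cos x], where
    [th = (x/2) d/dx]. *)
Lemma PSeries_hyp_base (c x : R) :
  0 < c -> PSeries (hyp (c + 1) (1 / 2) c) (x ^ 2 / 4) = base_fun c x.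
Proof.
  intros Hc. set (y := x ^ 2 / 4).
  assert (E1 : PSeries (hyp (c + 1) (1 / 2) c) y
               = / c * (y * dhyp 1 1 (1 / 2) y + c * PSeries (hyp 1 1 (1 / 2)) y)).
  { rewrite hyp_theta_linear by lra. unfold PSeries. rewrite <- Series_scal_l.
    apply Series_ext. intros k. unfold hyp.
    assert (E := poch_shift c k).
    assert (H1 := poch_pos (1 / 2) k ltac:(lra)). assert (H2 := INR_fact_lt_0 k).
    assert (H3 := poch_pos 1 k ltac:(lra)). assert (H4 := poch_pos c k ltac:(lra)).
    replace (poch (c + 1) k) with (poch c k * (c + INR k) / c) by (rewrite <- E; field; lra).
    field. lra. }
  assert (E2 : x * (x / 2 * dhyp 1 1 (1 / 2) y) = - x * sin x).
  { replace (- x * sin x) with (x * - sin x) by ring. f_equal.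
    assert (Hd1 : is_derive cos x (x / 2 * dhyp 1 1 (1 / 2) y)).
    { apply (is_derive_ext (fun t => PSeries (hyp 1 1 (1 / 2)) (t ^ 2 / 4)));
        [intros; apply PSeries_hyp_cos|].
      apply (is_derive_comp (PSeries (hyp 1 1 (1 / 2))) (fun t => t ^ 2 / 4)).
      - apply is_derive_hyp; lra.
      - auto_derive; auto. field. }
    apply is_derive_unique in Hd1.
    assert (Hd2 := is_derive_unique _ _ _ (is_derive_cos x)). congruence. }
  rewrite E1. unfold base_fun, y at 3. rewrite PSeries_hyp_cos.
  replace (y * dhyp 1 1 (1 / 2) y) with (/ 2 * (x * (x / 2 * dhyp 1 1 (1 / 2) y)))
    by (unfold y; field).
  rewrite E2. field. lra.
Qed.

(** The real part of [e^(i psi) e^(-(s - i th) x)]. Writing [s - i th = rho e^(-i phi)] turns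
    differentiation into a factor [- rho] and a phase shift by [- phi], so complex exponentials are
    avoided. *)
Definition damped (s th psi x : R) : R := exp (- s * x) * cos (th * x + psi).

Lemma is_derive_damped (rho phi psi x : R) :
  is_derive (damped (rho * cos phi) (rho * sin phi) psi) x
            (- rho * damped (rho * cos phi) (rho * sin phi) (psi - phi) x).
Proof.
  unfold damped. auto_derive; auto.
  replace (rho * sin phi * x + (psi - phi)) with ((rho * sin phi * x + psi) - phi) by ring.
  rewrite cos_minus. ring.
Qed.

(** Repeated integration by parts: each integration divides by [rho] and adds [phi] to the phase. *)
Fixpoint damped_prim (rho phi : R) (m : nat) (psi x : R) : R :=
  - x ^ m / rho * damped (rho * cos phi) (rho * sin phi) (psi + phi) x +
  match m with
  | O => 0
  | S m' => INR m / rho * damped_prim rho phi m' (psi + phi) x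
  end.

Lemma is_derive_damped_prim (rho phi : R) (m : nat) (psi x : R) :
  0 < rho ->
  is_derive (damped_prim rho phi m psi) x
            (x ^ m * damped (rho * cos phi) (rho * sin phi) psi x).
Proof.
  intros Hr. revert psi. induction m as [|m IH]; intros psi.
  - apply (is_derive_ext (fun t => - / rho * damped (rho * cos phi) (rho * sin phi) (psi + phi) t)).
    { intros t. simpl. field. lra. }
    replace (x ^ 0 * damped (rho * cos phi) (rho * sin phi) psi x)
      with (- / rho * (- rho * damped (rho * cos phi) (rho * sin phi) (psi + phi - phi) x)).
    + apply (is_derive_scal (damped (rho * cos phi) (rho * sin phi) (psi + phi))).
      apply is_derive_damped.
    + replace (psi + phi - phi) with psi by ring. simpl. field. lra.
  - set (g := damped (rho * cos phi) (rho * sin phi)) in *.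
    apply (is_derive_ext (fun t => (- t ^ S m / rho) * g (psi + phi) t
                                   + INR (S m) / rho * damped_prim rho phi m (psi + phi) t)).
    { intros t. reflexivity. }
    replace (x ^ S m * g psi x)
      with ((- (INR (S m) * x ^ m) / rho * g (psi + phi) x
             + (- x ^ S m / rho) * (- rho * g (psi + phi - phi) x))
            + INR (S m) / rho * (x ^ m * g (psi + phi) x)).
    + apply (@is_derive_plus R_AbsRing R_NormedModule).
      * apply (is_derive_mult (fun t => - t ^ S m / rho) (g (psi + phi))).
        -- auto_derive; auto. change (match m with O => 1 | S _ => INR m + 1 end) with (INR (S m)). field. lra.
        -- apply is_derive_damped.
        -- intros; apply Rmult_comm.
      * apply (is_derive_scal (damped_prim rho phi m (psi + phi))). apply IH.
    + replace (psi + phi - phi) with psi by ring. cbn [pow]. field. lra.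
Qed.

Lemma damped_prim_0 (rho phi : R) (m : nat) (psi : R) :
  0 < rho ->
  damped_prim rho phi m psi 0 =
  - (INR (Factorial.fact m) / rho ^ S m * cos (psi + INR (S m) * phi)).
Proof.
  intros Hr. revert psi. induction m as [|m IH]; intros psi.
  - simpl. unfold damped. rewrite !Rmult_0_r, exp_0.
    replace (0 + (psi + phi)) with (psi + 1 * phi) by ring. field. lra.
  - cbn [damped_prim]. rewrite IH, INR_fact_S, (S_INR (S m)).
    rewrite pow_i by lia. rewrite <- S_INR.
    replace (psi + phi + INR (S m) * phi) with (psi + (INR (S m) + 1) * phi) by ring.
    cbn [pow]. field. split; [apply pow_nonzero|]; lra.
Qed.

(** For [s > 0], the closed form of the integral of [t^m e^(-s t)] over [[x, oo)]. It measures the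
    error of stopping at a finite [X], so that no improper integral occurs. *)
Fixpoint damped_tail (s : R) (m : nat) (x : R) : R :=
  x ^ m / s * exp (- s * x) +
  match m with
  | O => 0
  | S m' => INR m / s * damped_tail s m' x
  end.

Lemma damped_prim_bound (rho phi s : R) (m : nat) (psi x : R) :
  0 < s -> s <= rho -> s = rho * cos phi -> 0 <= x ->
  Rabs (damped_prim rho phi m psi x) <= damped_tail s m x.
Proof.
  intros Hs Hsr Es Hx.
  assert (Hinv : 0 < / rho <= / s)
    by (split; [apply Rinv_0_lt_compat; lra | apply Rinv_le_contravar; auto]).
  assert (Hg : forall m' psi', Rabs (- x ^ m' / rho * damped (rho * cos phi) (rho * sin phi) psi' x)
                               <= x ^ m' / s * exp (- s * x)).
  { intros m' psi'. unfold damped. rewrite <- Es.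
    assert (Hxm : 0 <= x ^ m') by now apply pow_le.
    assert (He := exp_pos (- s * x)).
    unfold Rdiv. rewrite !Rabs_mult, Rabs_Ropp, (Rabs_pos_eq (x ^ m')), (Rabs_pos_eq (/ rho)),
      (Rabs_pos_eq (exp _)) by lra.
    assert (Hc : Rabs (cos (rho * sin phi * x + psi')) <= 1) by (apply Rabs_le, COS_bound).
    apply Rmult_le_compat; try apply Rmult_le_pos; auto using Rabs_pos; try lra.
    - apply Rmult_le_compat_l; lra.
    - nra. }
  revert psi. induction m as [|m IH]; intros psi.
  - specialize (Hg O (psi + phi)). simpl in *. rewrite !Rplus_0_r. exact Hg.
  - cbn [damped_prim damped_tail].
    eapply Rle_trans; [apply Rabs_triang|]. apply Rplus_le_compat; [apply Hg|].
    assert (Hm := pos_INR (S m)).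
    unfold Rdiv. rewrite !Rabs_mult, (Rabs_pos_eq (INR (S m))), (Rabs_pos_eq (/ rho)) by lra.
    apply Rmult_le_compat; auto using Rabs_pos.
    + apply Rmult_le_pos; lra.
    + apply Rmult_le_compat_l; lra.
Qed.

Lemma damped_tail_exp (s : R) (m : nat) :
  0 < s -> exists C, 0 <= C /\ forall x, 0 < x -> damped_tail s m x <= C * exp (- (s / 2) * x).
Proof.
  intros Hs.
  assert (Hpow : forall m', exists C, 0 <= C /\ forall x, 0 < x ->
            x ^ m' / s * exp (- s * x) <= C * exp (- (s / 2) * x)).
  { intros m'.
    assert (HC : exists C, 0 < C /\ forall x, 0 < x -> x ^ m' <= C * exp (s / 2 * x)).
    { destruct m' as [|m'].
      - exists 1. split; [lra|]. intros x Hx. simpl. rewrite Rmult_1_l.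
        eapply Rle_trans; [|apply exp_ineq1_le]. nra.
      - destruct (Rpower_le_exp (INR (S m')) (s / 2)) as (C & HC & H);
          [apply lt_0_INR; lia | lra|].
        exists C. split; auto. intros x Hx. rewrite <- Rpower_pow by auto. auto. }
    destruct HC as (C & HC & H). exists (C / s).
    split; [left; now apply Rdiv_lt_0_compat|]. intros x Hx.
    replace (exp (- (s / 2) * x)) with (exp (s / 2 * x) * exp (- s * x))
      by (rewrite <- exp_plus; f_equal; field).
    unfold Rdiv. replace (C * / s * (exp (s * / 2 * x) * exp (- s * x)))
      with (C * exp (s / 2 * x) * (/ s * exp (- s * x))) by (unfold Rdiv; ring).
    rewrite Rmult_assoc. apply Rmult_le_compat_r; [|now apply H].
    apply Rmult_le_pos; [left; now apply Rinv_0_lt_compat | left; apply exp_pos]. }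
  induction m as [|m (C & HC & IH)].
  - destruct (Hpow O) as (C & HC & H). exists C. split; auto.
    intros x Hx. cbn [damped_tail]. rewrite Rplus_0_r. auto.
  - destruct (Hpow (S m)) as (C' & HC' & H). exists (C' + INR (S m) / s * C).
    assert (Hm := pos_INR (S m)).
    assert (Hms : 0 <= INR (S m) / s)
      by (apply Rmult_le_pos; [auto | left; now apply Rinv_0_lt_compat]).
    split; [apply Rplus_le_le_0_compat; auto; now apply Rmult_le_pos|].
    intros x Hx. cbn [damped_tail]. rewrite Rmult_plus_distr_r.
    apply Rplus_le_compat; auto. rewrite Rmult_assoc. now apply Rmult_le_compat_l, IH.
Qed.

Lemma damped_integral (rho phi s th : R) (m : nat) (psi X : R) :
  0 < s -> s <= rho -> s = rho * cos phi -> th = rho * sin phi -> 0 <= X ->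
  Rabs (RInt (fun x => x ^ m * damped s th psi x) 0 X
        - INR (Factorial.fact m) / rho ^ S m * cos (psi + INR (S m) * phi)) <= damped_tail s m X.
Proof.
  intros Hs Hsr Es Eth HX.
  assert (E : RInt (fun x => x ^ m * damped s th psi x) 0 X
              = damped_prim rho phi m psi X - damped_prim rho phi m psi 0).
  { apply is_RInt_unique.
    apply (is_RInt_derive (damped_prim rho phi m psi)).
    - intros x _. assert (H := is_derive_damped_prim rho phi m psi x ltac:(lra)).
      now rewrite <- Es, <- Eth in H.
    - intros x _. apply (@ex_derive_continuous R_AbsRing R_NormedModule).
      unfold damped. auto_derive. exact I. }
  rewrite E, damped_prim_0 by lra.
  match goal with |- Rabs ?e <= _ => replace e with (damped_prim rho phi m psi X) by ring end.
  now apply damped_prim_bound.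
Qed.

(** * Lower bounds for the test integrals *)

Lemma atan_le_id (x : R) : 0 <= x -> atan x <= x.
Proof.
  intros Hx.
  assert (H : 0 - atan 0 <= x - atan x).
  { apply (nondecreasing_of_derive (fun t => t - atan t) (fun t => 1 - / (1 + t ^ 2))); auto.
    - intros t _. auto_derive; auto. field. nra.
    - intros t _. assert (H : / (1 + t ^ 2) <= / 1) by (apply Rinv_le_contravar; nra).
      rewrite Rinv_1 in H. lra. }
  rewrite atan_0 in H. lra.
Qed.

Lemma polar_complement (s th : R) :
  0 < s -> 0 < th ->
  exists rho om, 0 <= om <= s / th /\ s <= rho /\ th <= rho /\ rho <= s + th /\
    s = rho * cos (PI / 2 - om) /\ th = rho * sin (PI / 2 - om).
Proof.
  intros Hs Hth. set (om := atan (s / th)).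
  assert (Hst : 0 < s / th) by now apply Rdiv_lt_0_compat.
  assert (Hb := atan_bound (s / th)). fold om in Hb.
  assert (Hcos : 0 < cos om) by (apply cos_gt_0; lra).
  assert (Htan : tan om = s / th) by apply tan_atan.
  assert (Hom : 0 <= om <= s / th).
  { split; [|apply atan_le_id; lra]. unfold om. rewrite <- atan_0.
    left; now apply atan_increasing. }
  set (rho := th / cos om).
  assert (Hrho : 0 < rho) by now apply Rdiv_lt_0_compat.
  assert (E2 : th = rho * cos om) by (unfold rho; field; lra).
  assert (E1 : s = rho * sin om).
  { unfold tan in Htan. unfold rho.
    replace (th / cos om * sin om) with (th * (sin om / cos om)) by (field; lra).
    rewrite Htan. field. lra. }
  assert (E3 : rho * rho = s * s + th * th).
  { assert (H := sin2_cos2 om). unfold Rsqr in H.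
    transitivity (rho * rho * (sin om * sin om + cos om * cos om)); [rewrite H; ring|].
    transitivity (rho * sin om * (rho * sin om) + rho * cos om * (rho * cos om)); [ring|].
    now rewrite <- E1, <- E2. }
  exists rho, om. rewrite cos_shift, sin_shift.
  repeat split; auto; try lra; nra.
Qed.

Lemma cos_1_ge_half (x : R) : 0 <= x <= 1 -> 1 / 2 <= cos x.
Proof.
  intros Hx. rewrite <- cos_PI3. assert (H := PI2_3_2).
  apply cos_decr_1; lra.
Qed.

(* With [rho e^(i (pi/2 - om)) = s + i th] the integrals over [0, oo) are
   [(n-1)! rho^-n cos (n om)] and [n! rho^-(n+1) cos ((n+1) om)], as [4] divides [n]. *)
Lemma damped_integral_lower (j : nat) (s th X : R) :
  0 < s -> INR (S (4 * j)) * s <= th -> 0 <= X ->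
  let n := (4 * j)%nat in
  (0 < n)%nat ->
  - damped_tail s (pred n) X <= RInt (fun x => x ^ pred n * damped s th 0 x) 0 X /\
  INR (Factorial.fact n) / 2 / (s + th) ^ S n - damped_tail s n X
    <= RInt (fun x => x ^ n * damped s th (- (PI / 2)) x) 0 X.
Proof.
  intros Hs Hth HX n Hn. fold n in Hth.
  assert (HnR := pos_INR n). rewrite S_INR in Hth.
  assert (Hth0 : 0 < th) by nra.
  destruct (polar_complement s th Hs Hth0) as (rho & om & Hom & Hsr & Htr & Hrst & Es & Eth).
  assert (Hrho : 0 < rho) by lra.
  assert (Hom1 : 0 <= (INR n + 1) * om <= 1).
  { split; [apply Rmult_le_pos; lra|].
    apply Rle_trans with ((INR n + 1) * (s / th)); [apply Rmult_le_compat_l; lra|].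
    apply Rmult_le_reg_r with th; auto.
    replace ((INR n + 1) * (s / th) * th) with ((INR n + 1) * s) by (field; lra). lra. }
  assert (En : INR n * (PI / 2) = 2 * INR j * PI).
  { unfold n. rewrite mult_INR. simpl. field. }
  split.
  - assert (H := damped_integral rho (PI / 2 - om) s th (pred n) 0 X Hs Hsr Es Eth HX).
    replace (S (pred n)) with n in H by lia.
    replace (0 + INR n * (PI / 2 - om)) with (- (INR n * om) + 2 * INR j * PI) in H
      by (rewrite <- En; ring).
    rewrite cos_period, cos_neg in H. apply Rabs_le_between in H.
    assert (Hc : 1 / 2 <= cos (INR n * om)).
    { apply cos_1_ge_half. split; [apply Rmult_le_pos; lra | lra]. }
    assert (0 <= INR (Factorial.fact (pred n)) / rho ^ n * cos (INR n * om)).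
    { apply Rmult_le_pos; [|lra]. left. apply Rdiv_lt_0_compat;
        [apply INR_fact_lt_0 | now apply pow_lt]. }
    lra.
  - assert (H := damped_integral rho (PI / 2 - om) s th n (- (PI / 2)) X Hs Hsr Es Eth HX).
    rewrite (S_INR n) in H.
    replace (- (PI / 2) + (INR n + 1) * (PI / 2 - om))
      with (- ((INR n + 1) * om) + 2 * INR j * PI) in H by (rewrite <- En; ring).
    rewrite cos_period, cos_neg in H. apply Rabs_le_between in H.
    assert (Hc := cos_1_ge_half _ Hom1).
    assert (Hf := INR_fact_lt_0 n).
    assert (Hp : / (s + th) ^ S n <= / rho ^ S n).
    { apply Rinv_le_contravar; [now apply pow_lt|]. apply pow_incr; lra. }
    assert (Hp0 : 0 < / (s + th) ^ S n) by (apply Rinv_0_lt_compat, pow_lt; lra).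
    assert (INR (Factorial.fact n) / 2 / (s + th) ^ S n
            <= INR (Factorial.fact n) / rho ^ S n * cos ((INR n + 1) * om)).
    { unfold Rdiv. rewrite !Rmult_assoc. apply Rmult_le_compat_l; [lra|].
      rewrite Rmult_comm. apply Rmult_le_compat; lra. }
    lra.
Qed.

Lemma damped_tail_nonneg (s : R) (m : nat) (x : R) : 0 < s -> 0 <= x -> 0 <= damped_tail s m x.
Proof.
  intros Hs Hx. assert (Hi : 0 < / s) by now apply Rinv_0_lt_compat.
  assert (Hp : forall k, 0 <= x ^ k / s * exp (- s * x)).
  { intros k. apply Rmult_le_pos; [|left; apply exp_pos].
    apply Rmult_le_pos; [now apply pow_le | lra]. }
  induction m as [|m IH]; cbn [damped_tail]; [specialize (Hp O); lra|].
  apply Rplus_le_le_0_compat; auto. apply Rmult_le_pos; auto.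
  apply Rmult_le_pos; [apply pos_INR | lra].
Qed.

(** Away from the resonance [th = 0] the integral stays bounded as the damping [s] tends to 0, up to
    the tail; this serves the frequencies [tau + r]. *)
Lemma damped_integral_bounded (m : nat) (s th psi X : R) :
  0 < s -> 1 <= th -> 0 <= X ->
  Rabs (RInt (fun x => x ^ m * damped s th psi x) 0 X)
  <= INR (Factorial.fact m) + damped_tail s m X.
Proof.
  intros Hs Hth HX.
  destruct (polar_complement s th Hs ltac:(lra)) as (rho & om & Hom & Hsr & Htr & Hrst & Es & Eth).
  assert (H := damped_integral rho (PI / 2 - om) s th m psi X Hs Hsr Es Eth HX).
  set (q := psi + INR (S m) * (PI / 2 - om)) in *.
  set (I := RInt _ 0 X) in *.
  assert (Hf := INR_fact_lt_0 m).
  assert (Hq : Rabs (INR (Factorial.fact m) / rho ^ S m * cos q) <= INR (Factorial.fact m)).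
  { assert (H1 : 1 <= rho ^ S m) by (apply pow_R1_Rle; lra).
    assert (H2 : 0 < / rho ^ S m <= 1).
    { split; [apply Rinv_0_lt_compat; lra|]. rewrite <- Rinv_1. apply Rinv_le_contravar; lra. }
    assert (Hc : Rabs (cos q) <= 1) by (apply Rabs_le, COS_bound).
    unfold Rdiv. rewrite !Rabs_mult, (Rabs_pos_eq (INR _)), (Rabs_pos_eq (/ _)) by lra.
    rewrite Rmult_assoc. rewrite <- (Rmult_1_r (INR (Factorial.fact m))) at 2.
    apply Rmult_le_compat_l; [lra|]. rewrite <- (Rmult_1_r 1).
    apply Rmult_le_compat; try lra. apply Rabs_pos. }
  replace I with ((I - INR (Factorial.fact m) / rho ^ S m * cos q)
                  + INR (Factorial.fact m) / rho ^ S m * cos q) by ring.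
  eapply Rle_trans; [apply Rabs_triang|]. lra.
Qed.

Lemma RInt_linear (f g : R -> R) (A B X : R) :
  (forall x, continuous f x) -> (forall x, continuous g x) ->
  (forall x, continuous (fun x => A * f x + B * g x) x) /\
  RInt (fun x => A * f x + B * g x) 0 X = A * RInt f 0 X + B * RInt g 0 X.
Proof.
  intros Hf Hg. split.
  - intros x. apply (@continuous_plus R_UniformSpace R_AbsRing R_NormedModule);
      apply (@continuous_scal_r R_UniformSpace R_AbsRing R_NormedModule); auto.
  - apply is_RInt_unique.
    apply (@is_RInt_plus R_NormedModule); apply (@is_RInt_scal R_NormedModule);
      apply (@RInt_correct R_CompleteNormedModule); now apply ex_RInt_of_continuous.
Qed.

Lemma continuous_pow_damped (m : nat) (s th psi x : R) :
  continuous (fun x => x ^ m * damped s th psi x) x.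
Proof.
  apply (@ex_derive_continuous R_AbsRing R_NormedModule). unfold damped. auto_derive. exact I.
Qed.

Definition weight (n : nat) (s tau x : R) : R := x ^ pred n * exp (- s * x) * cos (tau * x).

(** Product-to-sum formulas separate the resonant frequency [tau - r] from the harmless [tau + r].
    Sines are written as cosines of phase [- PI / 2], and their factor [x] turns the power [n - 1]
    into [n]. *)
Lemma base_fun_weight (c : R) (n : nat) (s tau r x : R) :
  0 < c -> (0 < n)%nat ->
  base_fun c (r * x) * weight n s tau x =
  1 / 2 * (1 * (x ^ pred n * damped s (tau - r) 0 x) + 1 * (x ^ pred n * damped s (tau + r) 0 x))
  + r / (4 * c) * (1 * (x ^ n * damped s (tau - r) (- (PI / 2)) x)
                   + - 1 * (x ^ n * damped s (tau + r) (- (PI / 2)) x)).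
Proof.
  intros Hc Hn. unfold base_fun, weight, damped.
  destruct n as [|m]; [lia|]. simpl pred. cbn [pow].
  rewrite !Rplus_0_r.
  assert (Hcs : forall z, cos (z + - (PI / 2)) = sin z).
  { intros z. rewrite <- cos_shift, <- cos_neg. f_equal. ring. }
  rewrite !Hcs.
  replace ((tau - r) * x) with (tau * x - r * x) by ring.
  replace ((tau + r) * x) with (tau * x + r * x) by ring.
  rewrite cos_minus, cos_plus, sin_minus, sin_plus. field. lra.
Qed.

Lemma exp_pow (x : R) (k : nat) : exp x ^ k = exp (INR k * x).
Proof.
  induction k as [|k IH]; [simpl; now rewrite Rmult_0_l, exp_0|].
  cbn [pow]. rewrite IH, S_INR, <- exp_plus. f_equal. ring.
Qed.

(** The kernel peaks at [r = 1] with height of order [K^(n+1)] and width of order [1/K]; a monomial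
    in [r^2] is placed below it because raising can follow a monomial. With [z = n + 2 + K (1 - r)]
    and [z^(n+1) <= C e^z], one factor [r^K <= e^(-K(1-r))] compensates the exponential, and the
    other, [r^K <= r], supplies the numerator. *)
Lemma kernel_minorant (n : nat) :
  exists c2, 0 < c2 /\ forall K r, (1 <= K)%nat -> 0 <= r <= 1 ->
    c2 * INR K ^ S n * r ^ (2 * K) <= r / ((INR n + 2) / INR K + (1 - r)) ^ S n.
Proof.
  destruct (Rpower_le_exp (INR (S n)) 1) as (C & HC & H); [apply lt_0_INR; lia | lra|].
  assert (He := exp_pos (INR n + 2)).
  assert (HCe : 0 < C * exp (INR n + 2)) by now apply Rmult_lt_0_compat.
  exists (/ (C * exp (INR n + 2))). split; [now apply Rinv_0_lt_compat|].
  intros K r HK Hr. assert (HL : 1 <= INR K) by (apply (le_INR 1); auto).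
  set (L := INR K) in *. assert (Hn := pos_INR n).
  set (z := INR n + 2 + L * (1 - r)).
  assert (Hz : 0 < z) by (unfold z; nra).
  replace ((INR n + 2) / L + (1 - r)) with (z / L) by (unfold z; field; lra).
  assert (Hzn : 0 < z ^ S n) by now apply pow_lt.
  assert (HLn : 0 < L ^ S n) by (apply pow_lt; lra).
  replace (r / (z / L) ^ S n) with (L ^ S n * (r / z ^ S n)).
  2:{ replace ((z / L) ^ S n) with (z ^ S n / L ^ S n)
        by (unfold Rdiv; now rewrite Rpow_mult_distr, pow_inv).
      field. lra. }
  replace (/ (C * exp (INR n + 2)) * L ^ S n * r ^ (2 * K))
    with (L ^ S n * (/ (C * exp (INR n + 2)) * r ^ (2 * K))) by ring.
  apply Rmult_le_compat_l; [lra|].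
  assert (Hzb : z ^ S n <= C * exp (INR n + 2) * exp (L * (1 - r))).
  { rewrite Rmult_assoc, <- exp_plus. fold z. rewrite <- Rpower_pow by auto.
    rewrite <- (Rmult_1_l z) at 2. now apply H. }
  assert (Hrk : r ^ K * exp (L * (1 - r)) <= 1).
  { apply Rle_trans with (exp (r - 1) ^ K * exp (L * (1 - r))).
    - apply Rmult_le_compat_r; [left; apply exp_pos|]. apply pow_incr. split; [lra|].
      assert (H1 := exp_ineq1_le (r - 1)). lra.
    - rewrite exp_pow, <- exp_plus. fold L.
      replace (L * (r - 1) + L * (1 - r)) with 0 by ring. rewrite exp_0. lra. }
  assert (Hr2 : r ^ (2 * K) <= r * r ^ K).
  { replace (2 * K)%nat with (S (K + (K - 1))) by lia. cbn [pow].
    apply Rmult_le_compat_l; [lra|]. rewrite pow_add.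
    assert (H1 : r ^ (K - 1) <= 1) by (rewrite <- (pow1 (K - 1)); apply pow_incr; lra).
    assert (H2 : 0 <= r ^ K) by (apply pow_le; lra). nra. }
  apply Rmult_le_reg_r with (z ^ S n); auto.
  replace (r / z ^ S n * z ^ S n) with r by (field; lra).
  assert (Hrk0 : 0 <= r ^ K) by (apply pow_le; lra).
  apply Rle_trans with (/ (C * exp (INR n + 2)) * (r * r ^ K)
                        * (C * exp (INR n + 2) * exp (L * (1 - r)))).
  - apply Rmult_le_compat; auto; try lra.
    + apply Rmult_le_pos; [left; now apply Rinv_0_lt_compat | apply pow_le; lra].
    + apply Rmult_le_compat_l; auto. left; now apply Rinv_0_lt_compat.
  - replace (/ (C * exp (INR n + 2)) * (r * r ^ K) * (C * exp (INR n + 2) * exp (L * (1 - r))))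
      with (r * (r ^ K * exp (L * (1 - r)))) by (field; lra).
    nra.
Qed.

(** The frequency [1 + (n+1) s] keeps [tau - r >= (n+1) s] for all [r <= 1], exactly what
    [damped_integral_lower] asks. The resonant sine integral gives the main term, the resonant
    cosine integral is nonnegative up to a tail, and the non-resonant ones go into [M0]. *)
Lemma kernel_lower (c : R) (j : nat) :
  0 < c -> (0 < j)%nat ->
  let n := (4 * j)%nat in
  exists c3 M0, 0 < c3 /\ 0 <= M0 /\
    forall K X r, (1 <= K)%nat -> 0 <= X -> 0 <= r <= 1 ->
    let s := / INR K in
    c3 * INR K ^ S n * r ^ (2 * K) - M0
      - (damped_tail s (pred n) X + damped_tail s n X / c)
    <= RInt (fun x => base_fun c (r * x) * weight n s (1 + INR (S n) * s) x) 0 X.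
Proof.
  intros Hc Hj n. assert (Hn : (0 < n)%nat) by (unfold n; lia).
  destruct (kernel_minorant n) as (c2 & Hc2 & Hmin).
  assert (Hf := INR_fact_lt_0 n). assert (Hf' := INR_fact_lt_0 (pred n)).
  assert (Hic : 0 < / c) by now apply Rinv_0_lt_compat.
  exists (INR (Factorial.fact n) / (8 * c) * c2),
    (INR (Factorial.fact (pred n)) + INR (Factorial.fact n) / c).
  assert (Hf8 : 0 < INR (Factorial.fact n) / (8 * c)) by (apply Rdiv_lt_0_compat; lra).
  split; [now apply Rmult_lt_0_compat|]. split; [unfold Rdiv; nra|].
  intros K X r HK HX Hr s.
  assert (HL : 1 <= INR K) by (apply (le_INR 1); auto).
  assert (Hs : 0 < s) by (apply Rinv_0_lt_compat; lra).
  set (tau := 1 + INR (S n) * s).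
  assert (HnR := pos_INR (S n)).
  assert (Hns : 0 <= INR (S n) * s) by (apply Rmult_le_pos; lra).
  set (f1 := fun x => x ^ pred n * damped s (tau - r) 0 x).
  set (f2 := fun x => x ^ pred n * damped s (tau + r) 0 x).
  set (f3 := fun x => x ^ n * damped s (tau - r) (- (PI / 2)) x).
  set (f4 := fun x => x ^ n * damped s (tau + r) (- (PI / 2)) x).
  assert (Ef : RInt (fun x => base_fun c (r * x) * weight n s tau x) 0 X =
    1 / 2 * (1 * RInt f1 0 X + 1 * RInt f2 0 X)
    + r / (4 * c) * (1 * RInt f3 0 X + - 1 * RInt f4 0 X)).
  { assert (C1 : forall x, continuous f1 x) by (intros; apply continuous_pow_damped).
    assert (C2 : forall x, continuous f2 x) by (intros; apply continuous_pow_damped).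
    assert (C3 : forall x, continuous f3 x) by (intros; apply continuous_pow_damped).
    assert (C4 : forall x, continuous f4 x) by (intros; apply continuous_pow_damped).
    destruct (RInt_linear f1 f2 1 1 X C1 C2) as [C12 E12].
    destruct (RInt_linear f3 f4 1 (-1) X C3 C4) as [C34 E34].
    rewrite <- E12, <- E34. etransitivity; [|apply (RInt_linear _ _ _ _ X C12 C34)].
    apply RInt_ext. intros x _. now apply base_fun_weight. }
  rewrite Ef.
  destruct (damped_integral_lower j s (tau - r) X) as [L1 L3]; auto.
  { fold n. unfold tau. lra. }
  fold n in L1, L3. fold f1 in L1. fold f3 in L3.
  assert (B2 := damped_integral_bounded (pred n) s (tau + r) 0 X Hs ltac:(unfold tau; lra) HX).
  assert (B4 := damped_integral_bounded n s (tau + r) (- (PI / 2)) X Hs ltac:(unfold tau; lra) HX).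
  fold f2 in B2. fold f4 in B4. apply Rabs_le_between in B2. apply Rabs_le_between in B4.
  specialize (Hmin K r HK Hr).
  replace ((INR n + 2) / INR K + (1 - r)) with (s + (tau - r)) in Hmin
    by (unfold tau, s; rewrite S_INR; field; lra).
  set (T1 := damped_tail s (pred n) X) in *. set (T2 := damped_tail s n X) in *.
  set (F1 := INR (Factorial.fact (pred n))) in *. set (Fn := INR (Factorial.fact n)) in *.
  set (P := (s + (tau - r)) ^ S n) in *.
  assert (HT2 : 0 <= T2) by now apply damped_tail_nonneg.
  assert (HP : 0 < P) by (apply pow_lt; unfold tau; lra).
  assert (Hrc : 0 <= r / (4 * c) <= / c).
  { unfold Rdiv. rewrite Rinv_mult. split; [apply Rmult_le_pos; [lra|nra]|nra]. }
  assert (H34 : Fn / 2 / P - Fn - 2 * T2 <= 1 * RInt f3 0 X + - 1 * RInt f4 0 X) by lra.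
  apply (Rmult_le_compat_l (r / (4 * c))) in H34; [|lra].
  assert (H5 : Fn / (8 * c) * c2 * INR K ^ S n * r ^ (2 * K) <= r / (4 * c) * (Fn / 2 / P)).
  { replace (r / (4 * c) * (Fn / 2 / P)) with (Fn / (8 * c) * (r / P)) by (field; lra).
    rewrite !Rmult_assoc. apply Rmult_le_compat_l; [lra|].
    rewrite <- Rmult_assoc. exact Hmin. }
  assert (H6 : r / (4 * c) * Fn <= Fn / c) by (unfold Rdiv at 2; nra).
  assert (H7 : r / (4 * c) * (2 * T2) <= T2 / c).
  { replace (r / (4 * c) * (2 * T2)) with (r / 2 * (T2 / c)) by (field; lra).
    assert (0 <= T2 / c) by (unfold Rdiv; nra). nra. }
  lra.
Qed.

(** The lower half of the Gamma-ratio asymptotics. With [t = m + p], the product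
    [raise_mult p d (S m) * t^d] is nondecreasing in [m], because [ln (1 + d/(t+1)) <= d/(t+1) <= d
    ln ((t+1)/t)]. *)
Lemma raise_mult_lower (p d : R) :
  0 < p -> 0 <= d ->
  exists C, 0 < C /\ forall K, (1 <= K)%nat -> C * Rpower (INR K) (- d) <= raise_mult p d K.
Proof.
  intros Hp Hd.
  assert (Hm : forall K, 0 < raise_mult p d K).
  { intros K. apply Rdiv_lt_0_compat; apply poch_pos; lra. }
  set (C0 := raise_mult p d 1 * Rpower p d).
  assert (HC0 : 0 < C0) by (apply Rmult_lt_0_compat; [auto | apply Rpower_pos]).
  assert (Hmon : forall m, C0 <= raise_mult p d (S m) * Rpower (INR m + p) d).
  { induction m as [|m IH]; [rewrite Rplus_0_l; unfold C0; lra|].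
    eapply Rle_trans; [apply IH|].
    assert (Hmp := pos_INR m). set (t := INR m + p) in *.
    assert (Ht : 0 < t) by (unfold t; lra).
    replace (raise_mult p d (S (S m))) with (raise_mult p d (S m) * ((t + 1) / (t + 1 + d))).
    2:{ unfold raise_mult. cbn [poch]. rewrite (S_INR m). unfold t.
        assert (H1 := poch_pos (p + d) m ltac:(lra)). field. lra. }
    replace (INR (S m) + p) with (t + 1) by (unfold t; rewrite S_INR; ring).
    rewrite Rmult_assoc. apply Rmult_le_compat_l; [left; apply Hm|].
    assert (H1 : ln (1 + d / (t + 1)) <= d / (t + 1)).
    { assert (Hdt : 0 <= d / (t + 1))
        by (apply Rmult_le_pos; [auto | left; apply Rinv_0_lt_compat; lra]).
      eapply Rle_trans; [apply ln_le_minus_1|]; lra. }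
    assert (H2 : / (t + 1) <= ln (t + 1) - ln t).
    { assert (H := ln_le_minus_1 (t * / (t + 1))
        ltac:(apply Rmult_lt_0_compat; [|apply Rinv_0_lt_compat]; lra)).
      rewrite ln_mult, ln_Rinv in H; try lra; [|apply Rinv_0_lt_compat; lra].
      replace (t * / (t + 1) - 1) with (- / (t + 1)) in H by (field; lra). lra. }
    assert (H3 : ln ((t + 1) / (t + 1 + d)) = - ln (1 + d / (t + 1))).
    { rewrite <- ln_Rinv.
      - f_equal. field. split; lra.
      - assert (0 <= d / (t + 1))
          by (apply Rmult_le_pos; [auto | left; apply Rinv_0_lt_compat; lra]). lra. }
    unfold Rpower. rewrite <- (exp_ln ((t + 1) / (t + 1 + d))) by (apply Rdiv_lt_0_compat; lra).
    rewrite <- exp_plus, H3.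
    assert (H4 : d * ln t <= - ln (1 + d / (t + 1)) + d * ln (t + 1)).
    { assert (d / (t + 1) <= d * (ln (t + 1) - ln t)) by (apply Rmult_le_compat_l; auto). lra. }
    destruct H4 as [H4|H4]; [left; now apply exp_increasing | right; now f_equal]. }
  exists (C0 * Rpower (1 + p) (- d)).
  split; [apply Rmult_lt_0_compat; auto; apply Rpower_pos|].
  intros K HK. destruct K as [|m]; [lia|]. specialize (Hmon m).
  assert (Hmp := pos_INR m). rewrite S_INR.
  rewrite Rmult_assoc, Rpower_mult_distr, Rpower_Ropp by lra.
  assert (HR : Rpower (INR m + p) d <= Rpower ((1 + p) * (INR m + 1)) d)
    by (apply Rle_Rpower_l; nra).
  assert (HRp := Rpower_pos ((1 + p) * (INR m + 1)) d).
  apply Rmult_le_reg_r with (Rpower ((1 + p) * (INR m + 1)) d); auto.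
  rewrite Rmult_assoc, Rinv_l, Rmult_1_r by lra.
  eapply Rle_trans; [apply Hmon|]. apply Rmult_le_compat_l; auto. left; apply Hm.
Qed.

(** * Oscillation below the critical line *)

(** Half of the damping is spent on the power; substituting [x = L u] makes the constant independent
    of [L]. *)
Lemma Rpower_exp_scaled (s : R) :
  0 < s -> exists C, 0 < C /\ forall L x, 0 < L -> 0 < x ->
    Rpower x s * exp (- / L * x) <= C * Rpower L s * exp (- (/ (2 * L)) * x).
Proof.
  intros Hs. destruct (Rpower_le_exp s (1 / 2) Hs ltac:(lra)) as (C & HC & H).
  exists C. split; auto. intros L x HL Hx.
  assert (HxL : 0 < x / L) by now apply Rdiv_lt_0_compat.
  specialize (H (x / L) HxL).
  replace x with (L * (x / L)) at 1 by (field; lra).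
  rewrite <- Rpower_mult_distr by auto.
  replace (- (/ (2 * L)) * x) with (1 / 2 * (x / L) + - / L * x) by (field; lra).
  rewrite exp_plus.
  replace (C * Rpower L s * (exp (1 / 2 * (x / L)) * exp (- / L * x)))
    with (Rpower L s * exp (- / L * x) * (C * exp (1 / 2 * (x / L)))) by ring.
  replace (Rpower L s * Rpower (x / L) s * exp (- / L * x))
    with (Rpower L s * exp (- / L * x) * Rpower (x / L) s) by ring.
  apply Rmult_le_compat_l; auto.
  apply Rmult_le_pos; left; [apply Rpower_pos | apply exp_pos].
Qed.

(* [y d/dy] relates [Phi_b] to [Phi_(b+1)], so integration by parts bounds the integral of
   [Phi_b] by pointwise bounds on [Phi_(b+1)]. *)
Lemma weighted_integral_upper (a a' b c : R) (n : nat) :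
  0 < a' < a -> 0 < b -> 0 < c -> nonneg_hyp a b c -> 2 * a' + 1 < INR n ->
  exists C1, 0 <= C1 /\ forall L X, 0 < L -> 0 < X ->
    RInt (fun x => PSeries (hyp a b c) (x ^ 2 / 4) * (x ^ pred n * exp (- / L * x))) 0 X
    <= C1 * Rpower L (INR n - 2 * a').
Proof.
  intros Ha Hb Hc Hn Hna.
  destruct (hyp_power_decay a a' b c Ha Hb Hc Hn) as [K HK].
  set (h := fun x => PSeries (hyp a (b + 1) c) (x ^ 2 / 4)).
  set (f := fun x => PSeries (hyp a b c) (x ^ 2 / 4)).
  set (dh := fun x => x / 2 * dhyp a (b + 1) c (x ^ 2 / 4)).
  assert (Hn1 : nonneg_hyp a (b + 1) c) by (apply nonneg_hyp_raise with b c; auto; lra).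
  assert (Hh0 : forall x, 0 < x -> 0 <= h x) by (intros x Hx; apply Hn1; nra).
  set (K2 := Rpower 4 a' * K).
  assert (Hh : forall x, 0 < x -> Rpower x (2 * a') * h x <= K2).
  { intros x Hx. specialize (HK (x ^ 2 / 4) ltac:(nra)). fold (h x) in HK.
    unfold K2. apply Rle_trans with (Rpower 4 a' * (Rpower (x ^ 2 / 4) a' * h x)).
    - rewrite <- Rmult_assoc, Rpower_mult_distr by nra.
      replace (4 * (x ^ 2 / 4)) with (x * x) by field.
      rewrite <- Rpower_mult_distr, <- Rpower_plus by auto.
      replace (a' + a') with (2 * a') by ring. lra.
    - apply Rmult_le_compat_l; auto. left; apply Rpower_pos. }
  assert (HK2 : 0 <= K2).
  { eapply Rle_trans; [|apply (Hh 1); lra]. rewrite Rpower_1_base, Rmult_1_l. apply Hh0; lra. }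
  assert (Hdh : forall x, is_derive h x (dh x)).
  { intros x. unfold h, dh.
    apply (is_derive_comp (PSeries (hyp a (b + 1) c)) (fun t => t ^ 2 / 4)).
    - apply is_derive_hyp; lra.
    - auto_derive; auto. field. }
  assert (Hrel : forall x, x * dh x = 2 * b * (f x - h x)).
  { intros x. assert (E := hyp_theta_b a b c (x ^ 2 / 4) ltac:(lra) Hb Hc).
    fold (f x) (h x) in E. unfold dh.
    replace (x * (x / 2 * dhyp a (b + 1) c (x ^ 2 / 4)))
      with (2 * (x ^ 2 / 4 * dhyp a (b + 1) c (x ^ 2 / 4))) by field.
    lra. }
  set (s := INR n - 2 * a').
  destruct (Rpower_exp_scaled s ltac:(unfold s; lra)) as (Cs & HCs & Hs).
  destruct (Rpower_exp_scaled (s - 1) ltac:(unfold s; lra)) as (Ct & HCt & Ht).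
  assert (Hpn : exists m, n = S m).
  { destruct n as [|m]; [simpl in Hna; lra | now exists m]. }
  destruct Hpn as [m Em]. rewrite Em. simpl pred.
  assert (HmR : INR n = INR m + 1) by (rewrite Em; apply S_INR).
  assert (Hm0 : (0 < m)%nat) by (apply INR_lt; simpl; lra).
  set (K4 := K2 * (Ct + Cs / (2 * b))).
  assert (HK4 : 0 <= K4).
  { apply Rmult_le_pos; auto. assert (0 < Cs / (2 * b)) by (apply Rdiv_lt_0_compat; lra). lra. }
  exists (K2 * Cs / (2 * b) + 2 * K4).
  split.
  { apply Rplus_le_le_0_compat; [|lra]. apply Rmult_le_pos; [nra|].
    left; apply Rinv_0_lt_compat; lra. }
  intros L X HL HX.
  set (e := fun x => exp (- / L * x)).
  assert (HiL : 0 < / L) by now apply Rinv_0_lt_compat.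
  assert (He : forall x, 0 < e x) by (intros; apply exp_pos).
  assert (HxS : forall x, 0 < x -> x ^ S m * h x * e x <= K2 * Cs * Rpower L s * exp (- / (2 * L) * x)).
  { intros x Hx. rewrite <- Em, <- Rpower_pow by auto.
    replace (INR n) with (2 * a' + s) by (unfold s; ring). rewrite Rpower_plus.
    apply Rle_trans with (K2 * (Rpower x s * e x)).
    - replace (Rpower x (2 * a') * Rpower x s * h x * e x)
        with (Rpower x (2 * a') * h x * (Rpower x s * e x)) by ring.
      apply Rmult_le_compat_r; auto.
      apply Rmult_le_pos; left; [apply Rpower_pos | auto].
    - replace (K2 * Cs * Rpower L s * exp (- / (2 * L) * x))
        with (K2 * (Cs * Rpower L s * exp (- (/ (2 * L)) * x))) by ring.
      apply Rmult_le_compat_l; auto. now apply Hs. }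
  assert (Hxm : forall x, 0 < x ->
            x ^ m * h x * e x <= K2 * Ct * Rpower L (s - 1) * exp (- / (2 * L) * x)).
  { intros x Hx. rewrite <- Rpower_pow by auto.
    replace (INR m) with (2 * a' + (s - 1)) by (unfold s; lra). rewrite Rpower_plus.
    apply Rle_trans with (K2 * (Rpower x (s - 1) * e x)).
    - replace (Rpower x (2 * a') * Rpower x (s - 1) * h x * e x)
        with (Rpower x (2 * a') * h x * (Rpower x (s - 1) * e x)) by ring.
      apply Rmult_le_compat_r; auto.
      apply Rmult_le_pos; left; [apply Rpower_pos | auto].
    - replace (K2 * Ct * Rpower L (s - 1) * exp (- / (2 * L) * x))
        with (K2 * (Ct * Rpower L (s - 1) * exp (- (/ (2 * L)) * x))) by ring.
      apply Rmult_le_compat_l; auto. now apply Ht. }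
  assert (ELs : Rpower L s = L * Rpower L (s - 1)).
  { rewrite <- (Rpower_1 L) at 2 by auto. rewrite <- Rpower_plus. f_equal. ring. }
  assert (HLs := Rpower_pos L (s - 1)).
  set (F := fun x => f x * (x ^ m * e x)).
  assert (HFc : forall x, continuous F x).
  { intros x. apply (@continuous_mult R_UniformSpace R_AbsRing).
    - unfold f. apply continuous_PSeries_comp; [apply entire_seq_hyp; lra|].
      apply (@ex_derive_continuous R_AbsRing R_NormedModule). auto_derive. exact I.
    - apply (@ex_derive_continuous R_AbsRing R_NormedModule). unfold e. auto_derive. exact I. }
  (* [V] is the boundary term of the integration by parts. [W] adds to it a function whose
     derivative bounds the two remaining terms of unfavourable sign, those in [x^m h e] and
     [x^(m+1) h e / (2 b L)]. Thus [W' >= F] pointwise, and monotonicity replaces the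
     integration. *)
  set (V := fun x => x ^ S m * e x * h x / (2 * b)).
  set (W := fun x => V x - 2 * K4 * Rpower L s * exp (- / (2 * L) * x)).
  set (dW := fun x => (INR (S m) * x ^ m * e x - x ^ S m * (/ L * e x)) * h x / (2 * b)
                      + x ^ S m * e x * dh x / (2 * b)
                      + K4 * Rpower L (s - 1) * exp (- / (2 * L) * x)).
  assert (HW : forall x, is_derive W x (dW x)).
  { intros x. unfold W, dW, V.
    replace ((INR (S m) * x ^ m * e x - x ^ S m * (/ L * e x)) * h x / (2 * b)
             + x ^ S m * e x * dh x / (2 * b) + K4 * Rpower L (s - 1) * exp (- / (2 * L) * x))
      with (/ (2 * b) * ((INR (S m) * x ^ m * e x - x ^ S m * (/ L * e x)) * h x
                         + x ^ S m * e x * dh x)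
            - 2 * K4 * Rpower L s * (- / (2 * L) * exp (- / (2 * L) * x)))
      by (rewrite ELs; field; lra).
    apply (@is_derive_minus R_AbsRing R_NormedModule).
    - apply (is_derive_ext (fun t => / (2 * b) * (t ^ S m * e t * h t))).
      { intros t. simpl. field. lra. }
      apply (is_derive_scal (fun t => t ^ S m * e t * h t)).
      apply (is_derive_mult (fun t => t ^ S m * e t) h); auto.
      + unfold e. auto_derive; auto.
        change (match m with O => 1 | S _ => INR m + 1 end) with (INR (S m)). cbn [pow]. ring.
      + intros; apply Rmult_comm.
    - apply (is_derive_scal (fun t => exp (- / (2 * L) * t))).
      auto_derive; auto. ring. }
  assert (HFW : forall x, 0 <= x <= X -> F x <= dW x).
  { intros x Hx. unfold F, dW.
    assert (E : (INR (S m) * x ^ m * e x - x ^ S m * (/ L * e x)) * h x / (2 * b)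
                + x ^ S m * e x * dh x / (2 * b)
                = INR (S m) / (2 * b) * (x ^ m * h x * e x)
                  - / L / (2 * b) * (x ^ S m * h x * e x)
                  + x ^ m * e x * (f x - h x)).
    { replace (x ^ S m * e x * dh x / (2 * b)) with (x ^ m * e x / (2 * b) * (x * dh x))
        by (cbn [pow]; field; lra).
      rewrite Hrel. field. lra. }
    rewrite E. clear E.
    destruct (proj1 Hx) as [Hx0|<-].
    - specialize (HxS x Hx0). specialize (Hxm x Hx0).
      assert (Hpx : 0 <= x ^ m * h x * e x).
      { apply Rmult_le_pos; [apply Rmult_le_pos; auto; apply pow_le; lra | left; auto]. }
      assert (HSm : 0 <= INR (S m) / (2 * b)).
      { apply Rmult_le_pos; [apply pos_INR | left; apply Rinv_0_lt_compat; lra]. }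
      assert (H1 : 0 <= INR (S m) / (2 * b) * (x ^ m * h x * e x)) by now apply Rmult_le_pos.
      assert (H2 : / L / (2 * b) * (x ^ S m * h x * e x)
                   <= / L / (2 * b) * (K2 * Cs * Rpower L s * exp (- / (2 * L) * x))).
      { apply Rmult_le_compat_l; auto.
        apply Rmult_le_pos; [lra | left; apply Rinv_0_lt_compat; lra]. }
      rewrite ELs in H2.
      replace (/ L / (2 * b) * (K2 * Cs * (L * Rpower L (s - 1)) * exp (- / (2 * L) * x)))
        with (K2 * (Cs / (2 * b)) * Rpower L (s - 1) * exp (- / (2 * L) * x)) in H2
        by (field; lra).
      unfold K4. lra.
    - rewrite pow_i by lia. rewrite pow_i by lia.
      assert (0 <= K4 * Rpower L (s - 1) * exp (- / (2 * L) * 0)).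
      { apply Rmult_le_pos; [|left; apply exp_pos]. apply Rmult_le_pos; lra. }
      lra. }
  assert (Hmono : W 0 - RInt F 0 0 <= W X - RInt F 0 X).
  { apply (nondecreasing_of_derive (fun x => W x - RInt F 0 x) (fun x => dW x - F x)); [lra| |].
    - intros x _. apply (@is_derive_minus R_AbsRing R_NormedModule W); auto.
      apply (@is_derive_RInt R_NormedModule F (RInt F 0) 0); auto.
      exists (mkposreal 1 Rlt_0_1). intros t _.
      apply (@RInt_correct R_CompleteNormedModule). now apply ex_RInt_of_continuous.
    - intros x Hx. specialize (HFW x Hx). lra. }
  rewrite RInt_point in Hmono. change (@zero R_CompleteNormedModule) with 0 in Hmono.
  unfold W, V in Hmono. rewrite pow_i in Hmono by lia.
  assert (HV : X ^ S m * e X * h X / (2 * b) <= K2 * Cs / (2 * b) * Rpower L s).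
  { specialize (HxS X HX).
    replace (X ^ S m * e X * h X / (2 * b)) with (/ (2 * b) * (X ^ S m * h X * e X))
      by (field; lra).
    replace (K2 * Cs / (2 * b) * Rpower L s) with (/ (2 * b) * (K2 * Cs * Rpower L s))
      by (field; lra).
    apply Rmult_le_compat_l; [left; apply Rinv_0_lt_compat; lra|].
    eapply Rle_trans; [apply HxS|].
    rewrite <- (Rmult_1_r (K2 * Cs * Rpower L s)) at 2.
    apply Rmult_le_compat_l.
    - apply Rmult_le_pos; [nra | left; apply Rpower_pos].
    - rewrite <- exp_0. assert (H : - / (2 * L) * X < 0).
      { assert (0 < / (2 * L)) by (apply Rinv_0_lt_compat; lra). nra. }
      left. now apply exp_increasing. }
  rewrite Rmult_0_r, exp_0 in Hmono.
  assert (HE : 0 <= 2 * K4 * Rpower L s * exp (- / (2 * L) * X)).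
  { apply Rmult_le_pos; [|left; apply exp_pos]. apply Rmult_le_pos; [lra | left; apply Rpower_pos]. }
  change (RInt F 0 X <= (K2 * Cs / (2 * b) + 2 * K4) * Rpower L s).
  lra.
Qed.

Lemma continuous_weight (n : nat) (s tau x : R) : continuous (weight n s tau) x.
Proof.
  apply (@ex_derive_continuous R_AbsRing R_NormedModule). unfold weight. auto_derive. exact I.
Qed.

(* [hyp a b c] arises from [hyp (c+1) (1/2) c] by two raising multipliers, each of which
   preserves the lower bound of [kernel_lower], viewed as a power series in [r^2]. *)
Lemma weighted_integral_lower (a b c : R) (j : nat) :
  0 < a < b -> 0 < c -> (0 < j)%nat ->
  let n := (4 * j)%nat in
  exists c4 M0, 0 < c4 /\ 0 <= M0 /\
    forall K, (1 <= K)%nat -> exists X, 0 < X /\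
    c4 * Rpower (INR K) (INR n + 1 - (b + c - a + 1 / 2)) - M0
    <= RInt (fun x => PSeries (hyp a b c) (x ^ 2 / 4)
                      * weight n (/ INR K) (1 + INR (S n) * / INR K) x) 0 X.
Proof.
  intros Hab Hc Hj n.
  destruct (kernel_lower c j Hc Hj) as (c3 & M0 & Hc3 & HM0 & Hker). fold n in Hker.
  destruct (raise_mult_lower (1 / 2) (c + 1 / 2)) as (C1 & HC1 & H1); try lra.
  destruct (raise_mult_lower a (b - a)) as (C2 & HC2 & H2); try lra.
  exists (c3 * (C1 * C2)), (M0 + 1).
  split; [repeat apply Rmult_lt_0_compat; auto|]. split; [lra|].
  intros K HK. assert (HL : 1 <= INR K) by (apply (le_INR 1); auto).
  set (s := / INR K). assert (Hs : 0 < s) by (apply Rinv_0_lt_compat; lra).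
  assert (HX : exists X, 0 < X /\ damped_tail s (pred n) X + damped_tail s n X / c <= 1).
  { destruct (damped_tail_exp s (pred n) Hs) as (D1 & HD1 & HT1).
    destruct (damped_tail_exp s n Hs) as (D2 & HD2 & HT2).
    set (D := D1 + D2 / c).
    assert (HD : 0 <= D2 / c) by (apply Rmult_le_pos; [auto | left; now apply Rinv_0_lt_compat]).
    (* At this [X] the factor [e^(-s X / 2)] equals [e^(-(1+D))], and [u e^(-u) <= 1] bounds both
       tails together by 1. *)
    exists ((1 + D) * (2 / s)).
    assert (HX : 0 < (1 + D) * (2 / s)).
    { apply Rmult_lt_0_compat; [unfold D; lra | apply Rdiv_lt_0_compat; lra]. }
    split; auto. specialize (HT1 _ HX). specialize (HT2 _ HX).
    replace (- (s / 2) * ((1 + D) * (2 / s))) with (- (1 + D)) in HT1, HT2 by (field; lra).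
    assert (He : (1 + D) * exp (- (1 + D)) <= 1).
    { assert (H := exp_ineq1_le (1 + D)). assert (Hp := exp_pos (- (1 + D))).
      assert (E : exp (1 + D) * exp (- (1 + D)) = 1)
        by (rewrite <- exp_plus, Rplus_opp_r; apply exp_0).
      nra. }
    assert (Hp := exp_pos (- (1 + D))).
    assert (HT3 : damped_tail s n ((1 + D) * (2 / s)) / c <= D2 / c * exp (- (1 + D))).
    { replace (D2 / c * exp (- (1 + D))) with (D2 * exp (- (1 + D)) / c) by (field; lra).
      apply Rmult_le_compat_r; auto. left; now apply Rinv_0_lt_compat. }
    unfold D in *. lra. }
  destruct HX as (X & HX & HT). exists X. split; auto.
  set (tau := 1 + INR (S n) * s) in *. set (w := weight n s tau).
  assert (Hw : forall x, continuous w x) by (intros; apply continuous_weight).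
  set (al := fun k => hyp (c + 1) (1 / 2) c k * moment w X k).
  assert (HW : exists W, 0 <= W /\ forall x, 0 <= x <= X -> Rabs (w x) <= W).
  { destruct (continuity_ab_maj (fun x => Rabs (w x)) 0 X ltac:(lra)) as (z & Hz & _).
    - intros x _. apply continuity_pt_filterlim.
      apply (continuous_comp w Rabs); auto. apply continuous_Rabs.
    - exists (Rabs (w z)). split; [apply Rabs_pos | auto]. }
  destruct HW as (W & HW & HWb).
  assert (Hal : entire_seq al).
  { apply (entire_seq_moment _ w X W); auto; try lra. apply entire_seq_hyp; lra. }
  set (A := c3 * INR K ^ S n).
  (* The series of the dilated test integral, minus [A y^K], plus [M0 + 1], where the extra 1 pays
     for the tails. Raising multipliers equal 1 at index 0, so the constant is unchanged while [A]
     is multiplied by [m1 K * m2 K]. *)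
  set (ga := fun k => 1 * al k
     + 1 * ((- 1) * (if Nat.eqb k K then A else 0) + 1 * (if Nat.eqb k 0 then M0 + 1 else 0))).
  assert (Hpt : entire_seq (fun k => (- 1) * (if Nat.eqb k K then A else 0)
                                     + 1 * (if Nat.eqb k 0 then M0 + 1 else 0)))
    by (apply entire_seq_plus; apply entire_seq_scal, entire_seq_single).
  assert (Hga : entire_seq ga) by (apply entire_seq_plus; now apply entire_seq_scal).
  assert (Hga0 : forall y, 0 <= y <= 1 -> 0 <= PSeries ga y).
  { intros y Hy. unfold ga.
    rewrite PSeries_entire_linear, PSeries_entire_linear, !PSeries_single; auto;
      try apply entire_seq_single.
    unfold al. rewrite <- RInt_PSeries_mult; auto; try lra; [|apply entire_seq_hyp; lra].
    set (r := sqrt y).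
    assert (Hr : 0 <= r <= 1).
    { split; [apply sqrt_pos|]. rewrite <- sqrt_1. apply sqrt_le_1_alt; lra. }
    assert (Er : y = r * r) by (unfold r; rewrite sqrt_sqrt; lra).
    assert (H := Hker K X r HK ltac:(lra) Hr). cbv zeta in H. fold s in H. fold tau in H. fold w in H.
    rewrite (RInt_ext _ (fun x => base_fun c (r * x) * w x)).
    - replace (y ^ K) with (r ^ (2 * K)).
      + rewrite pow_O. fold A in H. lra.
      + rewrite pow_mult, Er. f_equal. ring.
    - intros x _. rewrite <- PSeries_hyp_base by auto. do 2 f_equal. rewrite Er. field. }
  assert (Hga00 : 0 <= ga O) by (rewrite <- (PSeries_0 ga); apply Hga0; lra).
  set (m1 := raise_mult (1 / 2) (c + 1 / 2)) in *. set (m2 := raise_mult a (b - a)) in *.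
  assert (Hfin : 0 <= PSeries (fun k => ga k * m1 k * m2 k) 1).
  { apply (PSeries_raise_nonneg (fun k => ga k * m1 k) a (b - a) 1); try lra.
    - apply entire_seq_raise; auto; lra.
    - unfold m1. rewrite raise_mult_0. lra.
    - apply PSeries_raise_nonneg; auto; try lra. intros y Hy; apply Hga0; lra. }
  (* Raising [1/2] to [c + 1] cancels the numerator parameter and leaves a Bessel series; inserting
     [a] above and below and raising the lower one to [b] gives the target. *)
  assert (Hhyp : forall k, hyp (c + 1) (1 / 2) c k * m1 k * m2 k = hyp a b c k).
  { intros k. unfold hyp, m1, m2, raise_mult.
    replace (1 / 2 + (c + 1 / 2)) with (c + 1) by field. replace (a + (b - a)) with b by ring.
    assert (P1 := poch_pos (1 / 2) k ltac:(lra)). assert (P2 := poch_pos (c + 1) k ltac:(lra)).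
    assert (P3 := poch_pos a k ltac:(lra)). assert (P4 := poch_pos b k ltac:(lra)).
    assert (P5 := poch_pos c k ltac:(lra)). assert (Hf := INR_fact_lt_0 k).
    field. lra. }
  set (be := fun k => hyp a b c k * moment w X k).
  assert (Hbe : entire_seq be).
  { apply (entire_seq_moment _ w X W); auto; try lra. apply entire_seq_hyp; lra. }
  rewrite (PSeries_ext _ (fun k => 1 * be k + 1 *
     ((- 1) * (if Nat.eqb k K then A * m1 K * m2 K else 0)
      + 1 * (if Nat.eqb k 0 then M0 + 1 else 0)))) in Hfin.
  2:{ intros k. unfold ga, be, al. rewrite <- Hhyp.
      destruct (Nat.eqb_spec k K) as [E1|]; destruct (Nat.eqb_spec k 0) as [E0|];
        try rewrite <- E1; try ring.
      - lia.
      - rewrite E0. unfold m1, m2. rewrite !raise_mult_0. ring. }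
  rewrite PSeries_entire_linear, PSeries_entire_linear, !PSeries_single in Hfin; auto;
    try apply entire_seq_single;
    try (apply entire_seq_plus; apply entire_seq_scal, entire_seq_single).
  unfold be in Hfin. rewrite <- RInt_PSeries_mult in Hfin; auto; try lra; [|apply entire_seq_hyp; lra].
  rewrite !pow1, !Rmult_1_r, !Rmult_1_l in Hfin.
  rewrite (RInt_ext _ (fun x => PSeries (hyp a b c) (x ^ 2 / 4) * w x)) in Hfin
    by (intros x _; now rewrite Rmult_1_r).
  assert (Hbnd : c3 * (C1 * C2) * Rpower (INR K) (INR n + 1 - (b + c - a + 1 / 2))
                 <= A * m1 K * m2 K).
  { unfold A. rewrite <- Rpower_pow by lra.
    replace (INR n + 1 - (b + c - a + 1 / 2))
      with (INR (S n) + (- (c + 1 / 2) + - (b - a))) by (rewrite S_INR; field).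
    rewrite !Rpower_plus.
    set (P := Rpower (INR K) (INR (S n))). assert (HP : 0 < P) by apply Rpower_pos.
    assert (Q1 := Rpower_pos (INR K) (- (c + 1 / 2))).
    assert (Q2 := Rpower_pos (INR K) (- (b - a))).
    specialize (H1 K HK). specialize (H2 K HK). fold m1 in H1. fold m2 in H2.
    replace (c3 * (C1 * C2) * (P * (Rpower (INR K) (- (c + 1 / 2)) * Rpower (INR K) (- (b - a)))))
      with (c3 * P * ((C1 * Rpower (INR K) (- (c + 1 / 2))) * (C2 * Rpower (INR K) (- (b - a)))))
      by ring.
    rewrite (Rmult_assoc (c3 * P)).
    apply Rmult_le_compat_l; [apply Rmult_le_pos; lra|].
    apply Rmult_le_compat; auto; apply Rmult_le_pos; lra. }
  lra.
Qed.

Lemma hyp_not_nonneg_sum (a b c : R) :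
  0 < a < b -> 0 < c -> b + c < 3 * a + 1 / 2 -> ~ nonneg_hyp a b c.
Proof.
  intros Hab Hc Hbc Hn.
  (* The midpoint of [(b+c-a-1/2)/2] and [a], kept positive by [a/2]. With this choice the exponent
     of the lower bound exceeds that of the upper bound. *)
  set (a' := Rmax (a / 2) ((b + c - a - 1 / 2 + 2 * a) / 4)).
  assert (Ha' : 0 < a' < a /\ b + c - a - 1 / 2 < 2 * a').
  { assert (M1 := Rmax_l (a / 2) ((b + c - a - 1 / 2 + 2 * a) / 4)).
    assert (M2 := Rmax_r (a / 2) ((b + c - a - 1 / 2 + 2 * a) / 4)).
    fold a' in M1, M2. repeat split; try lra.
    unfold a'. apply Rmax_lub_lt; lra. }
  destruct Ha' as [Ha' Hlt].
  destruct (INR_unbounded (2 * a' + 1)) as [j Hj].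
  assert (Hj0 : (0 < j)%nat) by (apply INR_lt; simpl; lra).
  set (n := (4 * j)%nat).
  assert (Hnj : 2 * a' + 1 < INR n).
  { unfold n. rewrite mult_INR. simpl. lra. }
  destruct (weighted_integral_upper a a' b c n Ha' ltac:(lra) Hc Hn Hnj) as (C1 & HC1 & Hup).
  destruct (weighted_integral_lower a b c j Hab Hc Hj0) as (c4 & M0 & Hc4 & HM0 & Hlow).
  fold n in Hlow.
  set (s := INR n + 1 - (b + c - a + 1 / 2)) in *. set (t := INR n - 2 * a') in *.
  assert (Hst : 0 < s - t) by (unfold s, t; lra). assert (Ht : 0 < t) by (unfold t; lra).
  assert (Hmain : forall K, (1 <= K)%nat ->
            c4 * Rpower (INR K) s - M0 <= C1 * Rpower (INR K) t).
  { intros K HK. assert (HL : 1 <= INR K) by (apply (le_INR 1); auto).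
    destruct (Hlow K HK) as (X & HX & HXl).
    eapply Rle_trans; [apply HXl|]. eapply Rle_trans; [|apply (Hup (INR K) X); lra].
    apply RInt_le; [lra| | |].
    - apply ex_RInt_of_continuous. intros x. apply (@continuous_mult R_UniformSpace R_AbsRing).
      + apply continuous_PSeries_comp; [apply entire_seq_hyp; lra|].
        apply (@ex_derive_continuous R_AbsRing R_NormedModule). auto_derive. exact I.
      + apply continuous_weight.
    - apply ex_RInt_of_continuous. intros x. apply (@continuous_mult R_UniformSpace R_AbsRing).
      + apply continuous_PSeries_comp; [apply entire_seq_hyp; lra|].
        apply (@ex_derive_continuous R_AbsRing R_NormedModule). auto_derive. exact I.
      + apply (@ex_derive_continuous R_AbsRing R_NormedModule). auto_derive. exact I.
    (* Assumed nonnegativity enters here: replacing the cosine by 1 can then only increase the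
       integral. *)
    - intros x Hx. apply Rmult_le_compat_l; [apply Hn; nra|].
      unfold weight. rewrite <- (Rmult_1_r (x ^ pred n * exp (- / INR K * x))) at 2.
      apply Rmult_le_compat_l; [|apply COS_bound].
      apply Rmult_le_pos; [apply pow_le; lra | left; apply exp_pos]. }
  (* Once [K^(s-t) >= Q], the left side [c4 K^s] is at least [(M0 + C1 + c4) K^t], and [K^t >= 1]
     contradicts [Hmain]. *)
  set (Q := (M0 + C1) / c4 + 1).
  assert (HQ : 0 < Q).
  { unfold Q. assert (0 <= (M0 + C1) / c4); [|lra].
    apply Rmult_le_pos; [lra | left; now apply Rinv_0_lt_compat]. }
  destruct (INR_unbounded (1 + Rpower Q (/ (s - t)))) as [K HK].
  assert (HRp := Rpower_pos Q (/ (s - t))).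
  assert (HK1 : (1 <= K)%nat) by (apply INR_le; simpl; lra).
  specialize (Hmain K HK1).
  assert (HKt := Rpower_pos (INR K) t).
  assert (HKt1 : 1 <= Rpower (INR K) t).
  { rewrite <- (Rpower_1_base t). apply Rle_Rpower_l; lra. }
  assert (HKs : Rpower (INR K) s = Rpower (INR K) t * Rpower (INR K) (s - t))
    by (rewrite <- Rpower_plus; f_equal; ring).
  assert (HQK : Q <= Rpower (INR K) (s - t)).
  { replace Q with (Rpower (Rpower Q (/ (s - t))) (s - t)).
    - apply Rle_Rpower_l; lra.
    - rewrite Rpower_mult, Rinv_l, Rpower_1; lra. }
  assert (E : c4 * Q = M0 + C1 + c4) by (unfold Q; field; lra).
  assert (c4 * Q * Rpower (INR K) t <= c4 * Rpower (INR K) s).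
  { rewrite HKs, Rmult_assoc. apply Rmult_le_compat_l; [lra|]. nra. }
  rewrite E in H. nra.
Qed.

Lemma hyp_not_nonneg_le (a b c : R) :
  0 < a -> 0 < b <= a -> 0 < c -> ~ nonneg_hyp a b c.
Proof.
  intros Ha Hb Hc H. apply (bessel_not_nonneg a c Ha Hc).
  apply nonneg_hyp_raise with b c; auto; lra.
Qed.

Lemma continuous_Phi (a b c x : R) :
  0 < a -> 0 < b -> 0 < c -> continuity_pt (Phi a b c) x.
Proof.
  intros Ha Hb Hc.
  apply continuity_pt_filterlim.
  apply (continuous_ext (fun t => PSeries (hyp a b c) (t ^ 2 / 4))).
  - intros t. symmetry. apply Phi_PSeries.
  - apply continuous_PSeries_comp; [now apply entire_seq_hyp|].
    apply (@ex_derive_continuous R_AbsRing R_NormedModule). auto_derive. exact I.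
Qed.

(** Positive values come for free, from [Phi = 1] at 0 and continuity; only a negative value has to
    be produced, and the zero lies between the two. *)
Lemma Phi_alternates (a b c : R) :
  0 < a -> 0 < b -> 0 < c -> ~ nonneg_hyp a b c ->
  alternates_in_sign (Phi a b c) /\ exists x, 0 < x /\ Phi a b c x = 0.
Proof.
  intros Ha Hb Hc Hn.
  assert (Hneg : exists y, 0 < y /\ Phi a b c y < 0).
  { apply NNPP. intros H. apply Hn. intros z Hz. apply Rnot_lt_le. intros Hz'.
    apply H. exists (2 * sqrt z). assert (Hs := sqrt_lt_R0 z Hz). split; [lra|].
    rewrite Phi_PSeries. replace ((2 * sqrt z) ^ 2 / 4) with z; auto.
    rewrite <- (sqrt_sqrt z) at 1 by lra. field. }
  destruct Hneg as (y & Hy & Hny).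
  destruct (pos_near_0 (Phi a b c) (y / 2)) as (d & Hd & Hpos); [lra | |  |].
  - now apply continuous_Phi.
  - rewrite Phi_PSeries. replace (0 ^ 2 / 4) with 0 by field.
    rewrite PSeries_0, hyp_0. lra.
  - assert (Hpd := Hpos d ltac:(lra)).
    split; [split; [exists d | exists y]; split; lra|].
    destruct (IVT (fun x => - Phi a b c x) d y) as (x & Hx & E); try lra.
    + intros x. apply continuity_pt_opp. now apply continuous_Phi.
    + exists x. split; lra.
Qed.

Theorem theorem6 (a : R) (ha : 0 < a) :
  (forall b c : R, 0 < b -> 0 < c -> P_a a (b, c) ->
     (forall x, 0 < x -> 0 <= Phi a b c x) /\
     (~ Lambda a (b, c) -> forall x, 0 < x -> 0 < Phi a b c x)) /\
  (forall b c : R, 0 < b -> 0 < c -> N_a a (b, c) ->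
     alternates_in_sign (Phi a b c) /\ (exists x, 0 < x /\ Phi a b c x = 0)).
Proof.
  split; intros b c Hb Hc H.
  - destruct (P_a_bounds a b c H) as (H1 & H2 & H3).
    destruct (nonneg_hyp_region a b c ha H1 H2 H3) as [H4 H5].
    split; [|intros HL]; intros x Hx; rewrite Phi_PSeries.
    + apply H4. nra.
    + apply H5; auto. nra.
  - apply Phi_alternates; auto.
    destruct (N_a_cases a b c ha H) as [Hba|[Hca|Hsum]].
    + apply hyp_not_nonneg_le; auto; lra.
    + intros Hn. apply (hyp_not_nonneg_le a c b); auto; try lra. now apply nonneg_hyp_sym.
    + destruct (Rle_or_lt b a).
      * apply hyp_not_nonneg_le; auto; lra.
      * apply hyp_not_nonneg_sum; auto.
Qed.
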